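(* Let $X$ and $Y$ be infinite dimensional Banach spaces and assume that $\mathcal A(X)$ and $\mathcal A(Y)$ are weakly amenable. Then $\mathcal A(X\oplus Y)$ is weakly amenable if and only if $\mathcal A(X\oplus Y)$ is self-induced and $$\sup\{|\operatorname{tr}(PQ)|:\ P\in\mathcal F(Y,X)_1,\ Q\in\mathcal F(X,Y)_1\}=+\infty.$$
   Context: All Banach spaces are complex. $\mathcal F(X,Y)$ is the space of bounded finite rank operators $X\to Y$, $\mathcal F(X,Y)_1$ its operator-norm closed unit ball, $\mathcal A(X)$ the Banach algebra of approximable operators on $X$ (operator-norm closure of $\mathcal F(X,X)$), and $\operatorname{tr}$ the canonical trace on finite rank operators. A Banach algebra $\mathfrak A$ is weakly amenable if every bounded derivation $\mathfrak A\to\mathfrak A^*$ is inner. $\mathfrak A$ is self-induced if multiplication implements a (topological) isomorphism $\mathfrak A\widehat\otimes_{\mathfrak A}\mathfrak A\to\mathfrak A$, where $\mathfrak A\widehat\otimes_{\mathfrak A}\mathfrak A$ is the quotient of the projective tensor product $\mathfrak A\widehat\otimes\mathfrak A$ by the closed linear span of $\{ab\otimes c-a\otimes bc\}$. *)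

(* Defs.v *)
From HB Require Import structures.
From mathcomp Require Import all_boot all_order all_algebra sesquilinear generic_quotient.
From mathcomp Require Import all_classical all_reals all_analysis.
From mathcomp Require Import complex.

Set Implicit Arguments.
Unset Strict Implicit.
Unset Printing Implicit Defensive.

Import Order.TTheory GRing.Theory Num.Theory.
Import numFieldNormedType.Exports.

Local Open Scope classical_set_scope.
Local Open Scope ring_scope.
Local Open Scope complex_scope.

(* The library norm of a normed module over R[i] takes its (real, nonnegative)
   values in R[i]; [rnorm] is the same norm with values in R, where suprema
   and infima are available. *)
Definition rnorm (R : realType) (V : normedZmodType R[i]) (v : V) : R :=
  complex.Re `|v|.

Section RealNorm.
Variable R : realType.
Implicit Type V : normedZmodType R[i].

Lemma ge0_RRe (z : R[i]) : 0 <= z -> (complex.Re z)%:C = z.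
Proof. by case: z => a b; rewrite lecE /= => /andP[/eqP -> _]. Qed.

Lemma rnormE V (v : V) : (rnorm v)%:C = `|v|.
Proof. exact/ge0_RRe/normr_ge0. Qed.

Lemma rnorm_ge0 V (v : V) : 0 <= rnorm v.
Proof. by rewrite -lecR rnormE normr_ge0. Qed.

Lemma rnorm0 V : rnorm (0 : V) = 0.
Proof. by rewrite /rnorm normr0. Qed.

Lemma rnorm0_eq0 V (v : V) : rnorm v = 0 -> v = 0.
Proof. by move=> v0; apply/normr0_eq0; rewrite -rnormE v0. Qed.

Lemma rnormN V (v : V) : rnorm (- v) = rnorm v.
Proof. by rewrite /rnorm normrN. Qed.

Lemma rnormB V (v w : V) : rnorm (v - w) = rnorm (w - v).
Proof. by rewrite /rnorm distrC. Qed.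

Lemma rnormD V (v w : V) : rnorm (v + w) <= rnorm v + rnorm w.
Proof. by rewrite -lecR rmorphD /= !rnormE ler_normD. Qed.

Lemma rnorm_sub V (u v w : V) : rnorm (u - w) <= rnorm (u - v) + rnorm (v - w).
Proof. by rewrite (le_trans _ (rnormD _ _))// addrA subrK. Qed.

Lemma rnormM (a b : R[i]) : rnorm (a * b) = rnorm a * rnorm b.
Proof. by apply: complexI; rewrite rmorphM /= !rnormE normrM. Qed.

Lemma rnormC (r : R) : 0 <= r -> rnorm r%:C = r.
Proof. by move=> r0; apply: complexI; rewrite rnormE ger0_norm// lecR. Qed.

Lemma rnormZ (V : normedModType R[i]) (a : R[i]) (v : V) :
  rnorm (a *: v) = rnorm a * rnorm v.
Proof. by apply: complexI; rewrite rmorphM /= !rnormE normrZ. Qed.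

Lemma rnorm_sum V (I : Type) (s : seq I) (F : I -> V) :
  rnorm (\sum_(i <- s) F i) <= \sum_(i <- s) rnorm (F i).
Proof.
elim: s => [|i s IH]; first by rewrite !big_nil rnorm0.
by rewrite !big_cons (le_trans (rnormD _ _))// lerD2l.
Qed.

Lemma gt0C (e : R[i]) : 0 < e -> 0 < complex.Re e /\ (complex.Re e)%:C = e.
Proof. by move=> e0; have E := ge0_RRe (ltW e0); split=> //; rewrite -ltcR E. Qed.

Lemma rnorm_cvgP (V : normedModType R[i]) (F : set_system V) (l : V) :
  Filter F -> F --> l <->
    forall e : R, 0 < e -> F [set y | rnorm (l - y) < e].
Proof.
move=> FF; rewrite fcvgrPdist_lt; split=> H e e0.
  have := H e%:C; rewrite ltcR => /(_ e0); apply: filterS => y /=.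
  by rewrite -rnormE ltcR.
have [e0' <-] := gt0C e0; apply: filterS (H _ e0') => y /=.
by rewrite -rnormE ltcR.
Qed.

Lemma rnorm_cauchyP (V : normedModType R[i]) (F : set_system V) :
  ProperFilter F -> cauchy F <->
    forall e : R, 0 < e -> exists2 A, F A &
      forall x y, A x -> A y -> rnorm (x - y) < e.
Proof.
move=> FF; split=> [/cauchyP cF e e0|H].
  have [|x Fx] := cF (e / 2)%:C; first by rewrite ltcR divr_gt0.
  exists (ball x (e / 2)%:C) => // y z; rewrite -ball_normE /ball_ /=.
  rewrite -!rnormE !ltcR => xy xz.
  apply: (le_lt_trans (rnorm_sub _ x _)); rewrite [e]splitr ltrD//.
  by rewrite rnormB.
apply/cauchyP => e /gt0C[e0 <-]; have [A FA HA] := H _ e0.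
have [x Ax] := filter_ex FA; exists x; apply: filterS FA => y Ay.
by rewrite -ball_normE /ball_ /= -rnormE ltcR HA.
Qed.

Lemma rnorm_closureP (V : normedModType R[i]) (A : set V) (v : V) :
  closure A v <-> forall e : R, 0 < e -> exists2 a, A a & rnorm (v - a) < e.
Proof.
split=> [cA e e0|H B].
  have [|a [Aa]] := cA (ball v e%:C).
    by apply: nbhsx_ballx; rewrite ltcR.
  by rewrite -ball_normE /ball_ /= -rnormE ltcR; exists a.
rewrite -nbhs_ballE => -[e /= /gt0C[e0 <-] sB].
have [a Aa va] := H _ e0; exists a; split=> //; apply: sB.
by rewrite -ball_normE /ball_ /= -rnormE ltcR.
Qed.

End RealNorm.

(* Derives the pointed topological structures that the library leaves
   undeclared on products. *)
HB.saturate prod.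

Section ProductComplete.
Variables (R : realType) (U V : completeNormedModType R[i]).

Lemma prod_cauchy_cvg (F : set_system (U * V)%type) :
  ProperFilter F -> cauchy F -> cvg F.
Proof.
move=> FF /rnorm_cauchyP cF.
have normE (p : U * V) : rnorm p.1 <= rnorm p /\ rnorm p.2 <= rnorm p.
  by split; rewrite -lecR !rnormE prod_normE comparable_le_max ?lexx ?orbT//;
     apply: real_comparable; exact: normr_real.
have c1 : cauchy (fst @ F).
  apply/rnorm_cauchyP => e /cF[A FA HA]; exists (fst @` A).
    rewrite /nbhs /=; apply: (@filterS _ F _ A) => // p Ap; by exists p.
  move=> _ _ [p Ap <-] [q Aq <-]; apply: le_lt_trans (HA _ _ Ap Aq).
  by have [] := normE (p - q).
have c2 : cauchy (snd @ F).
  apply/rnorm_cauchyP => e /cF[A FA HA]; exists (snd @` A).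
    rewrite /nbhs /=; apply: (@filterS _ F _ A) => // p Ap; by exists p.
  move=> _ _ [p Ap <-] [q Aq <-]; apply: le_lt_trans (HA _ _ Ap Aq).
  by have [] := normE (p - q).
move/cauchy_cvg/cvg_ex: c1 => [x /= cx]; move/cauchy_cvg/cvg_ex: c2 => [y /= cy].
apply/cvg_ex; exists (x, y) => B [[B1 B2] /= [nB1 nB2] sB].
have F1 : F (fst @^-1` B1) := cx _ nB1.
have F2 : F (snd @^-1` B2) := cy _ nB2.
by apply: filterS (filterI F1 F2) => -[p q] [/= ? ?]; apply: sB.
Qed.

HB.instance Definition _ :=
  Uniform_isComplete.Build (U * V)%type prod_cauchy_cvg.

End ProductComplete.

Section BoundedOperators.
Variable R : realType.
Implicit Types X Y : normedModType R[i].

Definition bounded_map X Y (f : X -> Y) : Prop :=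
  exists M : R, forall x, rnorm (f x) <= M * rnorm x.

Definition bounded_linear X Y : {pred X -> Y} :=
  fun f => `[< linear f /\ bounded_map f >].

Lemma bounded_linearP X Y (f : X -> Y) :
  reflect (linear f /\ bounded_map f) (f \in @bounded_linear X Y).
Proof. exact/asboolP. Qed.

Lemma bounded_linear_subproof X Y : subsemimod_closed (@bounded_linear X Y).
Proof.
have B0 : (0 : X -> Y) \in @bounded_linear X Y.
  apply/asboolP; split=> [a x y|]; first by rewrite /= scaler0 addr0.
  by exists 0 => x; rewrite rnorm0 mul0r.
split; [split=> //|].
  move=> f g /asboolP[lf [M Mf]] /asboolP[lg [N Ng]]; apply/asboolP; split.
    by move=> a x y; rewrite /= !fctE lf lg scalerDr addrACA.
  exists (M + N) => x; rewrite mulrDl (le_trans (rnormD _ _))//.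
  by rewrite lerD.
move=> b f /asboolP[lf [M Mf]]; apply/asboolP; split.
  by move=> a x y; rewrite /= !fctE lf scalerDr !scalerA mulrC.
exists (rnorm b * M) => x; rewrite !fctE rnormZ -mulrA.
by rewrite ler_wpM2l// rnorm_ge0.
Qed.

Record bop X Y := Bop { bop_fun :> X -> Y ; _ : bop_fun \in @bounded_linear X Y }.

HB.instance Definition _ X Y := [isSub for @bop_fun X Y].
HB.instance Definition _ X Y := [Choice of bop X Y by <:].
HB.instance Definition _ X Y :=
  @GRing.SubChoice_isSubLmodule.Build R[i] (X -> Y) (@bounded_linear X Y)
    (bop X Y) (@bounded_linear_subproof X Y).

Lemma bopP X Y (f g : bop X Y) : (forall x, f x = g x) -> f = g.
Proof. by move=> fg; apply/val_inj/funext. Qed.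

Lemma bop_linear X Y (f : bop X Y) : linear f.
Proof. by case: f => f /= /asboolP[]. Qed.

HB.instance Definition _ X Y (f : bop X Y) :=
  GRing.isLinear.Build R[i] X Y *:%R (bop_fun f) (bop_linear f).

Lemma bop_bounded X Y (f : bop X Y) : bounded_map f.
Proof. by case: f => f /= /asboolP[]. Qed.

Lemma bopD X Y (f g : bop X Y) x : (f + g) x = f x + g x.
Proof. by []. Qed.

Lemma bopN X Y (f : bop X Y) x : (- f) x = - f x.
Proof. by []. Qed.

Lemma bopB X Y (f g : bop X Y) x : (f - g) x = f x - g x.
Proof. by []. Qed.

Lemma bopZ X Y a (f : bop X Y) x : (a *: f) x = a *: f x.
Proof. by []. Qed.

Lemma bop0 X Y x : (0 : bop X Y) x = 0.
Proof. by []. Qed.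

Definition op_norm X Y (f : bop X Y) : R :=
  sup [set rnorm (f x) | x in [set x | rnorm x <= 1]].

Lemma op_norm_has_sup X Y (f : bop X Y) :
  has_sup [set rnorm (f x) | x in [set x | rnorm x <= 1]].
Proof.
split; first by exists (rnorm (f 0)), 0 => //=; rewrite rnorm0.
have [M Mf] := bop_bounded f; exists `|M| => _ [x /= x1 <-].
rewrite (le_trans (Mf x))// (le_trans (ler_norm _))// normrM.
by rewrite ler_piMr// ger0_norm ?rnorm_ge0.
Qed.

Lemma op_norm_ge0 X Y (f : bop X Y) : 0 <= op_norm f.
Proof.
apply: le_trans (rnorm_ge0 (f 0)) _; apply: ub_le_sup => /=.
  by have [] := op_norm_has_sup f.
by exists 0 => //=; rewrite rnorm0.
Qed.

Lemma op_normP X Y (f : bop X Y) x : rnorm (f x) <= op_norm f * rnorm x.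
Proof.
have [->|x0] := eqVneq x 0; first by rewrite linear0 !rnorm0 mulr0.
have nx : 0 < rnorm x.
  by rewrite lt_neqAle rnorm_ge0 andbT eq_sym; apply: contra_neq x0 => /rnorm0_eq0.
rewrite -ler_pdivrMr//; apply: ub_le_sup.
  by have [] := op_norm_has_sup f.
exists ((rnorm x)^-1%:C *: x) => /=.
  by rewrite rnormZ rnormC ?invr_ge0 ?rnorm_ge0// mulVf ?gt_eqF.
by rewrite linearZ /= rnormZ rnormC ?invr_ge0 ?rnorm_ge0// mulrC.
Qed.

Lemma op_norm_le X Y (f : bop X Y) (M : R) : 0 <= M ->
  (forall x, rnorm (f x) <= M * rnorm x) -> op_norm f <= M.
Proof.
move=> M0 Mf; apply: ge_sup; first by have [] := op_norm_has_sup f.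
by move=> _ [x /= x1 <-]; rewrite (le_trans (Mf x))// ler_piMr.
Qed.

Lemma op_normD_le X Y (f g : bop X Y) :
  (op_norm (f + g))%:C <= (op_norm f)%:C + (op_norm g)%:C.
Proof.
rewrite -rmorphD /= lecR; apply: op_norm_le => [|x].
  by rewrite addr_ge0 ?op_norm_ge0.
by rewrite bopD (le_trans (rnormD _ _))// mulrDl lerD ?op_normP.
Qed.

Lemma op_normZ_le X Y a (f : bop X Y) :
  op_norm (a *: f) <= rnorm a * op_norm f.
Proof.
apply: op_norm_le => [|x]; first by rewrite mulr_ge0 ?rnorm_ge0 ?op_norm_ge0.
by rewrite bopZ rnormZ -mulrA ler_wpM2l ?rnorm_ge0 ?op_normP.
Qed.

Lemma op_normZ X Y (a : R[i]) (f : bop X Y) :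
  (op_norm (a *: f))%:C = `|a| * (op_norm f)%:C.
Proof.
rewrite -rnormE -rmorphM /=; congr (_%:C); apply/eqP.
rewrite eq_le op_normZ_le /=; have [->|a0] := eqVneq a 0.
  by rewrite rnorm0 mul0r op_norm_ge0.
have ra : 0 < rnorm a.
  by rewrite lt_neqAle rnorm_ge0 andbT eq_sym; apply: contra_neq a0 => /rnorm0_eq0.
rewrite -ler_pdivlMl//; have := op_normZ_le a^-1 (a *: f).
rewrite scalerA mulVf// scale1r => /le_trans; apply.
suff -> : rnorm a^-1 = (rnorm a)^-1 by [].
by apply: complexI; rewrite rnormE normfV fmorphV /= rnormE.
Qed.

Lemma op_norm_eq0 X Y (f : bop X Y) : (op_norm f)%:C = 0 -> f = 0.
Proof.
move=> /complexI f0; apply: bopP => x; apply: rnorm0_eq0; apply/eqP.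
by rewrite eq_le rnorm_ge0 andbT (le_trans (op_normP _ _))// f0 mul0r.
Qed.

HB.instance Definition _ X Y :=
  @Lmodule_isNormed.Build R[i] (bop X Y) (fun f => (op_norm f)%:C)
    (@op_normD_le X Y) (@op_normZ X Y) (@op_norm_eq0 X Y).

Lemma rnorm_bop X Y (f : bop X Y) : rnorm f = op_norm f.
Proof. by []. Qed.

End BoundedOperators.

Section BopComplete.
Variables (R : realType) (X : normedModType R[i]) (Y : completeNormedModType R[i]).

Lemma bop_cauchy_cvg (F : set_system (bop X Y)) :
  ProperFilter F -> cauchy F -> cvg F.
Proof.
move=> FF /rnorm_cauchyP cF.
have pw x : exists y : Y, (fun f : bop X Y => f x) @ F --> y.
  apply/cvg_ex; apply: cauchy_cvg; apply/rnorm_cauchyP => e e0.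
  have x0 : 0 < rnorm x + 1 by rewrite ltr_wpDl ?rnorm_ge0.
  have [|A FA HA] := cF (e / (rnorm x + 1)); first by rewrite divr_gt0.
  exists ((fun f : bop X Y => f x) @` A).
    by rewrite /nbhs /=; apply: (@filterS _ F _ A) => // f Af; exists f.
  move=> _ _ [f Af <-] [g Ag <-]; rewrite -bopB.
  apply: le_lt_trans (op_normP _ _) _; rewrite -rnorm_bop.
  apply: (@le_lt_trans _ _ (rnorm (f - g) * (rnorm x + 1))).
    by rewrite ler_wpM2l ?rnorm_ge0// lerDl.
  by rewrite -ltr_pdivlMr// HA.
have [g gP] := choice pw.
have glin : linear g.
  move=> a x y; have := gP (a *: x + y).
  under eq_fun do rewrite linearP.
  have c1 : (fun f : bop X Y => a *: f x + f y) @ F --> a *: g x + g y.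
    by apply: cvgD; [apply: cvgZl_tmp|]; exact: gP.
  by move=> c2; exact: (cvg_unique (@norm_hausdorff _ Y) c2 c1).
have close (e : R) (A : set (bop X Y)) : F A ->
    (forall f h, A f -> A h -> rnorm (f - h) < e) ->
    forall f x, A f -> rnorm (f x - g x) <= e * rnorm x.
  move=> FA HA f x Af; apply/ler_addgt0Pr => d d0.
  have Fd : F [set h : bop X Y | rnorm (g x - h x) < d].
    by have /rnorm_cvgP/(_ _ d0) := gP x.
  have [h [Ah hd]] := filter_ex (filterI FA Fd).
  rewrite (le_trans (rnorm_sub _ (h x) _))// lerD//; last first.
    by rewrite rnormB ltW.
  rewrite -bopB (le_trans (op_normP _ _))//.
  by rewrite ler_wpM2r ?rnorm_ge0// -rnorm_bop ltW// HA.
have [A1 FA1 HA1] := cF 1 ltr01.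
have [f1 Af1] := filter_ex FA1.
have gb : bounded_map g.
  exists (op_norm f1 + 1) => x.
  rewrite -[g x](subKr (f1 x)) (le_trans (rnormD _ _))// rnormN mulrDl.
  by rewrite lerD ?op_normP// (close 1 A1).
pose G : bop X Y := Bop (introT (bounded_linearP g) (conj glin gb)).
apply/cvg_ex; exists G; apply/rnorm_cvgP => e e0.
have [|A FA HA] := cF (e / 2); first by rewrite divr_gt0.
apply: (@filterS _ F _ A) => // f Af /=; rewrite rnormB rnorm_bop.
apply: (@le_lt_trans _ _ (e / 2)); last by rewrite ltr_pdivrMr// ltr_pMr// ltr1n.
by apply: op_norm_le => [|x]; rewrite ?divr_ge0 ?(ltW e0)//; apply: close HA _ _ Af.
Qed.

HB.instance Definition _ := Uniform_isComplete.Build (bop X Y) bop_cauchy_cvg.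

End BopComplete.

HB.mixin Record CompleteNormedModule_isBanachAlgebra (K : numFieldType) A
    & CompleteNormedModule K A := {
  bmul : A -> A -> A;
  bmulA : associative bmul;
  bmulDl : left_distributive bmul +%R;
  bmulDr : right_distributive bmul +%R;
  bmulZl : forall (k : K) (a b : A), bmul (k *: a) b = k *: bmul a b;
  bmulZr : forall (k : K) (a b : A), bmul a (k *: b) = k *: bmul a b;
  bmul_norm : forall a b : A, `|bmul a b| <= `|a| * `|b|
}.

(* Banach algebras, not necessarily unital. *)
#[short(type="banachAlgebraType")]
HB.structure Definition BanachAlgebra (K : numFieldType) :=
  {A of CompleteNormedModule K A & CompleteNormedModule_isBanachAlgebra K A}.

Notation bdual R X := (@bop R X (R[i]^o)).

Section WeakAmenability.
Variables (R : realType) (A : banachAlgebraType R[i]).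
Implicit Types (a b c : A) (f : bdual R A).

Lemma rnorm_bmul a b : rnorm (bmul a b) <= rnorm a * rnorm b.
Proof. by rewrite -lecR rmorphM /= !rnormE bmul_norm. Qed.

Lemma dual_lact_subproof a f : (fun c => f (bmul c a)) \in @bounded_linear R A R[i]^o.
Proof.
apply/bounded_linearP; split=> [k x y|]; first by rewrite bmulDl bmulZl linearP.
exists (op_norm f * rnorm a) => x; rewrite (le_trans (op_normP _ _))//.
by rewrite -mulrA ler_wpM2l ?op_norm_ge0// mulrC rnorm_bmul.
Qed.

Lemma dual_ract_subproof f a : (fun c => f (bmul a c)) \in @bounded_linear R A R[i]^o.
Proof.
apply/bounded_linearP; split=> [k x y|]; first by rewrite bmulDr bmulZr linearP.
exists (op_norm f * rnorm a) => x; rewrite (le_trans (op_normP _ _))//.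
by rewrite -mulrA ler_wpM2l ?op_norm_ge0// rnorm_bmul.
Qed.

(* The dual Banach A-bimodule: <a.f, c> = <f, ca> and <f.a, c> = <f, ac>. *)
Definition dual_lact a f : bdual R A := Bop (dual_lact_subproof a f).
Definition dual_ract f a : bdual R A := Bop (dual_ract_subproof f a).

Definition derivation (D : bop A (bdual R A)) : Prop :=
  forall a b, D (bmul a b) = dual_lact a (D b) + dual_ract (D a) b.

Definition inner_derivation (D : bop A (bdual R A)) : Prop :=
  exists f : bdual R A, forall a, D a = dual_lact a f - dual_ract f a.

Definition weakly_amenable : Prop :=
  forall D : bop A (bdual R A), derivation D -> inner_derivation D.

End WeakAmenability.

Arguments weakly_amenable {R} A.

Section FiniteRank.
Variable R : realType.
Implicit Types X Y Z : normedModType R[i].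

Definition finitely_spanned X (S : set X) : Prop :=
  exists (n : nat) (e : 'I_n -> X),
    forall x, S x -> exists c : 'I_n -> R[i], x = \sum_(i < n) c i *: e i.

Definition finite_dimensional X : Prop := finitely_spanned [set: X].

Definition finite_rank X Y (T : bop X Y) : Prop := finitely_spanned (range T).

Lemma bcomp_subproof X Y Z (S : bop Y Z) (T : bop X Y) :
  (fun x => S (T x)) \in @bounded_linear R X Z.
Proof.
apply/bounded_linearP; split=> [a x y|]; first by rewrite !linearP.
exists (op_norm S * op_norm T) => x; rewrite (le_trans (op_normP _ _))//.
by rewrite -mulrA ler_wpM2l ?op_norm_ge0 ?op_normP.
Qed.

Definition bcomp X Y Z (S : bop Y Z) (T : bop X Y) : bop X Z :=
  Bop (bcomp_subproof S T).

Lemma bcomp_norm X Y Z (S : bop Y Z) (T : bop X Y) :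
  rnorm (bcomp S T) <= rnorm S * rnorm T.
Proof.
rewrite !rnorm_bop; apply: op_norm_le => [|x].
  by rewrite mulr_ge0 ?op_norm_ge0.
rewrite (le_trans (op_normP S _))//.
by rewrite -mulrA ler_wpM2l ?op_norm_ge0 ?op_normP.
Qed.

Lemma finite_rank0 X Y : finite_rank (0 : bop X Y).
Proof. by exists 0, (fun=> 0) => _ [x _ <-]; exists (fun=> 0); rewrite big_ord0. Qed.

Lemma finite_rankD X Y (S T : bop X Y) :
  finite_rank S -> finite_rank T -> finite_rank (S + T).
Proof.
move=> [n [e He]] [m [f Hf]].
exists (n + m)%N, (fun i => match fintype.split i with inl j => e j | inr j => f j end).
move=> _ [x _ <-]; rewrite bopD.
have [|c ->] := He (S x); first by exists x.
have [|d ->] := Hf (T x); first by exists x.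
exists (fun i => match fintype.split i with inl j => c j | inr j => d j end).
rewrite big_split_ord /=; congr (_ + _); apply: eq_bigr => i _.
  by rewrite (unsplitK (inl i)).
by rewrite (unsplitK (inr i)).
Qed.

Lemma finite_rankZ X Y (a : R[i]) (T : bop X Y) :
  finite_rank T -> finite_rank (a *: T).
Proof.
move=> [n [e He]]; exists n, e => _ [x _ <-].
have [|c Tx] := He (T x); first by exists x.
exists (fun i => a * c i); rewrite bopZ Tx scaler_sumr.
by apply: eq_bigr => i _; rewrite scalerA.
Qed.

Lemma finite_rank_compl X Y Z (S : bop Y Z) (T : bop X Y) :
  finite_rank S -> finite_rank (bcomp S T).
Proof.
by move=> [n [e He]]; exists n, e => _ [x _ <-]; apply: He; exists (T x).
Qed.

Lemma finite_rank_compr X Y Z (S : bop Y Z) (T : bop X Y) :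
  finite_rank T -> finite_rank (bcomp S T).
Proof.
move=> [n [e He]]; exists n, (S \o e) => _ [x _ <-] /=.
have [|c ->] := He (T x); first by exists x.
by exists c; rewrite linear_sum; apply: eq_bigr => i _; rewrite linearZ.
Qed.

Definition finite_rank_ball X Y : set (bop X Y) :=
  [set T | finite_rank T /\ rnorm T <= 1].

End FiniteRank.

Arguments finite_rank_ball {R} X Y.

Section Trace.
Variables (R : realType) (X : normedModType R[i]).

(* The list s = [:: (f_1, x_1); ...] represents the operator
   sum_i f_i(.) x_i. *)
Definition represents (s : seq (bdual R X * X)) (T : X -> X) : Prop :=
  forall z, T z = \sum_(u <- s) u.1 z *: u.2.

(* The canonical trace sum_i f_i(x_i) of T = sum_i f_i(.) x_i; it does not
   depend on the representation by [trE]. *)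
Definition tr (T : bop X X) : R[i] :=
  xget 0 [set t | exists2 s, represents s T & t = \sum_(u <- s) u.1 u.2 ].

Lemma represents0 (s : seq (bdual R X * X)) :
  represents s (fun=> 0) -> \sum_(u <- s) (u.1 u.2 : R[i]) = 0.
Proof.
move: {2}(size s) (erefl (size s)) => n; elim: n s => [|n IH] [|[f x] s]//=.
  by rewrite big_nil.
move=> [sn] H; rewrite big_cons /=.
have [f0|/existsNP[z /eqP fz]] := pselect (forall z, f z = 0).
  rewrite f0 add0r; apply: IH => // z.
  by have := H z; rewrite big_cons /= f0 scale0r add0r.
have xE : x = \sum_(u <- s) (- (f z)^-1 * u.1 z) *: u.2.
  have := H z; rewrite big_cons /= => /esym/eqP; rewrite addr_eq0 => /eqP fx.
  rewrite -[LHS]scale1r -(mulVf fz) -scalerA fx scalerN -scaleNr scaler_sumr.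
  by apply: eq_bigr => u _; rewrite scalerA.
pose k (u : bdual R X * X) : R[i] := - (f z)^-1 * u.1 z.
pose g (u : bdual R X * X) : bdual R X * X := (u.1 + k u *: f, u.2).
pose s' := map g s.
have : \sum_(u <- s') (u.1 u.2 : R[i]) = 0.
  apply: IH => [|w]; first by rewrite size_map.
  have := H w; rewrite big_cons /= => {1}->; rewrite {1}xE scaler_sumr.
  rewrite -big_split /= big_map; apply: eq_bigr => u _.
  have -> : (g u).1 w = u.1 w + k u * f w by [].
  by rewrite scalerDl addrC scalerA [_ * f w]mulrC.
have -> : f x = \sum_(u <- s) k u * f u.2 :> R[i].
  by rewrite {1}xE linear_sum; apply: eq_bigr => u _; rewrite linearZ.
rewrite big_map => s'0; rewrite -[RHS]s'0 -big_split.
by apply: eq_bigr => u _; exact: addrC.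
Qed.

Lemma trE (s : seq (bdual R X * X)) (T : bop X X) :
  represents s T -> tr T = \sum_(u <- s) u.1 u.2.
Proof.
move=> sT; apply: xget_unique; first by exists s.
move=> _ [s' s'T ->]; apply/eqP; rewrite -subr_eq0; apply/eqP.
pose m := [seq (- u.1, u.2) | u <- s].
have <- : \sum_(u <- s' ++ m) (u.1 u.2 : R[i]) =
    \sum_(u <- s') u.1 u.2 - \sum_(u <- s) u.1 u.2.
  by rewrite big_cat /= big_map /= -sumrN.
apply: represents0 => z; rewrite big_cat /= big_map /= -s'T.
have -> : \sum_(u <- s) (- u.1) z *: u.2 = - \sum_(u <- s) u.1 z *: u.2.
  by rewrite -sumrN; apply: eq_bigr => u _; rewrite -scaleNr.
by rewrite -sT subrr.
Qed.

End Trace.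

Section Approximable.
Variables (R : realType) (X : completeNormedModType R[i]).

Definition approximable : {pred bop X X} :=
  fun T => `[< closure [set S : bop X X | finite_rank S] T >].

Lemma approximableP (T : bop X X) :
  reflect (forall e : R, 0 < e -> exists2 S, finite_rank S & rnorm (T - S) < e)
    (T \in approximable).
Proof. by apply: (equivP (asboolP _)); exact: rnorm_closureP. Qed.

Lemma approximable_subproof : subsemimod_closed approximable.
Proof.
split; [split|].
- apply/approximableP => e e0; exists 0; first exact: finite_rank0.
  by rewrite subrr rnorm0.
- move=> S T /approximableP HS /approximableP HT; apply/approximableP => e e0.
  have e2 : 0 < e / 2 by rewrite divr_gt0.
  have [S' fS SS'] := HS _ e2; have [T' fT TT'] := HT _ e2.
  exists (S' + T'); first exact: finite_rankD.
  by rewrite opprD addrACA [e]splitr (le_lt_trans (rnormD _ _))// ltrD.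
move=> a T /approximableP HT; apply/approximableP => e e0.
have a0 : 0 < rnorm a + 1 by rewrite ltr_wpDl ?rnorm_ge0.
have [|T' fT TT'] := HT (e / (rnorm a + 1)); first by rewrite divr_gt0.
exists (a *: T'); first exact: finite_rankZ.
rewrite -scalerBr rnormZ; apply: (@le_lt_trans _ _ ((rnorm a + 1) * rnorm (T - T'))).
  by rewrite ler_wpM2r ?rnorm_ge0// lerDl.
by rewrite -ltr_pdivlMl// mulrC.
Qed.

Record aop := Aop { aop_bop :> bop X X; _ : aop_bop \in approximable }.

HB.instance Definition _ := [isSub for aop_bop].
HB.instance Definition _ := [Choice of aop by <:].
HB.instance Definition _ :=
  @GRing.SubChoice_isSubLmodule.Build R[i] (bop X X) approximable aop
    approximable_subproof.

Lemma aop_normD (S T : aop) :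
  `|aop_bop (S + T)| <= `|aop_bop S| + `|aop_bop T|.
Proof. exact: ler_normD. Qed.

Lemma aop_normZ (a : R[i]) (T : aop) : `|aop_bop (a *: T)| = `|a| * `|aop_bop T|.
Proof. exact: normrZ. Qed.

Lemma aop_norm_eq0 (T : aop) : `|aop_bop T| = 0 -> T = 0.
Proof. by move=> /normr0_eq0 T0; apply: val_inj. Qed.

HB.instance Definition _ :=
  @Lmodule_isNormed.Build R[i] aop (fun T => `|aop_bop T|)
    aop_normD aop_normZ aop_norm_eq0.

Lemma rnorm_aop (T : aop) : rnorm T = rnorm (aop_bop T).
Proof. by []. Qed.

Lemma aop_cauchy_cvg (F : set_system aop) : ProperFilter F -> cauchy F -> cvg F.
Proof.
move=> FF /rnorm_cauchyP cF.
have /cvg_ex[T /rnorm_cvgP FT] : cvg (aop_bop @ F).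
  apply: cauchy_cvg; apply/rnorm_cauchyP => e /cF[A FA HA].
  exists (aop_bop @` A).
    by rewrite /nbhs /=; apply: (@filterS _ F _ A) => // S AS; exists S.
  by move=> _ _ [S AS <-] [S' AS' <-]; exact: HA.
have aT : T \in approximable.
  apply/approximableP => e e0; have e2 : 0 < e / 2 by rewrite divr_gt0.
  have FTe : F [set S : aop | rnorm (T - aop_bop S) < e / 2] := FT _ e2.
  have [[S /= /approximableP aS] /= TS] := filter_ex FTe.
  have [S' fS' SS'] := aS _ e2; exists S' => //.
  by rewrite [e]splitr (le_lt_trans (rnorm_sub _ S _))// ltrD.
apply/cvg_ex; exists (Aop aT); apply/rnorm_cvgP => e e0.
exact: FT _ e0.
Qed.

HB.instance Definition _ := Uniform_isComplete.Build aop aop_cauchy_cvg.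

Lemma approximable_comp (S T : aop) :
  bcomp (aop_bop S) (aop_bop T) \in approximable.
Proof.
case: S T => [S /= /approximableP aS] [T /= /approximableP aT].
apply/approximableP => e e0.
have T0 : 0 < rnorm T + 1 by rewrite ltr_wpDl ?rnorm_ge0.
have [|S' fS' SS'] := aS (e / (rnorm T + 1)); first by rewrite divr_gt0.
exists (bcomp S' T); first exact: finite_rank_compl.
have -> : bcomp S T - bcomp S' T = bcomp (S - S') T by apply: bopP.
apply: le_lt_trans (bcomp_norm _ _) _.
apply: (@le_lt_trans _ _ (rnorm (S - S') * (rnorm T + 1))).
  by rewrite ler_wpM2l ?rnorm_ge0// lerDl.
by rewrite -ltr_pdivlMr.
Qed.

Definition aop_comp (S T : aop) : aop := Aop (approximable_comp S T).

Lemma aop_compA : associative aop_comp.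
Proof. by move=> S T U; apply/val_inj/bopP. Qed.

Lemma aop_compDl : left_distributive aop_comp +%R.
Proof. by move=> S T U; apply/val_inj/bopP. Qed.

Lemma aop_compDr : right_distributive aop_comp +%R.
Proof. move=> S T U; apply/val_inj/bopP => x.
exact: (linearD (bop_fun (aop_bop S)) (T x) (U x)). Qed.

Lemma aop_compZl (k : R[i]) (S T : aop) : aop_comp (k *: S) T = k *: aop_comp S T.
Proof. by apply/val_inj/bopP. Qed.

Lemma aop_compZr (k : R[i]) (S T : aop) : aop_comp S (k *: T) = k *: aop_comp S T.
Proof. apply/val_inj/bopP => x.
exact: (linearZ_LR (bop_fun (aop_bop S)) k (T x)). Qed.

Lemma aop_comp_norm (S T : aop) : `|aop_comp S T| <= `|S| * `|T|.
Proof. by rewrite -!rnormE -rmorphM /= lecR; exact: bcomp_norm. Qed.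

HB.instance Definition _ :=
  CompleteNormedModule_isBanachAlgebra.Build R[i] aop
    aop_compA aop_compDl aop_compDr aop_compZl aop_compZr aop_comp_norm.

End Approximable.

Section Seminorm.
Variable R : realType.

Record seminorm (V : lmodType R[i]) := Seminorm {
  sn :> V -> R;
  sn_triangle : forall x y, sn (x + y) <= sn x + sn y;
  sn_scale : forall (a : R[i]) x, sn (a *: x) = rnorm a * sn x
}.

Variables (V : lmodType R[i]) (p : seminorm V).
Implicit Types x y z : V.

Lemma sn0 : p 0 = 0.
Proof. by rewrite -(scale0r 0) sn_scale rnorm0 mul0r. Qed.

Lemma snN x : p (- x) = p x.
Proof. by rewrite -scaleN1r sn_scale rnormN rnormC ?mul1r. Qed.

Lemma sn_ge0 x : 0 <= p x.
Proof.
have := sn_triangle p x (- x); rewrite subrr sn0 snN -mulr2n.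
by rewrite pmulrn_lge0.
Qed.

Lemma sn_sub x y z : p (x - z) <= p (x - y) + p (y - z).
Proof. by rewrite (le_trans _ (sn_triangle p _ _))// addrA subrK. Qed.

Lemma snB x y : p (x - y) = p (y - x).
Proof. by rewrite -snN opprB. Qed.

Lemma sn_dist x y : `|p x - p y| <= p (x - y).
Proof.
rewrite ler_norml; apply/andP; split.
  rewrite lerNl opprB lerBlDr snB; have := sn_triangle p (y - x) x.
  by rewrite subrK.
by rewrite lerBlDr; have := sn_triangle p (x - y) y; rewrite subrK.
Qed.

Definition sn_eqv x y : bool := `[< p (x - y) = 0 >].

Lemma sn_eqv_equiv : equiv_class_of sn_eqv.
Proof.
split=> [x|x y|y x z]; rewrite /sn_eqv.
- by rewrite subrr sn0; exact/asboolP.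
- by rewrite snB.
move=> /asboolP xy /asboolP yz; apply/asboolP/eqP.
by rewrite eq_le sn_ge0 andbT (le_trans (sn_sub x y z))// xy yz addr0.
Qed.

Canonical sn_eqv_rel : equiv_rel V := EquivRelPack sn_eqv_equiv.

(* The normed space V / {p = 0}. *)
Definition sepquot : Type := {eq_quot sn_eqv_rel}%qT.

HB.instance Definition _ := Choice.on sepquot.
HB.instance Definition _ := EqQuotient.on sepquot.

Definition sepquot_pi : V -> sepquot := \pi_sepquot%qT.

Lemma sepquot_piP x y : sepquot_pi x = sepquot_pi y <-> p (x - y) = 0.
Proof.
split=> [/eqP|xy]; first by rewrite /sepquot_pi eqmodE => /asboolP.
by apply/eqP; rewrite eqmodE; apply/asboolP.
Qed.

Lemma sepquot_reprK (u : sepquot) : sepquot_pi (repr u) = u.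
Proof. exact: reprK. Qed.

Lemma sepquot_repr x : p (repr (sepquot_pi x) - x) = 0.
Proof. exact/sepquot_piP/sepquot_reprK. Qed.

Definition sq_add (u v : sepquot) := sepquot_pi (repr u + repr v).
Definition sq_opp (u : sepquot) := sepquot_pi (- repr u).
Definition sq_scale (a : R[i]) (u : sepquot) := sepquot_pi (a *: repr u).
Definition sq_norm (u : sepquot) : R[i] := (p (repr u))%:C.

Lemma sn_eq0_le x (r : R) : p x <= r -> r = 0 -> p x = 0.
Proof. by move=> xr r0; apply/eqP; rewrite eq_le sn_ge0 andbT -r0. Qed.

Lemma pi_add x y : sq_add (sepquot_pi x) (sepquot_pi y) = sepquot_pi (x + y).
Proof.
apply/sepquot_piP; rewrite opprD addrACA.
by apply: (sn_eq0_le (sn_triangle p _ _)); rewrite !sepquot_repr addr0.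
Qed.

Lemma pi_opp x : sq_opp (sepquot_pi x) = sepquot_pi (- x).
Proof. by apply/sepquot_piP; rewrite -opprD snN sepquot_repr. Qed.

Lemma pi_scale a x : sq_scale a (sepquot_pi x) = sepquot_pi (a *: x).
Proof. by apply/sepquot_piP; rewrite -scalerBr sn_scale sepquot_repr mulr0. Qed.

Lemma sepquot_ind (P : sepquot -> Prop) : (forall x, P (sepquot_pi x)) -> forall u, P u.
Proof. by move=> H u; rewrite -(sepquot_reprK u). Qed.

Lemma sq_addA : associative sq_add.
Proof.
elim/sepquot_ind=> x; elim/sepquot_ind=> y; elim/sepquot_ind=> z.
by rewrite !pi_add addrA.
Qed.

Lemma sq_addC : commutative sq_add.
Proof. by elim/sepquot_ind=> x; elim/sepquot_ind=> y; rewrite !pi_add addrC. Qed.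

Lemma sq_add0 : left_id (sepquot_pi 0) sq_add.
Proof. by elim/sepquot_ind=> x; rewrite pi_add add0r. Qed.

Lemma sq_addN : left_inverse (sepquot_pi 0) sq_opp sq_add.
Proof. by elim/sepquot_ind=> x; rewrite pi_opp pi_add addNr. Qed.

HB.instance Definition _ :=
  GRing.isZmodule.Build sepquot sq_addA sq_addC sq_add0 sq_addN.

Lemma sq_scaleA a b u : sq_scale a (sq_scale b u) = sq_scale (a * b) u.
Proof. by elim/sepquot_ind: u => x; rewrite !pi_scale scalerA. Qed.

Lemma sq_scale1 : left_id 1 sq_scale.
Proof. by elim/sepquot_ind=> x; rewrite pi_scale scale1r. Qed.

Lemma sq_scaleDr : right_distributive sq_scale +%R.
Proof.
move=> a; elim/sepquot_ind=> x; elim/sepquot_ind=> y.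
by rewrite [_ + _]pi_add !pi_scale [RHS]pi_add scalerDr.
Qed.

Lemma sq_scaleDl u : {morph sq_scale^~ u : a b / a + b}.
Proof.
by move=> a b; elim/sepquot_ind: u => x; rewrite !pi_scale [RHS]pi_add scalerDl.
Qed.

HB.instance Definition _ := GRing.Zmodule_isLmodule.Build R[i] sepquot
  sq_scaleA sq_scale1 sq_scaleDr sq_scaleDl.

Lemma sq_norm_pi x : sq_norm (sepquot_pi x) = (p x)%:C.
Proof.
congr (_%:C); apply/eqP; rewrite -subr_eq0 -normr_eq0 eq_le normr_ge0 andbT.
by rewrite (le_trans (sn_dist _ _))// sepquot_repr.
Qed.

Lemma sq_normD u v : sq_norm (u + v) <= sq_norm u + sq_norm v.
Proof.
elim/sepquot_ind: u => x; elim/sepquot_ind: v => y.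
by rewrite [_ + _]pi_add !sq_norm_pi -rmorphD /= lecR sn_triangle.
Qed.

Lemma sq_normZ (a : R[i]) u : sq_norm (a *: u) = `|a| * sq_norm u.
Proof.
elim/sepquot_ind: u => x.
by rewrite [_ *: _]pi_scale !sq_norm_pi sn_scale rmorphM /= rnormE.
Qed.

Lemma sq_norm_eq0 u : sq_norm u = 0 -> u = 0.
Proof.
elim/sepquot_ind: u => x; rewrite sq_norm_pi => /complexI x0.
by apply/sepquot_piP; rewrite subr0.
Qed.

HB.instance Definition _ :=
  @Lmodule_isNormed.Build R[i] sepquot sq_norm sq_normD sq_normZ sq_norm_eq0.

Lemma rnorm_sepquot x : rnorm (sepquot_pi x) = p x.
Proof. by apply: complexI; rewrite rnormE; exact: sq_norm_pi. Qed.

Lemma sepquot_pi_linear : linear sepquot_pi.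
Proof. by move=> a x y; rewrite [X in _ = X + _]pi_scale [RHS]pi_add. Qed.

HB.instance Definition _ :=
  GRing.isLinear.Build R[i] V sepquot *:%R sepquot_pi sepquot_pi_linear.

End Seminorm.

Section SeminormTools.
Variable R : realType.

Lemma sn_scale_of_le (V : lmodType R[i]) (f : V -> R) :
  (forall x, 0 <= f x) -> (forall (a : R[i]) x, f (a *: x) <= rnorm a * f x) ->
  forall (a : R[i]) x, f (a *: x) = rnorm a * f x.
Proof.
move=> f0 fZ a x; apply/eqP; rewrite eq_le fZ /=.
have [->|a0] := eqVneq a 0; first by rewrite rnorm0 mul0r f0.
have ra : 0 < rnorm a.
  by rewrite lt_neqAle rnorm_ge0 andbT eq_sym; apply: contra_neq a0 => /rnorm0_eq0.
have := fZ a^-1 (a *: x); rewrite scalerA mulVf// scale1r => le1.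
rewrite (le_trans (ler_wpM2l (ltW ra) le1))// mulrA -rnormM divff//.
by rewrite rnormC ?mul1r ?ler01.
Qed.

Lemma inf_ge0 (S : set R) : S !=set0 -> (forall x, S x -> 0 <= x) -> 0 <= inf S.
Proof. by move=> S0 Sge; apply: lb_le_inf => // x /Sge. Qed.

Lemma inf_le (S : set R) x : (forall x, S x -> 0 <= x) -> S x -> inf S <= x.
Proof. by move=> Sge Sx; apply: ge_inf => //; exists 0 => y /Sge. Qed.

Lemma inf_near (S : set R) e : S !=set0 -> (forall x, S x -> 0 <= x) -> 0 < e ->
  exists2 x, S x & x < inf S + e.
Proof. by move=> S0 Sge e0; apply: inf_adherent => //; split=> //; exists 0 => y /Sge. Qed.

End SeminormTools.

Section Quotient.
Variables (R : realType) (V : normedModType R[i]).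

Record subspace := Subspace {
  subspace_set :> set V;
  subspace0 : subspace_set 0;
  subspaceD : forall x y, subspace_set x -> subspace_set y -> subspace_set (x + y);
  subspaceZ : forall (a : R[i]) x, subspace_set x -> subspace_set (a *: x)
}.

Definition lin_span (S : set V) : set V := [set x | exists (n : nat)
  (c : 'I_n -> R[i]) (e : 'I_n -> V),
  (forall i, S (e i)) /\ x = \sum_(i < n) c i *: e i].

Lemma lin_span0 S : lin_span S 0.
Proof. by exists 0, (fun=> 0), (fun=> 0); split=> [[]//|]; rewrite big_ord0. Qed.

Lemma lin_spanD S x y : lin_span S x -> lin_span S y -> lin_span S (x + y).
Proof.
move=> [n [c [e [Se ->]]]] [m [d [f [Sf ->]]]].
exists (n + m)%N, (fun i => match fintype.split i with inl j => c j | inr j => d j end),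
  (fun i => match fintype.split i with inl j => e j | inr j => f j end); split.
  by move=> i; case: fintype.split.
rewrite big_split_ord /=; congr (_ + _); apply: eq_bigr => i _.
  by rewrite (unsplitK (inl i)).
by rewrite (unsplitK (inr i)).
Qed.

Lemma lin_spanZ S (a : R[i]) x : lin_span S x -> lin_span S (a *: x).
Proof.
move=> [n [c [e [Se ->]]]]; exists n, (fun i => a * c i), e; split=> //.
by rewrite scaler_sumr; apply: eq_bigr => i _; rewrite scalerA.
Qed.

Lemma closed_span0 S : closure (lin_span S) 0.
Proof. by apply: subset_closure; exact: lin_span0. Qed.

Lemma closed_spanD S x y : closure (lin_span S) x -> closure (lin_span S) y ->
  closure (lin_span S) (x + y).
Proof.
move=> /rnorm_closureP cx /rnorm_closureP cy; apply/rnorm_closureP => e e0.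
have e2 : 0 < e / 2 by rewrite divr_gt0.
have [a Sa xa] := cx _ e2; have [b Sb yb] := cy _ e2.
exists (a + b); first exact: lin_spanD.
by rewrite opprD addrACA [e]splitr (le_lt_trans (rnormD _ _))// ltrD.
Qed.

Lemma closed_spanZ S (a : R[i]) x : closure (lin_span S) x ->
  closure (lin_span S) (a *: x).
Proof.
move=> /rnorm_closureP cx; apply/rnorm_closureP => e e0.
have a0 : 0 < rnorm a + 1 by rewrite ltr_wpDl ?rnorm_ge0.
have [|b Sb xb] := cx (e / (rnorm a + 1)); first by rewrite divr_gt0.
exists (a *: b); first exact: lin_spanZ.
rewrite -scalerBr rnormZ; apply: (@le_lt_trans _ _ ((rnorm a + 1) * rnorm (x - b))).
  by rewrite ler_wpM2r ?rnorm_ge0// lerDl.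
by rewrite -ltr_pdivlMl// mulrC.
Qed.

Definition closed_span (S : set V) : subspace :=
  Subspace (closed_span0 S) (@closed_spanD S) (@closed_spanZ S).

Variable N : subspace.

Definition dist_sub (v : V) : R := inf [set rnorm (v - n) | n in N].

Lemma dist_sub_neq0 v : [set rnorm (v - n) | n in N] !=set0.
Proof. by exists (rnorm (v - 0)), 0 => //; exact: subspace0. Qed.

Lemma dist_sub_elt_ge0 v x : [set rnorm (v - n) | n in N] x -> 0 <= x.
Proof. by move=> [n _ <-]; exact: rnorm_ge0. Qed.

Lemma dist_sub_ge0 v : 0 <= dist_sub v.
Proof. by apply: inf_ge0; [exact: dist_sub_neq0 | exact: dist_sub_elt_ge0]. Qed.

Lemma dist_subD v w : dist_sub (v + w) <= dist_sub v + dist_sub w.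
Proof.
apply/ler_addgt0Pr => e e0; have e2 : 0 < e / 2 by rewrite divr_gt0.
have [_ [m Nm <-] vm] := inf_near (dist_sub_neq0 v) (@dist_sub_elt_ge0 v) e2.
have [_ [n Nn <-] wn] := inf_near (dist_sub_neq0 w) (@dist_sub_elt_ge0 w) e2.
apply: (@le_trans _ _ (rnorm (v + w - (m + n)))).
  apply: inf_le; first exact: dist_sub_elt_ge0.
  by exists (m + n) => //; exact: subspaceD.
rewrite opprD addrACA (le_trans (rnormD _ _))// [e]splitr addrACA.
by rewrite lerD// ltW.
Qed.

Lemma dist_subZ (a : R[i]) v : dist_sub (a *: v) <= rnorm a * dist_sub v.
Proof.
apply/ler_addgt0Pr => e e0.
have a0 : 0 < rnorm a + 1 by rewrite ltr_wpDl ?rnorm_ge0.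
have [|_ [n Nn <-] vn] :=
  @inf_near R _ (e / (rnorm a + 1)) (dist_sub_neq0 v) (@dist_sub_elt_ge0 v).
  by rewrite divr_gt0.
apply: (@le_trans _ _ (rnorm (a *: v - a *: n))).
  apply: inf_le; first exact: dist_sub_elt_ge0.
  by exists (a *: n) => //; exact: subspaceZ.
rewrite -scalerBr rnormZ (le_trans (ler_wpM2l (rnorm_ge0 a) (ltW vn)))//.
rewrite mulrDr lerD2l mulrCA ler_piMr ?(ltW e0)//.
by rewrite ler_pdivrMr// mul1r lerDl.
Qed.

Definition dist_sn : seminorm V :=
  Seminorm dist_subD (sn_scale_of_le dist_sub_ge0 dist_subZ).

(* The quotient V / N, with the quotient norm inf_{n in N} |v - n|. *)
Definition quot_space := sepquot dist_sn.
Definition quot_pi : V -> quot_space := @sepquot_pi R V dist_sn.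

End Quotient.

Section Completion.
Variables (R : realType) (V : lmodType R[i]) (p : seminorm V).

Definition sn_cauchy : {pred nat -> V} := fun u => `[< forall e : R, 0 < e ->
  exists N : nat, forall m n, (N <= m)%N -> (N <= n)%N -> p (u m - u n) < e >].

Lemma sn_cauchy_subproof : subsemimod_closed sn_cauchy.
Proof.
split; [split|].
- by apply/asboolP => e e0; exists 0 => m n _ _; rewrite subrr sn0.
- move=> u v /asboolP cu /asboolP cv; apply/asboolP => e e0.
  have e2 : 0 < e / 2 by rewrite divr_gt0.
  have [M HM] := cu _ e2; have [N HN] := cv _ e2.
  exists (maxn M N) => m n; rewrite !geq_max => /andP[Mm Nm] /andP[Mn Nn].
  rewrite !fctE opprD addrACA [e]splitr (le_lt_trans (sn_triangle _ _ _))//.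
  by rewrite ltrD ?HM ?HN.
move=> a u /asboolP cu; apply/asboolP => e e0.
have a0 : 0 < rnorm a + 1 by rewrite ltr_wpDl ?rnorm_ge0.
have [|N HN] := cu (e / (rnorm a + 1)); first by rewrite divr_gt0.
exists N => m n Nm Nn; rewrite !fctE -scalerBr sn_scale.
apply: (@le_lt_trans _ _ ((rnorm a + 1) * p (u m - u n))).
  by rewrite ler_wpM2r ?sn_ge0// lerDl.
by rewrite -ltr_pdivlMl// mulrC HN.
Qed.

Record cseq := CSeq { cseq_fun :> nat -> V; _ : cseq_fun \in sn_cauchy }.

HB.instance Definition _ := [isSub for cseq_fun].
HB.instance Definition _ := [Choice of cseq by <:].
HB.instance Definition _ :=
  @GRing.SubChoice_isSubLmodule.Build R[i] (nat -> V) sn_cauchy cseq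
    sn_cauchy_subproof.

Definition lim_norm (u : cseq) : R := limn (fun n => p (u n)).

Lemma lim_norm_cvg (u : cseq) : cvgn (fun n => p (u n)).
Proof.
case: u => u /= /asboolP cu; apply: cauchy_cvg; apply/cauchyP => e e0.
have [N HN] := cu _ e0; exists (p (u N)); exists N => // n /= Nn.
by rewrite -ball_normE /ball_ /= (le_lt_trans (sn_dist _ _ _))// HN.
Qed.

Lemma lim_normD (u v : cseq) : lim_norm (u + v) <= lim_norm u + lim_norm v.
Proof.
rewrite /lim_norm -limD; [|exact: lim_norm_cvg..].
apply: ler_lim; first exact: lim_norm_cvg.
  by apply: is_cvgD; exact: lim_norm_cvg.
by apply: nearW => n; exact: sn_triangle.
Qed.

Lemma lim_normZ (a : R[i]) (u : cseq) : lim_norm (a *: u) = rnorm a * lim_norm u.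
Proof.
rewrite /lim_norm; apply/cvg_lim => //.
have -> : (fun n => p ((a *: u) n)) = (fun n => rnorm a * p (u n)).
  by apply/funext => n; rewrite -sn_scale.
by apply: cvgMr; exact: lim_norm_cvg.
Qed.

Definition lim_sn : seminorm cseq := Seminorm lim_normD lim_normZ.

(* The completion of (V, p): Cauchy sequences modulo null sequences. *)
Definition completion := sepquot lim_sn.

Lemma const_cauchy (v : V) : (fun=> v) \in sn_cauchy.
Proof. by apply/asboolP => e e0; exists 0 => m n _ _; rewrite subrr sn0. Qed.

Definition completion_in (v : V) : completion := sepquot_pi lim_sn (CSeq (const_cauchy v)).

End Completion.

Section ProjectiveTensor.
Variables (R : realType) (X Y : normedModType R[i]).

Definition bilform := {bilinear X -> Y -> R[i]^o}.

Definition eval_tensor (s : seq (X * Y)) : bilform -> R[i]^o :=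
  fun B => \sum_(z <- s) B z.1 z.2.

Definition is_tensor : {pred bilform -> R[i]^o} :=
  fun t => `[< exists s, t = eval_tensor s >].

Lemma eval_tensor_cat s1 s2 :
  eval_tensor (s1 ++ s2) = eval_tensor s1 + eval_tensor s2.
Proof. by apply/funext => B; rewrite /eval_tensor big_cat. Qed.

Definition scale_seq (a : R[i]) (s : seq (X * Y)) := [seq (a *: z.1, z.2) | z <- s].

Lemma eval_tensor_scale a s : eval_tensor (scale_seq a s) = a *: eval_tensor s.
Proof.
apply/funext => B; rewrite /eval_tensor /scale_seq big_map !fctE scaler_sumr.
by apply: eq_bigr => z _; rewrite /= linearZl_LR.
Qed.

Lemma is_tensor_subproof : subsemimod_closed is_tensor.
Proof.
split; [split|].
- by apply/asboolP; exists [::]; apply/funext => B; rewrite /eval_tensor big_nil.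
- move=> _ _ /asboolP[s1 ->] /asboolP[s2 ->]; apply/asboolP; exists (s1 ++ s2).
  by rewrite eval_tensor_cat.
move=> a _ /asboolP[s ->]; apply/asboolP; exists (scale_seq a s).
by rewrite eval_tensor_scale.
Qed.

(* The algebraic tensor product of X and Y, realized as the space of functions
   on bilinear forms spanned by the evaluations x (x) y : B |-> B x y. *)
Record atensor := ATensor { atensor_fun :> bilform -> R[i]^o;
                            _ : atensor_fun \in is_tensor }.

HB.instance Definition _ := [isSub for atensor_fun].
HB.instance Definition _ := [Choice of atensor by <:].
HB.instance Definition _ :=
  @GRing.SubChoice_isSubLmodule.Build R[i] (bilform -> R[i]^o) is_tensor atensor
    is_tensor_subproof.

Definition seq_weight (s : seq (X * Y)) : R := \sum_(z <- s) rnorm z.1 * rnorm z.2.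

(* The projective norm: infimum of sum_i |x_i| |y_i| over the representations
   t = sum_i x_i (x) y_i. *)
Definition proj_norm (t : atensor) : R :=
  inf [set seq_weight s | s in [set s | atensor_fun t = eval_tensor s]].

Lemma seq_weight_ge0 s : 0 <= seq_weight s.
Proof. by apply: sumr_ge0 => z _; rewrite mulr_ge0 ?rnorm_ge0. Qed.

Lemma proj_norm_neq0 (t : atensor) :
  [set seq_weight s | s in [set s | atensor_fun t = eval_tensor s]] !=set0.
Proof. by case: t => t /= /asboolP[s st]; exists (seq_weight s), s. Qed.

Lemma proj_norm_elt_ge0 (t : atensor) x :
  [set seq_weight s | s in [set s | atensor_fun t = eval_tensor s]] x -> 0 <= x.
Proof. by move=> [s _ <-]; exact: seq_weight_ge0. Qed.

Lemma proj_norm_ge0 (t : atensor) : 0 <= proj_norm t.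
Proof. by apply: inf_ge0; [exact: proj_norm_neq0 | exact: proj_norm_elt_ge0]. Qed.

Lemma proj_normD (t u : atensor) : proj_norm (t + u) <= proj_norm t + proj_norm u.
Proof.
apply/ler_addgt0Pr => e e0; have e2 : 0 < e / 2 by rewrite divr_gt0.
have [_ [r /= tr <-] rt] := inf_near (proj_norm_neq0 t) (@proj_norm_elt_ge0 t) e2.
have [_ [s /= us <-] su] := inf_near (proj_norm_neq0 u) (@proj_norm_elt_ge0 u) e2.
apply: (@le_trans _ _ (seq_weight (r ++ s))).
  apply: inf_le; first exact: proj_norm_elt_ge0.
  by exists (r ++ s) => //=; rewrite eval_tensor_cat -tr -us.
by rewrite /seq_weight big_cat [e]splitr addrACA lerD// ltW.
Qed.

Lemma proj_normZ (a : R[i]) (t : atensor) : proj_norm (a *: t) <= rnorm a * proj_norm t.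
Proof.
apply/ler_addgt0Pr => e e0.
have a0 : 0 < rnorm a + 1 by rewrite ltr_wpDl ?rnorm_ge0.
have [|_ [s /= ts <-] st] :=
  @inf_near R _ (e / (rnorm a + 1)) (proj_norm_neq0 t) (@proj_norm_elt_ge0 t).
  by rewrite divr_gt0.
apply: (@le_trans _ _ (seq_weight (scale_seq a s))).
  apply: inf_le; first exact: proj_norm_elt_ge0.
  by exists (scale_seq a s) => //=; rewrite eval_tensor_scale -ts.
have -> : seq_weight (scale_seq a s) = rnorm a * seq_weight s.
  rewrite /seq_weight /scale_seq big_map mulr_sumr; apply: eq_bigr => z _ /=.
  by rewrite rnormZ mulrA.
rewrite (le_trans (ler_wpM2l (rnorm_ge0 a) (ltW st)))//.
rewrite mulrDr lerD2l mulrCA ler_piMr ?(ltW e0)//.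
by rewrite ler_pdivrMr// mul1r lerDl.
Qed.

Definition proj_sn : seminorm atensor :=
  Seminorm proj_normD (sn_scale_of_le proj_norm_ge0 proj_normZ).

Lemma pure_subproof (x : X) (y : Y) : eval_tensor [:: (x, y)] \in is_tensor.
Proof. by apply/asboolP; exists [:: (x, y)]. Qed.

Definition ptensor := completion proj_sn.
Definition pure (x : X) (y : Y) : ptensor :=
  completion_in proj_sn (ATensor (pure_subproof x y)).

End ProjectiveTensor.

Section SelfInduced.
Variables (R : realType) (A : banachAlgebraType R[i]).

Definition balanced_relations : set (ptensor A A) :=
  [set t | exists a b c : A, t = pure (bmul a b) c - pure a (bmul b c)].

Definition balanced_tensor := quot_space (closed_span balanced_relations).

Definition balanced_pure (a b : A) : balanced_tensor :=
  quot_pi (closed_span balanced_relations) (pure a b).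

(* phi is the map induced by multiplication; it is determined by its values on
   elementary tensors. *)
Definition self_induced : Prop :=
  exists (phi : bop balanced_tensor A) (psi : bop A balanced_tensor),
    [/\ forall a b, phi (balanced_pure a b) = bmul a b,
        cancel phi psi & cancel psi phi].

End SelfInduced.

Arguments self_induced {R} A.

(* Main.v *)
Require Import Defs.
From HB Require Import structures.
From mathcomp Require Import all_boot all_order all_algebra perm sesquilinear.
From mathcomp Require Import all_classical all_reals all_analysis.
From mathcomp Require Import complex ring lra.

(* Let F(Z) be the finite rank operators on Z. Bounded derivations of A(Z) into its dual correspond
   to linear functionals f on F(Z) for which (S, T) |-> f (ST - TS) is bounded, f being determined
   up to a multiple of the trace; so A(Z) is weakly amenable iff each such f differs from a bounded
   functional by a multiple of tr. Dually, A(Z) is self-induced iff f is bounded as soon as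
   (S, T) |-> f (ST) is bounded; the uniform bound comes from the Banach-Steinhaus theorem on the
   dual of the balanced tensor product.

   For Z = X + Y let f be bounded on commutators. The hypotheses on A(X) and A(Y) give multiples
   l tr and l' tr by which the diagonal corners of f differ from bounded functionals; f (PQ - QP)
   being bounded, (l - l') tr (PQ) is bounded, so that l = l' if the supremum is infinite. The
   off-diagonal corners of ST are sums of commutators, hence f - l tr is bounded on products, and it
   is bounded if A(Z) is self-induced. Conversely, a finite supremum makes the trace of the X-corner
   bounded on commutators; by weak amenability the trace would be bounded on F(X) or on F(Y), which
   is impossible in infinite dimension. Hence the supremum is infinite, tr is not bounded on
   products, and a functional bounded on products has to be bounded. *)

Set Implicit Arguments.
Unset Strict Implicit.
Unset Printing Implicit Defensive.

Import Order.TTheory GRing.Theory Num.Theory.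
Import numFieldNormedType.Exports.

Local Open Scope classical_set_scope.
Local Open Scope ring_scope.
Local Open Scope complex_scope.

(** * The Hahn-Banach theorem *)

(** Functionals live on finite rank operators because the trace, which has to be subtracted, does
    not extend continuously to A(Z); density carries the results over to derivations and tensors.
    The obstacle is that X and Y need not have the approximation property: every finite rank
    operator has a finite rank left unit, but of uncontrolled norm. Such units settle algebraic
    identities only, and the estimates have to come from duality. For the same reason the
    unboundedness of the trace cannot be read off projections of small norm. A bounded trace would
    make the identity of X a 2-summing operator; this is refuted by many orthonormal vectors that
    stay long under one contraction from a Euclidean space. They come from a contraction of nearly
    maximal determinant: if it were short on a large subspace, stretching it there and renormalizing
    would increase the determinant too much. The constants 1/4 and 4/5 are matched by (4/5)(1 + 1/4)
    = 1, and 25/32 is the inverse of 2 (4/5)^2. *)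

Section Sublinear.
Variables (R : realType) (V : lmodType R[i]).
Implicit Types (p q : V -> R) (x y v : V).

(** Homogeneity is asked only as an inequality for positive [r], which is easy to check for infima;
    applying it to [r^-1] gives the equality of [sublinearZ]. *)
Definition sublinear q : Prop :=
  (forall x y, q (x + y) <= q x + q y) /\
  (forall (r : R) x, 0 < r -> q (r%:C *: x) <= r * q x).

Lemma sublinearZ q : sublinear q -> forall (r : R) x, 0 <= r -> q (r%:C *: x) = r * q x.
Proof.
move=> [_ qZ] r x; rewrite le_eqVlt => /predU1P[<-|r0].
  rewrite scale0r mul0r; apply/eqP; rewrite eq_le.
  have h (s : R) : 0 < s -> q 0 <= s * q 0 by move=> s0; rewrite -{1}(scaler0 V s%:C) qZ.
  have h2 := h 2 (ltr0n _ 2); have := h 2^-1 _; rewrite invr_gt0 ltr0n => /(_ isT) h3.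
  apply/andP; split; last by move: h2; rewrite mulr_natl mulr2n lerDl.
  have := h3; rewrite ler_pdivlMl// mulr_natl mulr2n -subr_ge0 opprD addrA subrr sub0r.
  by rewrite oppr_ge0.
apply/eqP; rewrite eq_le qZ//= -ler_pdivlMl//.
have := qZ r^-1 (r%:C *: x); rewrite invr_gt0 => /(_ r0).
by rewrite scalerA -rmorphM /= mulVf ?gt_eqF// rmorph1 scale1r.
Qed.

Lemma sublinear0 q : sublinear q -> q 0 = 0.
Proof. by move=> sq; rewrite -(scale0r 0) (sublinearZ sq 0 (lexx 0)) mul0r. Qed.

Lemma sublinearN q x : sublinear q -> - q (- x) <= q x.
Proof. by move=> sq; rewrite lerNl -subr_ge0 opprK -(sublinear0 sq) -{1}(addNr x) sq.1. Qed.

(** For sublinear [q], this is the largest sublinear functional below [q] whose value at [- v] is at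
    most [- q v]. *)
Definition tilt q v x := inf [set q (x + t%:C *: v) - t * q v | t in [set t : R | 0 <= t]].

Lemma tilt_lb q v x : sublinear q ->
  lbound [set q (x + t%:C *: v) - t * q v | t in [set t : R | 0 <= t]] (- q (- x)).
Proof.
move=> sq _ [t /= t0 <-]; rewrite lerBrDr -(sublinearZ sq v t0) addrC lerBlDr.
by rewrite (le_trans _ (sq.1 _ _))// addrAC addrN add0r.
Qed.

Lemma tilt_le q v x (t : R) : sublinear q -> 0 <= t ->
  tilt q v x <= q (x + t%:C *: v) - t * q v.
Proof.
by move=> sq t0; apply: ge_inf; [exists (- q (- x)); exact: tilt_lb | exists t].
Qed.

Lemma le_tilt q v x (c : R) :
  (forall t : R, 0 <= t -> c <= q (x + t%:C *: v) - t * q v) -> c <= tilt q v x.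
Proof.
move=> h; apply: lb_le_inf => [|_ [t /= t0 <-]]; last exact: h.
by eexists; exists 0 => /=.
Qed.

Lemma tilt_sublinear q v : sublinear q -> sublinear (tilt q v).
Proof.
move=> sq; split=> [x y|r x r0].
  rewrite -lerBlDr; apply: le_tilt => t t0; rewrite lerBlDr -lerBlDl.
  apply: le_tilt => s s0; rewrite lerBlDl.
  apply: le_trans (tilt_le v (x + y) sq (addr_ge0 t0 s0)) _.
  rewrite rmorphD /= scalerDl addrACA mulrDl opprD [leRHS]addrACA lerD2r.
  exact: sq.1.
rewrite -ler_pdivrMl//; apply: le_tilt => t t0; rewrite ler_pdivrMl//.
apply: le_trans (tilt_le v _ sq (mulr_ge0 (ltW r0) t0)) _.
by rewrite rmorphM /= -scalerA -scalerDr (sublinearZ sq _ (ltW r0)) mulrBr mulrA.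
Qed.

Lemma tilt_leq q v x : sublinear q -> tilt q v x <= q x.
Proof.
by move=> sq; have := tilt_le v x sq (lexx 0); rewrite scale0r addr0 mul0r subr0.
Qed.

Lemma tiltN q v : sublinear q -> tilt q v (- v) <= - q v.
Proof.
move=> sq; have := tilt_le v (- v) sq ler01.
by rewrite scale1r addNr (sublinear0 sq) mul1r sub0r.
Qed.

Definition sublinear_below p : Type := {q : V -> R | sublinear q /\ forall x, q x <= p x}.

Definition mk_below p q (sq : sublinear q) (qp : forall x, q x <= p x) : sublinear_below p :=
  exist (fun q => sublinear q /\ forall x, q x <= p x) q (conj sq qp).

(* A minimal sublinear functional coincides with all its tilts, hence is odd. *)
Lemma minimal_sublinear p : sublinear p ->
  exists2 u : V -> R, sublinear u /\ (forall x, u x <= p x) & forall x, u (- x) = - u x.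
Proof.
move=> sp; pose below (q r : sublinear_below p) := `[< forall x, sval r x <= sval q x >].
have [||||u umin] := @Zorn (sublinear_below p) below.
- by move=> q; apply/asboolP.
- by move=> q r s /asboolP qr /asboolP rs; apply/asboolP => x; exact: le_trans (rs x) (qr x).
- move=> [q Hq] [r Hr] /asboolP qr /asboolP rq; apply: eq_exist => /=.
  by apply/funext => x; apply/eqP; rewrite eq_le (qr x) (rq x).
- move=> A chain.
  have [[q0 Aq0]|A0] := pselect (exists q0 : sublinear_below p, A q0); last first.
    by exists (mk_below sp (fun x => lexx (p x))) => s As; case: A0; exists s.
  (* The lower bound of the chain is its pointwise infimum; [- p (- x)] bounds each [S x] from
     below, so that the infimum is a genuine one. *)
  pose S x : set R := [set sval q x | q in A].
  have lbS x : lbound (S x) (- p (- x)).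
    move=> _ [[q [sq qp]] _ <-] /=; apply: le_trans (sublinearN x sq).
    by rewrite lerN2.
  have Sle (q : sublinear_below p) x : A q -> inf (S x) <= sval q x.
    by move=> Aq; apply: ge_inf; [exists (- p (- x)) | exists q].
  have leS x c : (forall q : sublinear_below p, A q -> c <= sval q x) -> c <= inf (S x).
    move=> h; apply: lb_le_inf => [|_ [q Aq <-]]; last exact: h.
    by exists (sval q0 x), q0.
  have sS : sublinear (fun x => inf (S x)).
    split=> [x y|r x r0].
      rewrite -lerBlDr; apply: (leS _ _) => q Aq; rewrite lerBlDr -lerBlDl.
      apply: (leS _ _) => r Ar; rewrite lerBlDl.
      (* Subadditivity of the infimum needs a single member of the chain for both points: the
         smaller of [q] and [r]. *)
      have [/asboolP qr|/asboolP rq] := chain q r Aq Ar.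
        apply: le_trans (Sle r _ Ar) (le_trans ((svalP r).1.1 _ _) _).
        by rewrite lerD2r.
      apply: le_trans (Sle q _ Aq) (le_trans ((svalP q).1.1 _ _) _).
      by rewrite lerD2l.
    rewrite -ler_pdivrMl//; apply: (leS _ _) => q Aq; rewrite ler_pdivrMl//.
    by apply: le_trans (Sle q _ Aq) _; exact: (svalP q).1.2.
  have Sp x : inf (S x) <= p x by apply: le_trans (Sle q0 x Aq0) ((svalP q0).2 x).
  by exists (mk_below sS Sp) => s As; apply/asboolP => x /=; exact: Sle.
have [su up] := svalP u; exists (sval u) => // x.
have tp y : tilt (sval u) x y <= p y by apply: le_trans (tilt_leq x y su) (up y).
have tu := umin (mk_below (tilt_sublinear x su) tp).
have {}tu : tilt (sval u) x = sval u.
  by apply: (congr1 sval (tu _)); apply/asboolP => y /=; exact: tilt_leq.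
apply/eqP; rewrite eq_le; apply/andP; split; first by rewrite -{1}tu tiltN.
by rewrite lerNl sublinearN.
Qed.

End Sublinear.

Section HahnBanach.
Variables (R : realType) (V : normedModType R[i]).

Lemma rnorm_sublinear : sublinear (@rnorm R V).
Proof.
split=> [x y|r x r0]; first exact: rnormD.
by rewrite rnormZ rnormC// ltW.
Qed.

Lemma Re_le_rnorm (z : R[i]) : complex.Re z <= rnorm z.
Proof.
rewrite /rnorm normc_def /=; case: z => a b /=.
by rewrite (le_trans (ler_norm _))// -sqrtr_sqr ler_sqrt ?addr_ge0 ?sqr_ge0// lerDl sqr_ge0.
Qed.

Lemma rnorm_Re_eq (z : R[i]) : rnorm z <= complex.Re z -> z = (rnorm z)%:C.
Proof.
move=> zle; have zE : complex.Re z = rnorm z by apply/eqP; rewrite eq_le Re_le_rnorm.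
move: zE; case: z {zle} => a b /= aE; rewrite -aE; congr (_ +i* _).
have : a ^+ 2 = a ^+ 2 + b ^+ 2.
  rewrite {1}aE /rnorm normc_def /= sqr_sqrtr//.
  by rewrite addr_ge0 ?sqr_ge0.
by move=> /eqP; rewrite -subr_eq0 opprD addrA subrr sub0r oppr_eq0 sqrf_eq0 => /eqP.
Qed.

(** Tilting the norm along [v] beforehand forces [u (- v) <= - rnorm v] for the minimal functional
    [u]. Being odd and sublinear, [u] is real linear with [u v = rnorm v], and [f] is the complex
    linear functional with real part [u]. *)
Lemma norming_functional (v : V) :
  exists2 f : bdual R V, forall x, rnorm (f x) <= rnorm x & f v = (rnorm v)%:C.
Proof.
have [u [su ule] uN] := minimal_sublinear (tilt_sublinear v rnorm_sublinear).
have u_le x : u x <= rnorm x by apply: le_trans (ule x) (tilt_leq _ _ rnorm_sublinear).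
have uv : rnorm v <= u v.
  rewrite -lerN2 -uN; apply: le_trans (ule _) (tiltN _ rnorm_sublinear).
have uD x y : u (x + y) = u x + u y.
  apply/eqP; rewrite eq_le su.1 /= -lerN2 opprD -!uN opprD; exact: su.1.
have uZ (r : R) x : u (r%:C *: x) = r * u x.
  have [r0|r0] := leP 0 r; first exact: sublinearZ.
  rewrite -[r]opprK rmorphN /= scaleNr uN (sublinearZ su) ?oppr_ge0 ?ltW//.
  by rewrite !mulNr.
pose f x : R[i]^o := u x +i* (- u ('i *: x)).
have flin : linear f.
  move=> [a b] x y; rewrite /f.
  have aE (c d : R) z : u ((c +i* d) *: z) = c * u z + d * u ('i *: z).
    have -> : c +i* d = c%:C + d%:C * 'i by simpc.
    by rewrite scalerDl uD uZ -scalerA uZ.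
  have iE (c d : R) z : u ('i *: ((c +i* d) *: z)) = c * u ('i *: z) - d * u z.
    rewrite scalerA; have -> : 'i * (c +i* d) = (- d) +i* c :> R[i] by simpc.
    by rewrite aE mulNr addrC.
  rewrite scalerDr !uD aE iE; apply/eqP; rewrite eq_complex /=.
  by rewrite !mulrN opprK opprD opprB eqxx /= [b * _ - _]addrC.
have fle x : rnorm (f x) <= rnorm x.
  have [fx0|fx0] := eqVneq (f x) 0; first by rewrite fx0 rnorm0 rnorm_ge0.
  have nz : (rnorm (f x))%:C != 0 :> R[i].
    by rewrite rnormE normr_eq0.
  (* A rotation of [x] makes the value of [f] real, so that it is a value of [u] at a vector of the
     same norm. *)
  pose a : R[i] := (rnorm (f x))%:C / f x.
  have fa : f (a *: x) = (rnorm (f x))%:C.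
    have := flin a x 0; rewrite addr0 => ->.
    have -> : f 0 = 0 by rewrite /f scaler0 (sublinear0 su) oppr0.
    by rewrite addr0 /GRing.scale /= /a mulfVK.
  have a1 : rnorm a = 1.
    by apply: complexI; rewrite rnormE /a normrM normfV -rnormE -rnormE
        [in X in X / _](rnormC (rnorm_ge0 _)) divff.
  have := congr1 (@complex.Re R) fa; rewrite /= => <-.
  by rewrite (le_trans (u_le _))// rnormZ a1 mul1r.
have fb : f \in @bounded_linear R V R[i]^o.
  by apply/bounded_linearP; split=> //; exists 1 => x; rewrite mul1r.
exists (Bop fb) => //=.
have fv : rnorm v = rnorm (f v).
  by apply/eqP; rewrite eq_le fle (le_trans uv)//= (Re_le_rnorm (f v)).
by rewrite fv; apply: rnorm_Re_eq; rewrite -fv.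
Qed.

End HahnBanach.

(** * Finite rank operators and extension by density *)

Section RankOne.
Variable R : realType.
Implicit Types X Y Z : normedModType R[i].

Lemma rank1_subproof X Y (y : Y) (f : bdual R X) :
  (fun x => f x *: y) \in @bounded_linear R X Y.
Proof.
apply/bounded_linearP; split=> [a u v|]; first by rewrite linearP scalerDl scalerA.
exists (op_norm f * rnorm y) => x.
by rewrite rnormZ mulrAC; apply: ler_wpM2r; [exact: rnorm_ge0 | exact: (op_normP f x)].
Qed.

Definition rank1 X Y (y : Y) (f : bdual R X) : bop X Y := Bop (rank1_subproof y f).

Lemma rank1E X Y (y : Y) (f : bdual R X) x : rank1 y f x = f x *: y.
Proof. by []. Qed.

Lemma finite_rank_rank1 X Y (y : Y) (f : bdual R X) : finite_rank (rank1 y f).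
Proof.
by exists 1%N, (fun=> y) => _ [x _ <-]; exists (fun=> f x); rewrite big_ord1.
Qed.

Lemma rank1_comp X Y Z (y : Y) (f : bdual R X) (z : Z) (g : bdual R Y) :
  bcomp (rank1 z g) (rank1 y f) = g y *: rank1 z f.
Proof.
apply: bopP => x; rewrite bopZ !rank1E /=.
have -> : g (f x *: y) = g y * f x by rewrite linearZ; exact: mulrC.
by rewrite scalerA.
Qed.

Lemma bop_sumE X Y (I : Type) (s : seq I) (F : I -> bop X Y) x :
  (\sum_(i <- s) F i) x = \sum_(i <- s) F i x.
Proof. by elim: s => [|i s IH]; rewrite ?big_nil ?big_cons// bopD IH. Qed.

Lemma finite_rank_sum X Y (I : Type) (s : seq I) (F : I -> bop X Y) :
  (forall i, finite_rank (F i)) -> finite_rank (\sum_(i <- s) F i).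
Proof.
move=> fF; elim: s => [|i s IH]; rewrite ?big_nil ?big_cons; first exact: finite_rank0.
exact: finite_rankD.
Qed.

Lemma bcompDl X Y Z (S S' : bop Y Z) (T : bop X Y) :
  bcomp (S + S') T = bcomp S T + bcomp S' T.
Proof. exact: bopP. Qed.

Lemma bcompDr X Y Z (S : bop Y Z) (T T' : bop X Y) :
  bcomp S (T + T') = bcomp S T + bcomp S T'.
Proof. by apply: bopP => x; exact: (linearD S (T x) (T' x)). Qed.

Lemma bcompZl X Y Z a (S : bop Y Z) (T : bop X Y) : bcomp (a *: S) T = a *: bcomp S T.
Proof. exact: bopP. Qed.

Lemma bcompZr X Y Z a (S : bop Y Z) (T : bop X Y) : bcomp S (a *: T) = a *: bcomp S T.
Proof. by apply: bopP => x; exact: (linearZ_LR S a (T x)). Qed.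

Lemma bcomp0l X Y Z (T : bop X Y) : bcomp (0 : bop Y Z) T = 0.
Proof. exact: bopP. Qed.

Lemma bcomp0r X Y Z (S : bop Y Z) : bcomp S (0 : bop X Y) = 0.
Proof. by apply: bopP => x; exact: (linear0 S). Qed.

Lemma bcompA X Y Z W (S : bop Z W) (T : bop Y Z) (U : bop X Y) :
  bcomp S (bcomp T U) = bcomp (bcomp S T) U.
Proof. exact: bopP. Qed.

End RankOne.

Section Biorthogonal.
Variables (R : realType) (V : normedModType R[i]).
Implicit Types (f : nat -> bdual R V) (b : nat -> V).

(** The families are indexed by [nat] and read only below [n], so that lengthening them changes no
    types. *)
Definition biorth n f b := forall i j, (i < n)%N -> (j < n)%N -> f i (b j) = (i == j)%:R.

Definition bproj n f b : bop V V := \sum_(i < n) rank1 (b i) (f i).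

Lemma bprojE n f b x : bproj n f b x = \sum_(i < n) f i x *: b i.
Proof. by rewrite bop_sumE. Qed.

Lemma finite_rank_bproj n f b : finite_rank (bproj n f b).
Proof. by apply: finite_rank_sum => i; exact: finite_rank_rank1. Qed.

(** A Gram-Schmidt step with Hahn-Banach in place of the inner product: the new vector is
    [y = x - E x], and the new functional is a norming functional of [y] composed with [1 - E] and
    normalized, which vanishes on the old vectors. *)
Lemma biorth_extend n f b x : biorth n f b -> bproj n f b x <> x ->
  exists f' b', [/\ biorth n.+1 f' b', bproj n.+1 f' b' x = x &
    forall z, bproj n f b z = z -> bproj n.+1 f' b' z = z].
Proof.
move=> bfb xE; set E := bproj n f b in xE *.
pose y := x - E x.
have y0 : rnorm y != 0.
  by apply/eqP => /rnorm0_eq0/eqP; rewrite subr_eq0 => /eqP/esym.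
have [g _ gy] := norming_functional y.
pose h : bdual R V := (rnorm y)^-1%:C *: (g - bcomp g E).
have hE z : h z = (rnorm y)^-1%:C * g (z - E z) by rewrite linearB.
have Eb i : (i < n)%N -> E (b i) = b i.
  move=> lin; rewrite bprojE (bigD1 (Ordinal lin)) //= bfb// eqxx scale1r.
  rewrite big1 ?addr0// => j ji; rewrite bfb// -[_ == _ :> nat]/(j == Ordinal lin).
  by rewrite (negbTE ji) scale0r.
have fE i z : (i < n)%N -> f i (E z) = f i z.
  move=> lin; rewrite bprojE linear_sum /= (bigD1 (Ordinal lin)) //= linearZ /= bfb//.
  rewrite eqxx [_ *: _]mulr1 big1 ?addr0// => j ji; rewrite linearZ /= bfb// eq_sym.
  by rewrite -[_ == _ :> nat]/(j == Ordinal lin) (negbTE ji) [_ *: _]mulr0.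
have fy i : (i < n)%N -> f i y = 0 by move=> lin; rewrite linearB /= fE// subrr.
have Ey : E y = 0 by rewrite bprojE big1// => i _; rewrite fy// scale0r.
have hb i : (i < n)%N -> h (b i) = 0 by move=> lin; rewrite hE Eb// subrr linear0 mulr0.
have hy : h y = 1.
  by rewrite hE Ey subr0 gy -rmorphM /= mulVf// rmorph1.
have hx : h x = 1 by rewrite hE -/y gy -rmorphM /= mulVf// rmorph1.
pose f' i := if i == n then h else f i; pose b' i := if i == n then y else b i.
have E'E z : bproj n.+1 f' b' z = E z + h z *: y.
  rewrite !bprojE big_ord_recr /= /f' /b' eqxx; congr (_ + _).
  by apply: eq_bigr => i _; rewrite ltn_eqF.
exists f', b'; split.
- move=> i j; rewrite !ltnS => li lj; rewrite /f' /b'.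
  have [ni|ni] := eqVneq i n; have [nj|nj] := eqVneq j n.
  + by rewrite ni nj eqxx hy.
  + by rewrite hb ?ni ?[n == j]eq_sym ?(negbTE nj)// ltn_neqAle nj.
  + by rewrite fy ?nj ?(negbTE ni)// ltn_neqAle ni.
  + by rewrite bfb// ltn_neqAle ?ni ?nj.
- by rewrite E'E hx scale1r addrC subrK.
- by move=> z Ez; rewrite E'E hE Ez subrr linear0 mulr0 scale0r addr0.
Qed.

(** This provides finite rank left units for finite rank operators. Nothing bounds the norm of the
    projection, so it enters identities but no estimates. *)
Lemma fixing_projection (s : seq V) :
  exists n f b, biorth n f b /\ forall x, x \in s -> bproj n f b x = x.
Proof.
elim: s => [|x s [n [f [b [bfb fix_s]]]]].
  by exists 0%N, (fun=> 0), (fun=> 0); split.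
have [Ex|Ex] := pselect (bproj n f b x = x).
  by exists n, f, b; split=> // z; rewrite inE => /predU1P[->|/fix_s].
have [f' [b' [bfb' Ex' fix']]] := biorth_extend bfb Ex.
by exists n.+1, f', b'; split=> // z; rewrite inE => /predU1P[->|/fix_s/fix'].
Qed.

Lemma infinite_biorth n : ~ finite_dimensional V -> exists f b, biorth n f b.
Proof.
move=> infV; elim: n => [|n [f [b bfb]]]; first by exists (fun=> 0), (fun=> 0).
have [x Ex] : exists x, bproj n f b x <> x.
  apply: contrapT => /forallNP h; apply: infV; exists n, (fun i : 'I_n => b i) => x _.
  by exists (fun i : 'I_n => f i x); rewrite -(bprojE n f b x); apply/esym; apply: contrapT; exact: h.
by have [f' [b' [? _ _]]] := biorth_extend bfb Ex; exists f', b'.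
Qed.

End Biorthogonal.

Section FiniteRankRepresentation.
Variables (R : realType) (X Y : normedModType R[i]).

Lemma finite_rank_fix2 (S T : bop X Y) : finite_rank S -> finite_rank T ->
  exists n f b, bcomp (bproj n f b) S = S /\ bcomp (bproj n f b) T = T.
Proof.
move=> [n [e He]] [m [e' He']].
have [k [f [b [_ fix_s]]]] := fixing_projection
  ([seq e i | i <- enum 'I_n] ++ [seq e' i | i <- enum 'I_m]).
have Ee i : bproj k f b (e i) = e i.
  by apply: fix_s; rewrite mem_cat map_f ?mem_enum.
have Ee' i : bproj k f b (e' i) = e' i.
  by apply: fix_s; rewrite mem_cat orbC map_f ?mem_enum.
exists k, f, b; split; apply: bopP => x /=.
  have [|c ->] := He (S x); first by exists x.
  by rewrite linear_sum; apply: eq_bigr => i _; rewrite linearZ /= Ee.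
have [|c ->] := He' (T x); first by exists x.
by rewrite linear_sum; apply: eq_bigr => i _; rewrite linearZ /= Ee'.
Qed.

Lemma finite_rank_rank1_sum (T : bop X Y) : finite_rank T ->
  exists s : seq (bdual R X * Y), T = \sum_(u <- s) rank1 u.2 u.1.
Proof.
move=> fT; have [n [f [b [ET _]]]] := finite_rank_fix2 fT fT.
exists [seq (bcomp (f i) T, b i) | i : 'I_n <- enum 'I_n]; rewrite -[LHS]ET.
rewrite big_map big_enum /=; apply: bopP => x; rewrite /= bprojE bop_sumE.
exact: eq_bigr.
Qed.

End FiniteRankRepresentation.

(** * Completeness and extension by density *)

Section RapidCompleteness.
Variable R : realType.

(** Completeness tested on sequences with geometric steps: easy to verify on completions and
    quotients, and sufficient for extension by density and for uniform boundedness. *)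
Definition rapidly_complete (W : normedModType R[i]) : Prop :=
  forall u : nat -> W, (forall n, rnorm (u n.+1 - u n) <= 2^-1 ^+ n) ->
  exists l, forall e : R, 0 < e -> exists N, forall n, (N <= n)%N -> rnorm (u n - l) < e.

Lemma half_pow_lt (e : R) : 0 < e -> exists N, forall n, (N <= n)%N -> 2^-1 ^+ n < e.
Proof.
move=> e0; exists (Num.trunc e^-1).+1 => n Nn.
rewrite exprVn -[e]invrK ltf_pV2 ?posrE ?exprn_gt0 ?invr_gt0//.
apply: lt_le_trans (truncnS_gt _) _.
by rewrite -natrX ler_nat (leq_trans Nn)// ltnW// ltn_expl.
Qed.

Lemma rapid_tail (W : normedModType R[i]) (u : nat -> W) :
  (forall n, rnorm (u n.+1 - u n) <= 2^-1 ^+ n) ->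
  forall n k, rnorm (u (n + k)%N - u n) <= 2 * 2^-1 ^+ n.
Proof.
move=> hu n k; apply: (@le_trans _ _ (2 * 2^-1 ^+ n - 2 * 2^-1 ^+ (n + k))).
  elim: k => [|k IH]; first by rewrite addn0 !subrr rnorm0.
  rewrite addnS (le_trans (rnorm_sub _ (u (n + k)%N) _))//.
  apply: le_trans (lerD (hu _) IH) _.
  rewrite exprS mulrA divff ?pnatr_eq0// mul1r addrCA lerD2l.
  by rewrite mulr_natl mulr2n opprD addNKr.
by rewrite lerBlDr lerDl mulr_ge0// exprn_ge0// invr_ge0.
Qed.

Lemma rapid_cauchy (W : normedModType R[i]) (u : nat -> W) :
  (forall n, rnorm (u n.+1 - u n) <= 2^-1 ^+ n) ->
  forall e : R, 0 < e -> exists N, forall m n, (N <= m)%N -> (N <= n)%N -> rnorm (u m - u n) < e.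
Proof.
move=> hu e e0; have [|N HN] := @half_pow_lt (e / 4); first by rewrite divr_gt0.
have h n : (N <= n)%N -> rnorm (u n - u N) < e / 2.
  move=> Nn; rewrite -(subnKC Nn); apply: le_lt_trans (rapid_tail hu _ _) _.
  rewrite -ltr_pdivlMl//; apply: lt_le_trans (HN _ (leqnn _)) _.
  by rewrite mulrCA -invfM -natrM.
exists N => m n Nm Nn; rewrite (le_lt_trans (rnorm_sub _ (u N) _))// [e]splitr.
by rewrite ltrD ?h// rnormB h.
Qed.

Lemma complete_rapidly_complete (W : completeNormedModType R[i]) : rapidly_complete W.
Proof.
move=> u hu; have : cauchy (u @ \oo).
  apply/rnorm_cauchyP => e e0; have [N HN] := rapid_cauchy hu e0.
  exists (u @` [set n | (N <= n)%N]); first by exists N => // n /= Nn; exists n.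
  by move=> _ _ [m Nm <-] [n Nn <-]; exact: HN.
move=> /cauchy_cvg/cvg_ex[l /= /rnorm_cvgP ul]; exists l => e e0.
by have [N _ HN] := ul _ e0; exists N => n Nn; rewrite rnormB; exact: HN.
Qed.

End RapidCompleteness.

Section ComplexComplete.
Variable R : realType.
Implicit Types z : R[i].

Lemma normr_Re_le z : `|complex.Re z| <= rnorm z.
Proof.
by rewrite ler_norml lerNl -raddfN /= -{1}rnormN !Re_le_rnorm.
Qed.

Lemma normr_Im_le z : `|complex.Im z| <= rnorm z.
Proof.
have -> : complex.Im z = complex.Re (- 'i * z) by case: z => a b /=; ring.
rewrite (le_trans (normr_Re_le _))// rnormM rnormN /rnorm normc_def /=.
by rewrite expr0n /= expr1n add0r sqrtr1 mul1r.
Qed.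

Lemma rnorm_real (t : R) : rnorm t%:C = `|t|.
Proof. by rewrite /rnorm normc_def /= expr0n /= addr0 sqrtr_sqr. Qed.

Lemma rnorm_ReIm z : rnorm z <= `|complex.Re z| + `|complex.Im z|.
Proof.
case: z => a b /=; have -> : a +i* b = a%:C + 'i * b%:C by simpc.
rewrite (le_trans (rnormD _ _))// rnormM.
by rewrite !rnorm_real /rnorm normc_def /= expr0n /= expr1n add0r sqrtr1 mul1r.
Qed.

Lemma complex_cauchy_cvg (F : set_system R[i]^o) : ProperFilter F -> cauchy F -> cvg F.
Proof.
move=> FF /rnorm_cauchyP cF.
have part (p : R[i]^o -> R) : (forall x y, `|p x - p y| <= rnorm (x - y)) -> exists a : R, p @ F --> a.
  move=> hp; apply/cvg_ex; apply: cauchy_cvg; apply/cauchyP => e e0.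
  have [A FA HA] := cF _ e0; have [x Ax] := filter_ex FA; exists (p x).
  rewrite /nbhs /=; apply: (@filterS _ F _ A) => // y Ay.
  by rewrite -ball_normE /ball_ /=; apply: le_lt_trans (hp _ _) (HA _ _ Ax Ay).
have [|a ca] := part (@complex.Re R).
  by move=> x y; rewrite -raddfB; exact: normr_Re_le.
have [|b cb] := part (@complex.Im R).
  by move=> x y; rewrite -raddfB; exact: normr_Im_le.
apply/cvg_ex; exists (a +i* b : R[i]^o); apply/rnorm_cvgP => e e0.
have e2 : 0 < e / 2 by rewrite divr_gt0.
have Fa : F [set y | `|a - complex.Re y| < e / 2] by have /fcvgrPdist_lt/(_ _ e2) := ca.
have Fb : F [set y | `|b - complex.Im y| < e / 2] by have /fcvgrPdist_lt/(_ _ e2) := cb.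
apply: filterS (filterI Fa Fb) => y /= [ya yb].
apply: le_lt_trans (rnorm_ReIm _) _; rewrite !raddfB /= [e]splitr.
exact: ltrD ya yb.
Qed.

(* The key [R^o] is already bound to the completeness of a realType, so this structure on
   [R[i]^o] cannot be inferred and is passed explicitly. *)
Definition complex_complete : completeNormedModType R[i] :=
  HB.pack_for (completeNormedModType R[i]) R[i]^o
    (Uniform_isComplete.Build R[i]^o complex_cauchy_cvg).

Lemma complex_rapidly_complete : rapidly_complete R[i]^o.
Proof. exact: (@complete_rapidly_complete R complex_complete). Qed.

Lemma dual_rapidly_complete (V : normedModType R[i]) : rapidly_complete (bdual R V).
Proof. exact: (@complete_rapidly_complete R (bop V complex_complete)). Qed.

End ComplexComplete.

Section DenseExtension.
Variable R : realType.
Implicit Types V W : normedModType R[i].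

Definition is_subspace V (S : set V) : Prop :=
  S 0 /\ forall (a : R[i]) x y, S x -> S y -> S (a *: x + y).

Definition rdense V (S : set V) : Prop :=
  forall x (e : R), 0 < e -> exists2 z, S z & rnorm (x - z) < e.

Lemma le_small (a K : R) : 0 <= K -> (forall e, 0 < e -> a <= K * e) -> a <= 0.
Proof.
move=> K0 h; apply/ler_addgt0Pr => e e0; rewrite add0r.
have K1 : 0 < K + 1 by rewrite ltr_wpDl.
apply: le_trans (h (e / (K + 1)) _) _; first by rewrite divr_gt0.
by rewrite mulrCA ler_piMr ?(ltW e0)// ler_pdivrMr// mul1r lerDl.
Qed.

Lemma dense_zero V W (S : set V) (h : V -> W) (K : R) : rdense S ->
  (forall x y, h (x - y) = h x - h y) -> (forall x, rnorm (h x) <= K * rnorm x) ->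
  (forall x, S x -> h x = 0) -> forall x, h x = 0.
Proof.
move=> dS hB hK hS x; apply: rnorm0_eq0; apply/eqP; rewrite eq_le rnorm_ge0 andbT.
apply: (@le_small _ `|K|) => // e e0; have [z Sz xz] := dS x _ e0.
rewrite -[h x]subr0 -(hS z Sz) -hB (le_trans (hK _))//.
apply: (@le_trans _ _ (`|K| * rnorm (x - z))); first by rewrite ler_wpM2r ?rnorm_ge0 ?ler_norm.
by rewrite ler_wpM2l// ltW.
Qed.

Lemma bop_dense_eq V W (S : set V) (f g : bop V W) : rdense S ->
  (forall x, S x -> f x = g x) -> f = g.
Proof.
move=> dS fg; apply: bopP => x; apply/eqP; rewrite -subr_eq0 -bopB; apply/eqP.
apply: (dense_zero (K := op_norm (f - g)) dS) => [y z|y|y Sy].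
- by rewrite linearB.
- exact: op_normP.
- by rewrite bopB fg// subrr.
Qed.

Section Extend.
Variables (V W : normedModType R[i]) (N : set V) (g : V -> W) (K : R).
Hypothesis sN : is_subspace N.
Hypotheses (W_complete : rapidly_complete W) (dN : rdense N) (K0 : 0 <= K).
Hypothesis g_lin : forall a x y, N x -> N y -> g (a *: x + y) = a *: g x + g y.
Hypothesis g_bnd : forall x, N x -> rnorm (g x) <= K * rnorm x.

Let subB x y : N x -> N y -> N (x - y).
Proof. by move=> Nx Ny; rewrite -scaleN1r addrC; exact: sN.2. Qed.

Let gB x y : N x -> N y -> g (x - y) = g x - g y.
Proof. by move=> Nx Ny; rewrite -scaleN1r addrC g_lin// scaleN1r addrC. Qed.

(** The extension is specified by an estimate instead of a limit: [z = x] gives agreement with [g]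
    on [N], [z = 0] gives the bound [K], and density gives linearity. *)
Let is_value x y := forall z, N z -> rnorm (y - g z) <= K * rnorm (x - z).

Let value_exists x : exists y, is_value x y.
Proof.
(* The radii satisfy [(K + 1) * (d n + d n) = 2^-1 ^+ n], the step size in [rapidly_complete];
   [K + 1] replaces [K], which may be zero. *)
pose d n : R := (2 * (K + 1))^-1 * 2^-1 ^+ n.
have K1 : 0 < K + 1 by rewrite ltr_wpDl.
have d0 n : 0 < d n by rewrite mulr_gt0 ?invr_gt0 ?exprn_gt0 ?mulr_gt0 ?invr_gt0.
have /choice[z zP] n : exists z, N z /\ rnorm (x - z) < d n.
  by have [z] := dN x (d0 n); exists z.
have Nz n : N (z n) by have [] := zP n.
have xz n : rnorm (x - z n) < d n by have [] := zP n.
have dS n : d n.+1 <= d n.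
  by rewrite /d ler_pM2l ?invr_gt0 ?mulr_gt0// exprS ler_piMl ?exprn_ge0 ?invr_ge0// invf_le1// ler1n.
have [n|y yP] := W_complete (u := g \o z).
  rewrite /= -gB// (le_trans (g_bnd (subB _ _)))//.
  apply: (@le_trans _ _ ((K + 1) * (d n + d n))).
    apply: ler_pM; rewrite ?rnorm_ge0 ?lerDl//.
    rewrite (le_trans (rnorm_sub _ x _))// rnormB lerD// ?ltW//.
    exact: lt_le_trans (xz _) _.
  by rewrite le_eqVlt; apply/orP; left; apply/eqP; rewrite /d; field; rewrite gt_eqF.
exists y => w Nw; apply/ler_addgt0Pr => e e0.
have e2 : 0 < e / 2 by rewrite divr_gt0.
have [M1 HM1] := yP _ e2; have [M2 HM2] := half_pow_lt e2.
pose n := maxn M1 M2.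
have dn : K * d n <= e / 2.
  apply: le_trans (ltW (HM2 n (leq_maxr _ _))).
  rewrite /d mulrA ler_piMl ?exprn_ge0 ?invr_ge0//.
  by rewrite ler_pdivrMr ?mulr_gt0// mul1r mulr_natl mulr2n ler_wpDl ?(ltW K1)// lerDl.
have yz : rnorm (y - g (z n)) <= e / 2 by rewrite rnormB ltW// HM1// leq_maxl.
rewrite (le_trans (rnorm_sub _ (g (z n)) _))//.
rewrite -gB//; apply: le_trans (lerD yz (g_bnd (subB (Nz n) Nw))) _.
apply: (@le_trans _ _ (e / 2 + K * (d n + rnorm (x - w)))).
  rewrite lerD2l ler_wpM2l// (le_trans (rnorm_sub _ x _))// lerD2r rnormB.
  by rewrite ltW.
by rewrite mulrDr addrA addrC lerD2l [leRHS]splitr lerD2l.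
Qed.

Lemma dense_extend : exists G : bop V W,
  (forall x, N x -> G x = g x) /\ forall x, rnorm (G x) <= K * rnorm x.
Proof.
have [G GP] := choice value_exists.
have Glin : linear G.
  move=> a x x'; apply/eqP; rewrite -subr_eq0; apply/eqP/rnorm0_eq0/eqP.
  rewrite eq_le rnorm_ge0 andbT.
  apply: (@le_small _ ((K * (rnorm a + 1)) *+ 2)) => [|e e0].
    by rewrite mulrn_wge0// mulr_ge0// addr_ge0 ?rnorm_ge0.
  have [z Nz xz] := dN x e0; have [z' Nz' xz'] := dN x' e0.
  have Nw : N (a *: z + z') by exact: sN.2.
  rewrite (le_trans (rnorm_sub _ (g (a *: z + z')) _))// mulrnAl mulr2n lerD//.
    rewrite (le_trans (GP _ _ Nw))// -mulrA ler_wpM2l// opprD addrACA -scalerBr.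
    by rewrite (le_trans (rnormD _ _))// rnormZ mulrDl mul1r lerD ?ler_wpM2l ?rnorm_ge0 ?ltW.
  rewrite g_lin// opprD addrACA -scalerBr (le_trans (rnormD _ _))// rnormZ.
  rewrite rnormB [rnorm (g z' - _)]rnormB mulrDr mulr1 mulrDl lerD//.
    rewrite [K * _]mulrC -mulrA ler_wpM2l ?rnorm_ge0// (le_trans (GP _ _ Nz))//.
    by rewrite ler_wpM2l// ltW.
  by rewrite (le_trans (GP _ _ Nz'))// ler_wpM2l// ltW.
have GK x : rnorm (G x) <= K * rnorm x.
  have g0 : g 0 = 0 by rewrite -[0 in LHS](subrr 0) gB ?subrr//; exact: sN.1.
  by have := GP x 0 sN.1; rewrite g0 !subr0.
have GB : G \in @bounded_linear R V W by apply/bounded_linearP; split=> //; exists K.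
exists (Bop GB); split=> // x Nx /=; apply/eqP; rewrite -subr_eq0; apply/eqP/rnorm0_eq0/eqP.
by rewrite eq_le rnorm_ge0 andbT (le_trans (GP x x Nx))// subrr rnorm0 mulr0.
Qed.

End Extend.

(** One variable at a time: each [beta x] with [x] in [N] extends to an element of the dual of [V'],
    and the resulting map from [N] into this complete dual extends to [V]. *)
Lemma bilinear_extend V V' (N : set V) (N' : set V') (beta : V -> V' -> R[i]^o)
    (K : R) : is_subspace N -> is_subspace N' -> rdense N -> rdense N' -> 0 <= K ->
  (forall a x y z, N x -> N y -> N' z -> beta (a *: x + y) z = a *: beta x z + beta y z) ->
  (forall a x y z, N x -> N' y -> N' z -> beta x (a *: y + z) = a *: beta x y + beta x z) ->
  (forall x y, N x -> N' y -> rnorm (beta x y) <= K * rnorm x * rnorm y) ->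
  exists D : bop V (bdual R V'), forall x y, N x -> N' y -> D x y = beta x y.
Proof.
move=> sN sN' dN dN' K0 bl br bK.
have /choice[g gP] x : exists g : bdual R V', N x ->
    (forall y, N' y -> g y = beta x y) /\ (forall y, rnorm (g y) <= K * rnorm x * rnorm y).
  have [Nx|Nx] := pselect (N x); last by exists 0 => /Nx.
  have [||||g gP] := @dense_extend _ _ N' (beta x) (K * rnorm x) sN' _ dN'; last by exists g.
  - exact: complex_rapidly_complete.
  - by rewrite mulr_ge0 ?rnorm_ge0.
  - by move=> a y z; exact: br.
  - by move=> y; exact: bK.
have [|x Nx|D [DN _]] := @dense_extend _ _ N g K sN (@dual_rapidly_complete R V') dN K0.
- move=> a x y Nx Ny; have Nxy : N (a *: x + y) by exact: sN.2.
  apply: (bop_dense_eq dN') => z Nz.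
  by rewrite bopD bopZ (gP _ Nxy).1// (gP _ Nx).1// (gP _ Ny).1// bl.
- rewrite rnorm_bop; apply: op_norm_le; first by rewrite mulr_ge0 ?rnorm_ge0.
  exact: (gP x Nx).2.
- by exists D => x y Nx Ny; rewrite DN// (gP x Nx).1.
Qed.

End DenseExtension.

(** * Uniform boundedness *)

Section BanachSteinhaus.
Variables (R : realType) (V W : normedModType R[i]).

(** The norm need not be attained, but scaling reaches any fraction of it below 1. The value 2/3
    leaves room for the 1/3 lost in the tail of the gliding hump. *)
Lemma large_value (f : bop V W) (r : R) : 0 < r -> 0 < rnorm f ->
  exists2 z, rnorm z <= r & 2 / 3 * r * rnorm f <= rnorm (f z).
Proof.
move=> r0 f0; apply: contrapT => /forall2NP h.
suff : rnorm f <= 2 / 3 * rnorm f.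
  by move: f0; set t := rnorm f; lra.
rewrite {1}rnorm_bop; apply: op_norm_le => [|x].
  by rewrite mulr_ge0 ?rnorm_ge0.
have [->|x0] := eqVneq x 0; first by rewrite linear0 !rnorm0 mulr0.
have nx : 0 < rnorm x.
  by rewrite lt_neqAle rnorm_ge0 andbT eq_sym; apply: contra_neq x0 => /rnorm0_eq0.
have rx : 0 <= r / rnorm x by rewrite divr_ge0// ltW.
have [/negP|/negP] := h ((r / rnorm x)%:C *: x).
  by rewrite rnormZ rnormC// mulfVK ?lexx// gt_eqF.
rewrite -ltNge linearZ rnormZ rnormC// => /ltW.
have -> : 2 / 3 * rnorm f * rnorm x = (r / rnorm x)^-1 * (2 / 3 * r * rnorm f).
  by field; rewrite !gt_eqF.
by rewrite ler_pdivlMl ?divr_gt0.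
Qed.

(* Sokal's gliding hump: among x + z and x - z one has an image of norm at least |f z|. *)
Theorem banach_steinhaus (I : Type) (f : I -> bop V W) : rapidly_complete V ->
  (forall x, exists M : R, forall i, rnorm (f i x) <= M) ->
  exists M : R, forall i, rnorm (f i) <= M.
Proof.
move=> V_complete pb; apply: contrapT => /forallNP nb.
have big (M : R) : exists i, M < rnorm (f i).
  by have /existsNP[i /negP] := nb M; rewrite -ltNge; exists i.
pose c n : R := 4^-1 ^+ n.
have c0 n : 0 < c n by rewrite exprn_gt0// invr_gt0.
(* All later corrections add up to at most [c n / 3], so of the value
   [2 / 3 * c n * rnorm (f (i n))] one half survives at the limit; the factor 3 makes that at least
   [n]. *)
have /choice[i iP] n := big (3 * n%:R / c n).
have f0 n : 0 < rnorm (f (i n)).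
  by apply: le_lt_trans (iP n); rewrite !mulr_ge0// invr_ge0 ltW.
have step n x : exists x', rnorm (x' - x) <= c n /\ 2 / 3 * c n * rnorm (f (i n)) <= rnorm (f (i n) x').
  have [z zc fz] := large_value (c0 n) (f0 n).
  have [h|h] := leP (2 / 3 * c n * rnorm (f (i n))) (rnorm (f (i n) (x + z))).
    by exists (x + z); rewrite addrAC subrr add0r.
  exists (x - z); rewrite addrAC subrr add0r rnormN; split=> //.
  have : rnorm (f (i n) z) *+ 2 <= rnorm (f (i n) (x + z)) + rnorm (f (i n) (x - z)).
    have -> : rnorm (f (i n) z) *+ 2 = rnorm (f (i n) (x + z) - f (i n) (x - z)).
      rewrite linearD linearB opprB addrC addrA subrK -mulr2n.
      by apply: complexI; rewrite rmorphMn /= !rnormE -normrMn.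
    by rewrite (le_trans (rnormD _ _))// rnormN.
  rewrite mulr2n => h2; rewrite -(lerD2l (rnorm (f (i n) (x + z)))).
  by apply: le_trans h2; rewrite lerD// (le_trans (ltW h)).
have /choice[nx nxP] (p : nat * V) : exists x', rnorm (x' - p.2) <= c p.1 /\
  2 / 3 * c p.1 * rnorm (f (i p.1)) <= rnorm (f (i p.1) x') by exact: step.
pose x := fix x n : V := if n is n'.+1 then nx (n', x n') else 0.
have xS n : rnorm (x n.+1 - x n) <= c n by have [] := nxP (n, x n).
have xf n : 2 / 3 * c n * rnorm (f (i n)) <= rnorm (f (i n) (x n.+1)).
  by have [] := nxP (n, x n).
have [n|l xl] := V_complete x.
  apply: le_trans (xS n) _; rewrite /c; apply: lerXn2r; rewrite ?nnegrE ?invr_ge0//.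
  by rewrite lef_pV2 ?posrE// ler_nat.
have tail n k : rnorm (x (n.+1 + k)%N - x n.+1) <= (c n - c (n + k)%N) / 3.
  elim: k => [|k IH]; first by rewrite !addn0 !subrr mul0r rnorm0.
  rewrite addnS (le_trans (rnorm_sub _ (x (n.+1 + k)%N) _))//.
  apply: le_trans (lerD (xS _) IH) _.
  have cS m : c m.+1 = 4^-1 * c m by rewrite /c exprS.
  rewrite addSn addnS !cS.
  by rewrite ler_pdivlMr// mulrDl mulfVK ?pnatr_eq0//; lra.
have xl_le n : rnorm (l - x n.+1) <= c n / 3.
  apply/ler_addgt0Pr => e e0; have [N HN] := xl _ e0.
  rewrite [leRHS]addrC (le_trans (rnorm_sub _ (x (n.+1 + N)%N) _))// lerD//.
    by rewrite rnormB ltW// HN// leq_addl.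
  by rewrite (le_trans (tail _ _))// ler_pM2r ?invr_gt0// gerBl ltW.
have fl n : n%:R <= rnorm (f (i n) l).
  have h1 : rnorm (f (i n) (x n.+1)) <= rnorm (f (i n) l) + rnorm (f (i n)) * (c n / 3).
    rewrite -{1}(subrK l (x n.+1)) linearD addrC (le_trans (rnormD _ _))// lerD2l.
    apply: le_trans (op_normP _ _) _; apply: ler_wpM2l; first exact: op_norm_ge0.
    by rewrite rnormB.
  have h2 : n%:R * 3 <= c n * rnorm (f (i n)).
    by have := ltW (iP n); rewrite ler_pdivrMr// mulrC [rnorm _ * _]mulrC.
  have := le_trans (xf n) h1; set u := rnorm (f (i n)) in h2 *; move: h2; set v := c n.
  by move=> h2 h3; nra.
have [M HM] := pb l; have := le_trans (fl (Num.trunc M).+1) (HM _).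
by rewrite leNgt truncnS_gt.
Qed.

End BanachSteinhaus.

(** * Tensor products *)

Section CompletionTheory.
Variables (R : realType) (V : lmodType R[i]) (p : seminorm V).

Lemma completion_in_linear : linear (@completion_in R V p).
Proof.
move=> a x y; rewrite /completion_in -linearP; congr (sepquot_pi _ _).
exact: val_inj.
Qed.

HB.instance Definition _ :=
  GRing.isLinear.Build R[i] V (completion p) *:%R (@completion_in R V p) completion_in_linear.

Lemma rnorm_sepquot_le (c : cseq p) (e : R) N :
  (forall n, (N <= n)%N -> p (c n) <= e) -> rnorm (sepquot_pi (lim_sn p) c) <= e.
Proof.
move=> ce; rewrite rnorm_sepquot; apply: limr_le; first exact: lim_norm_cvg.
by exists N.
Qed.

Lemma rnorm_completion_in v : rnorm (completion_in p v) = p v.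
Proof.
rewrite rnorm_sepquot; apply/cvg_lim; first exact: Rhausdorff.
have h : (fun=> p v : R) @ \oo --> p v by exact: cvg_cst.
exact: h.
Qed.

Lemma cseq_approx (c : cseq p) (e : R) : 0 < e ->
  exists N, forall n, (N <= n)%N -> rnorm (sepquot_pi (lim_sn p) c - completion_in p (c n)) <= e.
Proof.
move=> e0; have /asboolP/(_ e e0)[N HN] : (c : nat -> V) \in sn_cauchy p by case: c.
exists N => n Nn; rewrite -linearB /=; apply: (@rnorm_sepquot_le _ _ N) => m Nm.
by apply/ltW; exact: HN.
Qed.

Lemma completion_in_dense : rdense (range (completion_in p)).
Proof.
elim/sepquot_ind => c e e0; have e2 : 0 < e / 2 by rewrite divr_gt0.
have [N HN] := cseq_approx c e2; exists (completion_in p (c N)); first by exists (c N).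
apply: le_lt_trans (HN N (leqnn N)) _.
by rewrite ltr_pdivrMr// ltr_pMr// ltr1n.
Qed.

Lemma range_completion_in_subspace : is_subspace (range (completion_in p)).
Proof.
split; first by exists 0 => //; exact: linear0.
by move=> a _ _ [x _ <-] [y _ <-]; exists (a *: x + y) => //; exact: linearP.
Qed.

(** Diagonal argument: vectors [w n] within [2^-1 ^+ n] of [u n] form a Cauchy sequence, whose class
    is the limit. *)
Lemma completion_rapidly_complete : rapidly_complete (completion p).
Proof.
move=> u hu.
have h0 n : 0 < 2^-1 ^+ n :> R by rewrite exprn_gt0// invr_gt0.
have /choice[w wP] n : exists w, rnorm (u n - completion_in p w) < 2^-1 ^+ n.
  by have [_ [w _ <-] ?] := completion_in_dense (u n) (h0 n); exists w.
have cw : w \in sn_cauchy p.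
  apply/asboolP => e e0; have e4 : 0 < e / 4 by rewrite divr_gt0.
  have [M HM] := rapid_cauchy hu e4; have [M' HM'] := half_pow_lt e4.
  exists (maxn M M') => m n; rewrite !geq_max => /andP[Mm Mm'] /andP[Mn Mn'].
  rewrite -rnorm_completion_in linearB.
  apply: le_lt_trans (rnorm_sub _ (u m) _) _.
  apply: (@lt_trans _ _ (e / 4 + (e / 4 + e / 4))); last by lra.
  apply: ltrD; first by rewrite rnormB; exact: lt_trans (wP m) (HM' _ Mm').
  apply: le_lt_trans (rnorm_sub _ (u n) _) _; apply: ltrD; first exact: HM.
  exact: lt_trans (wP n) (HM' _ Mn').
exists (sepquot_pi (lim_sn p) (CSeq cw)) => e e0; have e2 : 0 < e / 2 by rewrite divr_gt0.
have [M HM] := half_pow_lt e2; have [M' HM'] := cseq_approx (CSeq cw) e2.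
exists (maxn M M') => n; rewrite geq_max => /andP[Mn Mn'].
apply: le_lt_trans (rnorm_sub _ (completion_in p (w n)) _) _; rewrite [e]splitr.
apply: ltr_leD; first exact: lt_trans (wP n) (HM _ Mn).
by rewrite rnormB; exact: HM'.
Qed.

(** Vectors at [p]-distance zero become equal in the completion, so [h] passes to the range of
    [completion_in] through a choice [r] of preimages; the bound by [p] makes the result independent
    of that choice. *)
Lemma completion_extend (U : normedModType R[i]) (h : {linear V -> U}) (K : R) :
  rapidly_complete U -> 0 <= K -> (forall v, rnorm (h v) <= K * p v) ->
  exists H : bop (completion p) U, forall v, H (completion_in p v) = h v.
Proof.
move=> U_complete K0 hK.
have /choice[r rP] (x : completion p) : exists v, range (completion_in p) x -> completion_in p v = x.
  have [[v _ <-]|nx] := pselect (range (completion_in p) x); first by exists v.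
  by exists 0 => /nx.
have hr v : h (r (completion_in p v)) = h v.
  apply/eqP; rewrite -subr_eq0 -linearB; apply/eqP/rnorm0_eq0/eqP.
  rewrite eq_le rnorm_ge0 andbT (le_trans (hK _))// -rnorm_completion_in linearB /= rP.
    by rewrite subrr rnorm0 mulr0.
  by exists v.
have [||H [HN _]] := @dense_extend _ _ _ _ (h \o r) K range_completion_in_subspace U_complete
    completion_in_dense K0.
- move=> a _ _ [x _ <-] [y _ <-] /=.
  by rewrite -linearP /= !hr linearP.
- by move=> _ [x _ <-] /=; rewrite hr rnorm_completion_in.
by exists H => v; rewrite HN /= ?hr//; exists v.
Qed.

End CompletionTheory.

Section QuotientTheory.
Variables (R : realType) (V : normedModType R[i]) (N : Defs.subspace V).

HB.instance Definition _ := GRing.isLinear.Build R[i] V (quot_space N) *:%R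
  (@quot_pi R V N) (@sepquot_pi_linear R V (dist_sn N)).

Lemma rnorm_quot_pi v : rnorm (quot_pi N v) <= rnorm v.
Proof.
rewrite rnorm_sepquot; apply: Defs.inf_le; first exact: dist_sub_elt_ge0.
by exists 0; [exact: Defs.subspace0 | rewrite subr0].
Qed.

Lemma quot_pi_eq0 v : subspace_set N v -> quot_pi N v = 0.
Proof.
move=> Nv; rewrite -(linear0 (quot_pi N)); apply/sepquot_piP; rewrite subr0.
apply/eqP; rewrite eq_le sn_ge0 andbT; apply: Defs.inf_le; first exact: dist_sub_elt_ge0.
by exists v; rewrite ?subrr ?rnorm0.
Qed.

Lemma quot_pi_lift (x : quot_space N) (e : R) : rnorm x < e ->
  exists2 v, quot_pi N v = x & rnorm v < e.
Proof.
elim/sepquot_ind: x => v; rewrite rnorm_sepquot => ve.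
have d0 : 0 < e - dist_sub N v by rewrite subr_gt0.
have [_ [n Nn <-] vn] := Defs.inf_near (dist_sub_neq0 N v) (@dist_sub_elt_ge0 _ _ N v) d0.
exists (v - n); first by rewrite linearB /= (quot_pi_eq0 Nn) subr0.
by apply: lt_le_trans vn _; rewrite addrC subrK.
Qed.

Lemma quot_rapidly_complete : rapidly_complete V -> rapidly_complete (quot_space N).
Proof.
move=> V_complete u hu.
have pi_surj (x : quot_space N) : exists v, quot_pi N v = x.
  by exists (repr x); exact: sepquot_reprK.
(* Lifting needs a strict bound on the norm. The index is shifted by one because the step from
   [u n.+1] to [u n.+2] is at most [2^-1 ^+ n.+1], strictly below [2^-1 ^+ n]. *)
have lift n v : quot_pi N v = u n.+1 ->
    exists w, quot_pi N w = u n.+2 /\ rnorm (w - v) <= 2^-1 ^+ n.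
  move=> vu; have [|w wu wn] := @quot_pi_lift (u n.+2 - u n.+1) (2^-1 ^+ n).
    apply: le_lt_trans (hu _) _; rewrite exprS gtr_pMl ?exprn_gt0 ?invr_gt0//.
    by rewrite invf_lt1// ltr1n.
  exists (v + w); rewrite linearD /= wu vu addrC subrK; split=> //.
  by rewrite addrAC subrr add0r ltW.
have [v0 v0u] := pi_surj (u 1%N).
have /choice[nx nxP] (q : nat * V) : exists w, quot_pi N q.2 = u q.1.+1 ->
    quot_pi N w = u q.1.+2 /\ rnorm (w - q.2) <= 2^-1 ^+ q.1.
  have [h|h] := pselect (quot_pi N q.2 = u q.1.+1); last by exists 0 => /h.
  by have [w wP] := lift _ _ h; exists w.
pose v := fix v n : V := if n is n'.+1 then nx (n', v n') else v0.
have vu n : quot_pi N (v n) = u n.+1.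
  by elim: n => [//|n IH]; have [] := nxP (n, v n) IH.
have [n|l vl] := V_complete v; first by have [] := nxP (n, v n) (vu n).
exists (quot_pi N l) => e e0; have [M HM] := vl _ e0; exists M.+1 => -[//|n] Mn.
by rewrite -vu -linearB; apply: le_lt_trans (rnorm_quot_pi _) (HM _ Mn).
Qed.

Lemma quot_extend (U : normedModType R[i]) (f : bop V U) : (forall v, subspace_set N v -> f v = 0) ->
  exists F : bop (quot_space N) U, forall v, F (quot_pi N v) = f v.
Proof.
move=> fN; pose F (x : quot_space N) := f (repr x).
have fle v : rnorm (f v) <= op_norm f * rnorm (quot_pi N v).
  rewrite rnorm_sepquot; have [f0|f0] := eqVneq (op_norm f) 0.
    by rewrite (le_trans (op_normP _ _))// f0 !mul0r.
  have f_gt0 : 0 < op_norm f by rewrite lt_neqAle eq_sym f0 op_norm_ge0.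
  rewrite -ler_pdivrMl//; apply: lb_le_inf; first exact: dist_sub_neq0.
  move=> _ [n Nn <-]; rewrite ler_pdivrMl// -[f v]subr0 -(fN n Nn) -linearB.
  exact: op_normP.
have FE v : F (quot_pi N v) = f v.
  apply/eqP; rewrite -subr_eq0 -linearB; apply/eqP/rnorm0_eq0/eqP.
  rewrite eq_le rnorm_ge0 andbT (le_trans (fle _))//.
  have -> : quot_pi N (repr (quot_pi N v) - v) = 0.
    by rewrite linearB; apply/eqP; rewrite subr_eq0; apply/eqP; exact: sepquot_reprK.
  by rewrite rnorm0 mulr0.
have FB : F \in @bounded_linear R (quot_space N) U.
  apply/bounded_linearP; split.
    move=> a; elim/sepquot_ind => x; elim/sepquot_ind => y.
    by rewrite -[X in F X]linearP !FE linearP.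
  by exists (op_norm f); elim/sepquot_ind => x; rewrite FE.
by exists (Bop FB).
Qed.

Lemma quot_bop_eq (U : normedModType R[i]) (f g : bop (quot_space N) U) :
  (forall v, f (quot_pi N v) = g (quot_pi N v)) -> f = g.
Proof. by move=> fg; apply: bopP; elim/sepquot_ind. Qed.

End QuotientTheory.

Section TensorTheory.
Variables (R : realType) (X Y : normedModType R[i]).

Lemma pure_linearl (y : Y) : linear (fun x : X => pure x y).
Proof.
move=> a x x'; rewrite /pure -linearP; congr (completion_in _ _).
apply/val_inj/funext => B; rewrite /= /eval_tensor !fctE !big_seq1 /=.
by rewrite linearDl linearZl_LR.
Qed.

Lemma pure_linearr (x : X) : linear (fun y : Y => pure x y).
Proof.
move=> a y y'; rewrite /pure -linearP; congr (completion_in _ _).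
apply/val_inj/funext => B; rewrite /= /eval_tensor !fctE !big_seq1 /=.
by rewrite linearDr linearZr_LR.
Qed.

Lemma rnorm_pure (x : X) (y : Y) : rnorm (pure x y) <= rnorm x * rnorm y.
Proof.
rewrite rnorm_completion_in; apply: Defs.inf_le; first exact: proj_norm_elt_ge0.
by exists [:: (x, y)] => //=; rewrite /seq_weight big_seq1.
Qed.

Lemma atensor_sum (t : atensor X Y) s : atensor_fun t = eval_tensor s ->
  t = \sum_(z <- s) ATensor (pure_subproof z.1 z.2).
Proof.
move=> ts; apply: val_inj; rewrite /= ts => {ts t}; elim: s => [|z s IH].
  by rewrite big_nil; apply/funext => B; rewrite /eval_tensor big_nil.
rewrite big_cons -[z :: s]/([:: z] ++ s) eval_tensor_cat IH.
by case: z.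
Qed.

Lemma completion_in_sum (t : atensor X Y) s : atensor_fun t = eval_tensor s ->
  completion_in (proj_sn X Y) t = \sum_(z <- s) pure z.1 z.2.
Proof. by move=> /atensor_sum ->; rewrite linear_sum. Qed.

Lemma ptensor_bop_eq (U : normedModType R[i]) (f g : bop (ptensor X Y) U) :
  (forall x y, f (pure x y) = g (pure x y)) -> f = g.
Proof.
move=> fg; apply: (bop_dense_eq (@completion_in_dense _ _ (proj_sn X Y))) => _ [t _ <-].
have [s ts] : exists s, atensor_fun t = eval_tensor s by case: t => t /= /asboolP.
by rewrite (completion_in_sum ts) !linear_sum; apply: eq_bigr => z _; exact: fg.
Qed.

Section Universal.
Variables (U : normedModType R[i]) (M : X -> Y -> U) (K : R).
Hypotheses (Ml : forall y, linear (M^~ y)) (Mr : forall x, linear (M x)).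
Hypotheses (K0 : 0 <= K) (MK : forall x y, rnorm (M x y) <= K * rnorm x * rnorm y).

Let Msum (s : seq (X * Y)) : U := \sum_(z <- s) M z.1 z.2.

Let comp_bilinear (f : bdual R U) :
  bilinear_for ( *:%R : GRing.Scale.law R[i] R[i]^o) ( *:%R : GRing.Scale.law R[i] R[i]^o)
    (fun x y => f (M x y)).
Proof.
by split=> [y a x x'|x a y y']; rewrite ?Ml ?Mr linearP.
Qed.

Let comp_bilform (f : bdual R U) : bilform X Y :=
  HB.pack (fun x y => f (M x y))
    (bilinear_isBilinear.Build R[i] X Y R[i]^o _ _ (fun x y => f (M x y)) (comp_bilinear f)).

(** Tensors are tested on scalar bilinear forms only. A norming functional of the difference,
    composed with [M], is such a form and detects the difference. *)
Let Msum_eq s s' : eval_tensor s = eval_tensor s' -> Msum s = Msum s'.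
Proof.
move=> ss; apply/eqP; rewrite -subr_eq0; apply/eqP/rnorm0_eq0.
have [f _ fv] := norming_functional (Msum s - Msum s').
have fM s0 : f (Msum s0) = eval_tensor s0 (comp_bilform f) by rewrite /Msum linear_sum.
by apply: complexI; rewrite -fv linearB /= !fM ss subrr.
Qed.

Lemma tensor_extend : rapidly_complete U ->
  exists F : bop (ptensor X Y) U, forall x y, F (pure x y) = M x y.
Proof.
move=> U_complete.
have /choice[r rP] (t : atensor X Y) : exists s, atensor_fun t = eval_tensor s.
  by case: t => t /= /asboolP.
pose h t := Msum (r t).
have hE t s : atensor_fun t = eval_tensor s -> h t = Msum s.
  by move=> ts; apply: Msum_eq; rewrite -rP.
have hlin : linear h.
  move=> a t t'; have := hE (a *: t + t') (scale_seq a (r t) ++ r t').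
  rewrite eval_tensor_cat eval_tensor_scale -!rP => /(_ erefl) ->.
  rewrite /Msum big_cat /scale_seq big_map scaler_sumr; congr (_ + _).
  apply: eq_bigr => z _ /=; have := Ml z.2 a z.1 0.
  have M0 y : M 0 y = 0.
    have := Ml y 1 0 0; rewrite /= scaler0 addr0 scale1r -{1}[M 0 y]addr0.
    by move=> /addrI/esym.
  by rewrite /= !addr0 M0 addr0.
pose hL : {linear atensor X Y -> U} :=
  HB.pack h (GRing.isLinear.Build R[i] (atensor X Y) U *:%R h hlin).
have [t|F FE] := @completion_extend _ _ (proj_sn X Y) U hL K U_complete K0.
  have [K00|K00] := eqVneq K 0.
    rewrite K00 mul0r /= /h /Msum (le_trans (rnorm_sum _ _))// sumr_le0// => z _.
    by rewrite (le_trans (MK _ _))// K00 !mul0r.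
  have K_gt0 : 0 < K by rewrite lt_neqAle eq_sym K00.
  rewrite -ler_pdivrMl//; apply: lb_le_inf; first exact: proj_norm_neq0.
  move=> _ [s /= ts <-]; rewrite ler_pdivrMl// (hE _ _ ts) (le_trans (rnorm_sum _ _))//.
  by rewrite mulr_sumr ler_sum// => z _; rewrite mulrA.
by exists F => x y; rewrite FE /= (hE _ [:: (x, y)])// /Msum big_seq1.
Qed.

End Universal.
End TensorTheory.

Section BalancedTensor.
Variables (R : realType) (A : banachAlgebraType R[i]).

Lemma balanced_pure_linearl (b : A) : linear (fun a : A => balanced_pure a b).
Proof. by move=> k a a'; rewrite /balanced_pure pure_linearl linearP. Qed.

Lemma balanced_pure_linearr (a : A) : linear (fun b : A => balanced_pure a b).
Proof. by move=> k b b'; rewrite /balanced_pure pure_linearr linearP. Qed.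

Lemma rnorm_balanced_pure (a b : A) : rnorm (balanced_pure a b) <= rnorm a * rnorm b.
Proof. exact: le_trans (rnorm_quot_pi _ _) (rnorm_pure _ _). Qed.

Lemma balanced_pureA (a b c : A) : balanced_pure (bmul a b) c = balanced_pure a (bmul b c).
Proof.
apply/eqP; rewrite -subr_eq0 /balanced_pure -linearB; apply/eqP/quot_pi_eq0.
apply: subset_closure; exists 1%N, (fun=> 1), (fun=> pure (bmul a b) c - pure a (bmul b c)).
by split; [move=> _; exists a, b, c | rewrite big_ord1 scale1r].
Qed.

Lemma balanced_rapidly_complete : rapidly_complete (balanced_tensor A).
Proof. by apply: quot_rapidly_complete; exact: completion_rapidly_complete. Qed.

Lemma balanced_bop_eq (U : normedModType R[i]) (f g : bop (balanced_tensor A) U) :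
  (forall a b, f (balanced_pure a b) = g (balanced_pure a b)) -> f = g.
Proof.
move=> fg; apply: quot_bop_eq => v.
have piB : quot_pi (closed_span (@balanced_relations R A)) \in
    @bounded_linear R (ptensor A A) (balanced_tensor A).
  apply/bounded_linearP; split; first exact: linearP.
  by exists 1 => x; rewrite mul1r rnorm_quot_pi.
suff /(congr1 (fun h => bop_fun h v)) : bcomp f (Bop piB) = bcomp g (Bop piB) by [].
exact: ptensor_bop_eq.
Qed.

(** The map given by the universal property vanishes on the balanced relations, hence by continuity
    on their closed span. *)
Lemma balanced_extend (U : normedModType R[i]) (M : A -> A -> U) (K : R) :
  (forall b, linear (M^~ b)) -> (forall a, linear (M a)) -> 0 <= K ->
  (forall a b, rnorm (M a b) <= K * rnorm a * rnorm b) ->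
  (forall a b c, M (bmul a b) c = M a (bmul b c)) -> rapidly_complete U ->
  exists F : bop (balanced_tensor A) U, forall a b, F (balanced_pure a b) = M a b.
Proof.
move=> Ml Mr K0 MK Mbal U_complete.
have [F FE] := tensor_extend Ml Mr K0 MK U_complete.
have [v|G GE] := @quot_extend _ _ (closed_span (@balanced_relations R A)) _ F.
  move=> /= /rnorm_closureP cv; apply: rnorm0_eq0; apply/eqP; rewrite eq_le rnorm_ge0 andbT.
  apply: (@le_small _ _ (op_norm F)) => [|e e0]; first exact: op_norm_ge0.
  have [w [n [c [t [relt ->]]]] vw] := cv _ e0.
  have F0 : F (\sum_(i < n) c i *: t i) = 0.
    rewrite linear_sum big1// => i _; rewrite linearZ /=.
    by have [a [b [d ->]]] := relt i; rewrite linearB /= !FE Mbal subrr scaler0.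
  rewrite -[F v]subr0 -F0 -linearB (le_trans (op_normP _ _))//.
  by rewrite ler_wpM2l ?op_norm_ge0// ltW.
by exists G => a b; rewrite GE FE.
Qed.

End BalancedTensor.

(** * Functionals on finite rank operators *)

Section TraceTheory.
Variable R : realType.
Implicit Types X Y : normedModType R[i].

Lemma finite_rank_ind X Y (P : bop X Y -> Prop) : P 0 ->
  (forall y f, P (rank1 y f)) ->
  (forall S T, finite_rank S -> finite_rank T -> P S -> P T -> P (S + T)) ->
  forall T, finite_rank T -> P T.
Proof.
move=> P0 P1 PD T /finite_rank_rank1_sum[s ->]; elim: s => [|u s IH].
  by rewrite big_nil.
rewrite big_cons; apply: PD => //; first exact: finite_rank_rank1.
by apply: finite_rank_sum => i; exact: finite_rank_rank1.
Qed.

(* Expanding the vectors u.2 along a fixing projection shows that the sum depends on T only. *)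
Lemma rank1_sum_eq X Y (beta : Y -> bdual R X -> R[i]^o) s s' :
  (forall f, linear (beta^~ f)) -> (forall y, linear (beta y)) ->
  \sum_(u <- s) rank1 u.2 u.1 = \sum_(u <- s') rank1 u.2 u.1 ->
  \sum_(u <- s) beta u.2 u.1 = \sum_(u <- s') beta u.2 u.1.
Proof.
move=> bl br ss.
have [n [f [b [_ fix_s]]]] := fixing_projection [seq u.2 | u <- s ++ s'].
have b0 h : beta 0 h = 0.
  have := bl h 1 0 0; rewrite /= scaler0 addr0 scale1r -{1}[beta 0 h]addr0.
  by move=> /addrI/esym.
have bsum h (c : 'I_n -> R[i]) : beta (\sum_(i < n) c i *: b i) h = \sum_(i < n) c i *: beta (b i) h.
  elim/big_rec2: _ => [|i y1 y2 _ <-]; first exact: b0.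
  by rewrite bl.
pose betaL y : {linear bdual R X -> R[i]^o} :=
  HB.pack (beta y) (GRing.isLinear.Build R[i] (bdual R X) R[i]^o *:%R (beta y) (br y)).
suff E t : {subset t <= s ++ s'} ->
    \sum_(u <- t) beta u.2 u.1 = \sum_(i < n) beta (b i) (bcomp (f i) (\sum_(u <- t) rank1 u.2 u.1)).
  by rewrite !E ?ss// => u; rewrite mem_cat => ->; rewrite ?orbT.
move=> ts.
rewrite [LHS]big_seq (eq_bigr (fun u => \sum_(i < n) f i u.2 *: beta (b i) u.1)); last first.
  by move=> u /ts us; rewrite -bsum -bprojE fix_s// map_f.
rewrite -big_seq exchange_big /=; apply: eq_bigr => i _.
have -> : bcomp (f i) (\sum_(u <- t) rank1 u.2 u.1) = \sum_(u <- t) f i u.2 *: u.1.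
  apply: bopP => x; rewrite /= bop_sumE linear_sum bop_sumE; apply: eq_bigr => u _.
  by rewrite /= linearZ; exact: mulrC.
rewrite -[beta (b i)]/(betaL (b i) : _ -> _) linear_sum; apply: eq_bigr => u _.
by rewrite linearZ.
Qed.

Lemma tr_sum X (s : seq (bdual R X * X)) : tr (\sum_(u <- s) rank1 u.2 u.1) = \sum_(u <- s) u.1 u.2.
Proof. by apply: trE => z; rewrite bop_sumE. Qed.

Lemma tr_rank1 X (x : X) (f : bdual R X) : tr (rank1 x f) = f x.
Proof. by have := tr_sum [:: (f, x)]; rewrite !big_seq1. Qed.

Lemma tr_linear X a (S T : bop X X) : finite_rank S -> finite_rank T ->
  tr (a *: S + T) = a * tr S + tr T.
Proof.
move=> /finite_rank_rank1_sum[s ->] /finite_rank_rank1_sum[t ->]; rewrite !tr_sum.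
have -> : a *: (\sum_(u <- s) rank1 u.2 u.1) + \sum_(u <- t) rank1 u.2 u.1 =
    \sum_(u <- [seq (a *: u.1, u.2) | u <- s] ++ t) rank1 u.2 u.1.
  rewrite big_cat big_map scaler_sumr; congr (_ + _); apply: eq_bigr => u _.
  by apply: bopP => x; exact: scalerA.
by rewrite tr_sum big_cat big_map mulr_sumr.
Qed.

Lemma tr_comm X Y (P : bop Y X) (Q : bop X Y) : finite_rank P ->
  tr (bcomp P Q) = tr (bcomp Q P).
Proof.
move=> /finite_rank_rank1_sum[s ->].
have -> : bcomp (\sum_(u <- s) rank1 u.2 u.1) Q =
    \sum_(u <- [seq (bcomp u.1 Q, u.2) | u <- s]) rank1 u.2 u.1.
  by rewrite big_map; apply: bopP => x /=; rewrite !bop_sumE.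
have -> : bcomp Q (\sum_(u <- s) rank1 u.2 u.1) =
    \sum_(u <- [seq (u.1, Q u.2) | u <- s]) rank1 u.2 u.1.
  rewrite big_map; apply: bopP => x; rewrite /= !bop_sumE linear_sum.
  by apply: eq_bigr => u _; rewrite /= linearZ.
by rewrite !tr_sum !big_map.
Qed.

End TraceTheory.

Section FiniteRankFunctionals.
Variables (R : realType) (Z : normedModType R[i]).
Implicit Types (f : bop Z Z -> R[i]^o) (S T : bop Z Z).

(** Functionals on F(Z) are encoded as functions on all of [bop Z Z] that are constrained on finite
    rank operators only. *)
Definition fr_linear f : Prop := forall a S T, finite_rank S -> finite_rank T ->
  f (a *: S + T) = a *: f S + f T.

Definition fr_bounded f : Prop := exists2 K : R, 0 <= K &
  forall T, finite_rank T -> rnorm (f T) <= K * rnorm T.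

Definition prod_bounded f : Prop := exists2 K : R, 0 <= K &
  forall S T, finite_rank S -> finite_rank T ->
    rnorm (f (bcomp S T)) <= K * rnorm S * rnorm T.

Definition comm_bounded f : Prop := exists2 K : R, 0 <= K &
  forall S T, finite_rank S -> finite_rank T ->
    rnorm (f (bcomp S T - bcomp T S)) <= K * rnorm S * rnorm T.

Lemma fr_linearD f S T : fr_linear f -> finite_rank S -> finite_rank T ->
  f (S + T) = f S + f T.
Proof. by move=> lf fS fT; rewrite -[S in LHS]scale1r lf// scale1r. Qed.

Lemma fr_linearB f S T : fr_linear f -> finite_rank S -> finite_rank T ->
  f (S - T) = f S - f T.
Proof. by move=> lf fS fT; rewrite addrC -scaleN1r lf// scaleN1r addrC. Qed.

Lemma fr_linear0 f : fr_linear f -> f 0 = 0.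
Proof.
by move=> lf; have := fr_linearB lf (@finite_rank0 _ Z Z) (@finite_rank0 _ Z Z); rewrite !subrr.
Qed.

Lemma fr_linearZ f a T : fr_linear f -> finite_rank T -> f (a *: T) = a *: f T.
Proof. by move=> lf fT; rewrite -[a *: T]addr0 lf ?fr_linear0 ?addr0//; exact: finite_rank0. Qed.

Lemma fr_linear_subtr f (l : R[i]) : fr_linear f -> fr_linear (fun T => f T - l * tr T).
Proof.
move=> lf a S T fS fT; rewrite lf// tr_linear// mulrDr scalerBr opprD addrACA.
by congr (_ - _ + _); exact: mulrCA.
Qed.

Lemma finite_rankB S T : finite_rank S -> finite_rank T -> finite_rank (S - T).
Proof. by move=> fS fT; apply: finite_rankD => //; rewrite -scaleN1r; exact: finite_rankZ. Qed.

Lemma prod_bounded_comm f : fr_linear f -> prod_bounded f -> comm_bounded f.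
Proof.
move=> lf [K K0 fK]; exists (K + K) => [|S T fS fT]; first exact: addr_ge0.
rewrite fr_linearB//; try exact: finite_rank_compl.
rewrite (le_trans (rnormD _ _))// rnormN !mulrDl lerD ?fK//.
by rewrite (le_trans (fK T S fT fS))// mulrAC.
Qed.

End FiniteRankFunctionals.

Section DensityInAlgebra.
Variables (R : realType) (A : banachAlgebraType R[i]) (S : set A).
Hypothesis dS : rdense S.
Implicit Types (a b c : A) (f : bdual R A) (D : bop A (bdual R A)).

Lemma rnorm_dual_lact a f : rnorm (dual_lact a f) <= rnorm f * rnorm a.
Proof.
rewrite [leLHS]rnorm_bop; apply: op_norm_le => [|c]; first by rewrite mulr_ge0 ?rnorm_ge0.
rewrite (le_trans (op_normP f _))// -mulrA; apply: ler_wpM2l; first exact: op_norm_ge0.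
by rewrite mulrC rnorm_bmul.
Qed.

Lemma rnorm_dual_ract a f : rnorm (dual_ract f a) <= rnorm f * rnorm a.
Proof.
rewrite [leLHS]rnorm_bop; apply: op_norm_le => [|c]; first by rewrite mulr_ge0 ?rnorm_ge0.
rewrite (le_trans (op_normP f _))// -mulrA; apply: ler_wpM2l; first exact: op_norm_ge0.
by rewrite rnorm_bmul.
Qed.

Lemma bmulBl a b c : bmul (a - b) c = bmul a c - bmul b c.
Proof. by rewrite -scaleN1r bmulDl bmulZl scaleN1r. Qed.

Lemma bmulBr a b c : bmul c (a - b) = bmul c a - bmul c b.
Proof. by rewrite -scaleN1r bmulDr bmulZr scaleN1r. Qed.

(** The defect [h] of the derivation identity is additive and bounded in each variable, so density
    makes it vanish in one variable after the other: in [c], then in [b], then in [a]. *)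
Lemma derivation_dense D :
  (forall a b c, S a -> S b -> S c -> D (bmul a b) c = D b (bmul c a) + D a (bmul b c)) ->
  derivation D.
Proof.
move=> DS; have DB x y c : D (x - y) c = D x c - D y c by rewrite linearB.
pose h a b := D (bmul a b) - (dual_lact a (D b) + dual_ract (D a) b).
have hE a b c : h a b c = D (bmul a b) c - (D b (bmul c a) + D a (bmul b c)) by [].
have h0 a b : S a -> S b -> h a b = 0.
  move=> Sa Sb; apply/eqP; rewrite subr_eq0; apply/eqP/(bop_dense_eq dS) => c Sc.
  by rewrite DS.
have hb a b : rnorm (h a b) <= (rnorm D *+ 3) * rnorm a * rnorm b.
  have Dle c : rnorm (D c) <= rnorm D * rnorm c := op_normP D c.
  have D0 := rnorm_ge0 D; have a0 := rnorm_ge0 a; have b0 := rnorm_ge0 b.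
  rewrite (le_trans (rnormD _ _))// rnormN (le_trans (lerD (lexx _) (rnormD _ _)))//.
  have h1 : rnorm (D (bmul a b)) <= rnorm D * rnorm a * rnorm b.
    by rewrite (le_trans (Dle _))// -mulrA ler_wpM2l// rnorm_bmul.
  have h2 : rnorm (dual_lact a (D b)) <= rnorm D * rnorm a * rnorm b.
    by rewrite (le_trans (rnorm_dual_lact _ _))// mulrAC ler_wpM2r.
  have h3 : rnorm (dual_ract (D a) b) <= rnorm D * rnorm a * rnorm b.
    apply: le_trans (rnorm_dual_ract _ _) _; apply: ler_wpM2r => //; exact: Dle.
  by rewrite !mulrnAl !mulrSr mulr0n add0r -addrA lerD// lerD.
have hBl b a a' : h (a - a') b = h a b - h a' b.
  apply: bopP => c; have -> : (h a b - h a' b) c = h a b c - h a' b c by [].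
  rewrite !hE bmulBl bmulBr !DB !linearB /=.
  by ring.
have hBr a b b' : h a (b - b') = h a b - h a b'.
  apply: bopP => c; have -> : (h a b - h a b') c = h a b c - h a b' c by [].
  rewrite !hE bmulBr bmulBl !DB !linearB /=.
  by ring.
have h0' a b : S a -> h a b = 0.
  move=> Sa; move: b; apply: (dense_zero (K := (rnorm D *+ 3) * rnorm a) dS) => //.
  by move=> b Sb; exact: h0.
have h0'' a b : h a b = 0.
  move: a; apply: (dense_zero (K := (rnorm D *+ 3) * rnorm b) dS) => // [a|a Sa].
    by rewrite mulrAC.
  exact: h0'.
by move=> a b; apply/eqP; rewrite -subr_eq0; apply/eqP/h0''.
Qed.

Lemma inner_dense D f :
  (forall a c, S a -> S c -> D a c = f (bmul c a) - f (bmul a c)) -> inner_derivation D.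
Proof.
move=> DS; exists f; have DB x y c : D (x - y) c = D x c - D y c by rewrite linearB.
pose h a := D a - (dual_lact a f - dual_ract f a).
have hE a c : h a c = D a c - (f (bmul c a) - f (bmul a c)) by [].
suff h0 a : h a = 0 by move=> a; apply/eqP; rewrite -subr_eq0; apply/eqP/h0.
move: a; apply: (dense_zero (K := rnorm D + (rnorm f + rnorm f)) dS) => [a a'|a|a Sa].
- apply: bopP => c; have -> : (h a - h a') c = h a c - h a' c by [].
  rewrite !hE bmulBl bmulBr !DB !linearB /=.
  by ring.
- rewrite (le_trans (rnormD _ _))// rnormN mulrDl lerD//; first exact: (op_normP D a).
  rewrite (le_trans (rnormD _ _))// rnormN mulrDl lerD//.
    exact: rnorm_dual_lact.
  exact: rnorm_dual_ract.
- by apply: (bop_dense_eq dS) => c Sc; rewrite hE DS// subrr.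
Qed.

End DensityInAlgebra.

Section ApproximableTheory.
Variables (R : realType) (Z : completeNormedModType R[i]).
Implicit Types (f : bop Z Z -> R[i]^o).

Lemma finite_rank_approximable (T : bop Z Z) : finite_rank T -> T \in @approximable R Z.
Proof.
by move=> fT; apply/approximableP => e e0; exists T; rewrite // subrr rnorm0.
Qed.

Definition fop (T : bop Z Z) (fT : finite_rank T) : aop Z := Aop (finite_rank_approximable fT).

Definition frset : set (aop Z) := [set T | finite_rank (aop_bop T)].

Lemma frset_dense : rdense frset.
Proof.
move=> [T /= aT] e e0; have /approximableP/(_ e e0)[S fS TS] := aT.
by exists (fop fS).
Qed.

Lemma frset_subspace : is_subspace frset.
Proof.
split; first exact: finite_rank0.
by move=> a S T fS fT; apply: finite_rankD => //; exact: finite_rankZ.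
Qed.

Lemma fr_bounded_extend f : fr_linear f -> fr_bounded f ->
  exists g : bdual R (aop Z), forall T, frset T -> g T = f (aop_bop T).
Proof.
move=> lf [K K0 fK].
have [||g [gf _]] := @dense_extend _ _ _ frset (fun T => f (aop_bop T)) K frset_subspace
  (@complex_rapidly_complete R) frset_dense K0.
- by move=> a S T fS fT; exact: lf.
- by move=> T fT; exact: fK.
by exists g.
Qed.

Lemma bmul_aop (S T : aop Z) : aop_bop (bmul S T) = bcomp (aop_bop S) (aop_bop T).
Proof. by []. Qed.

End ApproximableTheory.

(** * Criteria for weak amenability and self-inducedness *)

Section WeakAmenabilityCriterion.
Variables (R : realType) (Z : completeNormedModType R[i]).
Implicit Types (f : bop Z Z -> R[i]^o).

Lemma dual_pair : (exists z : Z, z <> 0) -> exists (z : Z) (e : bdual R Z), e z = 1.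
Proof.
move=> [z /eqP z0]; have [g _ gz] := norming_functional z.
exists z, ((rnorm z)^-1%:C *: g).
have -> : ((rnorm z)^-1%:C *: g) z = (rnorm z)^-1%:C * (rnorm z)%:C by rewrite -gz.
rewrite -rmorphM /= mulVf ?rmorph1//.
by apply: contra_neq z0 => /rnorm0_eq0.
Qed.

(** The operator [rank1 x x'] factors as [bcomp (rank1 x e) (rank1 z0 x')]; interchanging the
    factors leaves [x' x *: rank1 z0 e], and [x' x] is the trace. *)
Lemma trace_of_tracial (h : bop Z Z -> R[i]^o) (z0 : Z) (e : bdual R Z) : e z0 = 1 ->
  fr_linear h -> (forall S T, finite_rank S -> finite_rank T -> h (bcomp S T) = h (bcomp T S)) ->
  forall T, finite_rank T -> h T = h (rank1 z0 e) * tr T.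
Proof.
move=> ez lh hC; apply: finite_rank_ind.
- have -> : tr (0 : bop Z Z) = 0.
    by have := @tr_sum R Z [::]; rewrite !big_nil.
  by rewrite mulr0 fr_linear0.
- move=> x x'; rewrite tr_rank1.
  have -> : rank1 x x' = bcomp (rank1 x e) (rank1 z0 x') by rewrite rank1_comp ez scale1r.
  rewrite hC; try exact: finite_rank_rank1.
  by rewrite rank1_comp fr_linearZ//; [exact: mulrC | exact: finite_rank_rank1].
- move=> S T fS fT hS hT; rewrite (fr_linearD lh)// hS hT -mulrDr; congr (_ * _).
  by rewrite -[S in RHS]scale1r tr_linear// mul1r.
Qed.

(** The values [f (T S - S T)] define a derivation. If [g] implements it, then [f - g] agrees on
    [S T] and [T S], so [trace_of_tracial] makes it a multiple of the trace. *)
Lemma weakly_amenable_functional f : (exists z : Z, z <> 0) -> weakly_amenable (aop Z) ->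
  fr_linear f -> comm_bounded f -> exists l : R[i], fr_bounded (fun T => f T - l * tr T).
Proof.
move=> /dual_pair[z0 [e ez]] wa lf [K K0 fK].
pose beta (S T : aop Z) : R[i]^o :=
  f (bcomp (aop_bop T) (aop_bop S) - bcomp (aop_bop S) (aop_bop T)).
have fc (S T : aop Z) : frset S -> frset T ->
    finite_rank (bcomp (aop_bop S) (aop_bop T)).
  by move=> fS _; exact: finite_rank_compl.
have fcc (S T : aop Z) : frset S -> frset T ->
    finite_rank (bcomp (aop_bop S) (aop_bop T) - bcomp (aop_bop T) (aop_bop S)).
  by move=> fS fT; apply: finite_rankB; exact: fc.
have [||S T fS fT|D DE] := @bilinear_extend R _ _ (@frset R Z) (@frset R Z) beta K (@frset_subspace R Z)
  (@frset_subspace R Z) (@frset_dense R Z) (@frset_dense R Z) K0.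
- move=> a S S' T fS fS' fT; rewrite /beta -lf; [|exact: fcc..].
  congr f; have -> : aop_bop (a *: S + S') = a *: aop_bop S + aop_bop S' by [].
  by rewrite bcompDr bcompZr bcompDl bcompZl scalerBr opprD addrACA.
- move=> a S T T' fS fT fT'; rewrite /beta -lf; [|exact: fcc..].
  congr f; have -> : aop_bop (a *: T + T') = a *: aop_bop T + aop_bop T' by [].
  by rewrite bcompDr bcompZr bcompDl bcompZl scalerBr opprD addrACA.
- by rewrite /beta (le_trans (fK _ _ fT fS))// mulrAC.
have frmul (a b : aop Z) : frset a -> frset b -> frset (bmul a b) by exact: fc.
have dD : derivation D.
  apply: (derivation_dense (@frset_dense R Z)) => a b c fa fb fc'.
  rewrite !DE//; [|exact: frmul..].
  rewrite /beta -(fr_linearD lf (fcc _ _ (frmul _ _ fc' fa) fb) (fcc _ _ (frmul _ _ fb fc') fa)).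
  by congr f; rewrite !bmul_aop !bcompA addrA subrK.
have [g gP] := wa D dD.
(* The value 0 outside the finite rank operators is a dummy that makes [g'] total. *)
pose g' (T : bop Z Z) : R[i]^o :=
  if pselect (finite_rank T) is left fT then g (fop fT) else 0.
have g'E T (fT : finite_rank T) : g' T = g (fop fT).
  rewrite /g'; case: pselect => // fT'; congr (g _); exact: val_inj.
have lg : fr_linear g'.
  move=> a S T fS fT; have fST : finite_rank (a *: S + T).
    by apply: finite_rankD => //; exact: finite_rankZ.
  rewrite !g'E -linearP; congr (g _); exact: val_inj.
pose h T : R[i]^o := f T - g' T.
have lh : fr_linear h.
  by move=> a S T fS fT; rewrite /h lf// lg// scalerBr opprD addrACA.
have hC S T : finite_rank S -> finite_rank T -> h (bcomp S T) = h (bcomp T S).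
  move=> fS fT; have fST : finite_rank (bcomp S T) by exact: finite_rank_compl.
  have fTS : finite_rank (bcomp T S) by exact: finite_rank_compl.
  have : D (fop fT) (fop fS) = g (bmul (fop fS) (fop fT)) - g (bmul (fop fT) (fop fS)).
    by rewrite gP.
  rewrite DE// /beta /= fr_linearB//.
  have -> : g (bmul (fop fS) (fop fT)) = g' (bcomp S T).
    by rewrite g'E; congr (g _); exact: val_inj.
  have -> : g (bmul (fop fT) (fop fS)) = g' (bcomp T S).
    by rewrite g'E; congr (g _); exact: val_inj.
  move=> E; apply/eqP; rewrite -subr_eq0 /h; apply/eqP.
  rewrite [LHS](_ : _ = f (bcomp S T) - f (bcomp T S) - (g' (bcomp S T) - g' (bcomp T S))).
    by rewrite E subrr.
  by ring.
exists (h (rank1 z0 e)); exists (rnorm g) => [|T fT]; first exact: rnorm_ge0.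
rewrite -(trace_of_tracial ez lh hC fT) /h subKr g'E.
exact: (op_normP g (fop fT)).
Qed.

(** The functional is read off [D]. If [D S T = f (T S - S T)], then [D (r1 z0 x') (r1 x e)] equals
    [f (rank1 x x')] minus [x' x] times the constant [f (rank1 z0 e)], and a multiple of the trace
    is free. *)
Lemma weakly_amenable_of_functional : (exists z : Z, z <> 0) ->
  (forall f, fr_linear f -> comm_bounded f ->
    exists l : R[i], fr_bounded (fun T => f T - l * tr T)) ->
  weakly_amenable (aop Z).
Proof.
move=> /dual_pair[z0 [e ez]] H D dD.
pose r1 (x : Z) (x' : bdual R Z) : aop Z := fop (finite_rank_rank1 x x').
have r1M x x' y y' : bmul (r1 x x') (r1 y y') = x' y *: r1 x y'.
  by apply: val_inj; exact: rank1_comp.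
have r1l x' : linear (r1^~ x').
  by move=> a x y; apply/val_inj/bopP => z; rewrite /= scalerDr scalerA mulrC -scalerA.
have r1r x : linear (r1 x).
  move=> a x' y'; apply/val_inj/bopP => z.
  have -> : aop_bop (r1 x (a *: x' + y')) z = (a * x' z + y' z) *: x by [].
  by rewrite scalerDl -scalerA.
have DM a b c : D (bmul a b) c = D b (bmul c a) + D a (bmul b c) by rewrite dD.
pose beta (x : Z) (x' : bdual R Z) : R[i]^o := D (r1 z0 x') (r1 x e).
have bl x' : linear (beta^~ x') by move=> a x y; rewrite /beta r1l linearP.
have br x : linear (beta x) by move=> a x' y'; rewrite /beta r1r linearP.
have /choice[s sP] (T : bop Z Z) : exists s, finite_rank T -> T = \sum_(u <- s) rank1 u.2 u.1.
  by have [/finite_rank_rank1_sum[s]|nT] := pselect (finite_rank T); [exists s | exists [::]].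
pose f T : R[i]^o := \sum_(u <- s T) beta u.2 u.1.
have fE t : f (\sum_(u <- t) rank1 u.2 u.1) = \sum_(u <- t) beta u.2 u.1.
  apply: rank1_sum_eq => //; rewrite -sP//.
  by apply: finite_rank_sum => u; exact: finite_rank_rank1.
have f1 x x' : f (rank1 x x') = beta x x'.
  by have := fE [:: (x', x)]; rewrite !big_seq1.
have lf : fr_linear f.
  move=> a S T /finite_rank_rank1_sum[p ->] /finite_rank_rank1_sum[q ->].
  have -> : a *: (\sum_(u <- p) rank1 u.2 u.1) + \sum_(u <- q) rank1 u.2 u.1 =
      \sum_(u <- [seq (a *: u.1, u.2) | u <- p] ++ q) rank1 u.2 u.1.
    rewrite big_cat big_map scaler_sumr; congr (_ + _); apply: eq_bigr => u _.
    by apply: bopP => x; exact: scalerA.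
  rewrite !fE big_cat big_map scaler_sumr; congr (_ + _); apply: eq_bigr => u _ /=.
  have := br u.2 a u.1 0; rewrite addr0 => ->.
  have := br u.2 1 0 0; rewrite scaler0 addr0 scale1r -{1}[beta _ 0]addr0 => /addrI <-.
  by rewrite addr0.
have De : D (r1 z0 e) (r1 z0 e) = 0.
  have := DM (r1 z0 e) (r1 z0 e) (r1 z0 e); rewrite r1M ez scale1r.
  by rewrite -{1}[D _ _]addr0 => /addrI.
have DZ k a b : D (k *: a) b = k * D a b by rewrite linearZ.
(* The product of [r1 z0 y'] and [r1 x e] is [y' x *: r1 z0 e], so by [De] one side of the
   derivation identity at [r1 z0 e] vanishes. *)
have Danti x y' : D (r1 x e) (r1 z0 y') = - beta x y'.
  have := DM (r1 z0 y') (r1 x e) (r1 z0 e); rewrite !r1M ez !scale1r DZ De mulr0.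
  by move=> /esym/eqP; rewrite addr_eq0 => /eqP.
have Df1 x x' y y' : D (r1 x x') (r1 y y') =
    f (bcomp (rank1 y y') (rank1 x x') - bcomp (rank1 x x') (rank1 y y')).
  have -> : r1 x x' = bmul (r1 x e) (r1 z0 x') by rewrite r1M ez scale1r.
  rewrite DM !r1M !linearZ /= Danti !rank1_comp.
  rewrite fr_linearB//; [|by apply: finite_rankZ; exact: finite_rank_rank1..].
  rewrite !fr_linearZ//; [|exact: finite_rank_rank1..].
  by rewrite !f1 scalerN.
have fc S T : finite_rank S -> finite_rank T -> finite_rank (bcomp T S - bcomp S T : bop Z Z).
  by move=> fS fT; apply: finite_rankB; exact: finite_rank_compl.
have Df1' x x' (b : aop Z) : frset b ->
    D (r1 x x') b = f (bcomp (aop_bop b) (rank1 x x') - bcomp (rank1 x x') (aop_bop b)).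
  case: b => T aT fT; rewrite /frset /= in fT *; move: T fT aT.
  apply: finite_rank_ind => [a0|y y' aT|S T fS fT IS IT aST].
  - have -> : Aop a0 = 0 by exact: val_inj.
    by rewrite linear0 bcomp0l bcomp0r subrr fr_linear0.
  - have -> : Aop aT = r1 y y' by exact: val_inj.
    exact: Df1.
  - have -> : Aop aST = fop fS + fop fT by exact: val_inj.
    have -> : D (r1 x x') (fop fS + fop fT) = D (r1 x x') (fop fS) + D (r1 x x') (fop fT).
      by rewrite linearD.
    rewrite (IS (finite_rank_approximable fS)) (IT (finite_rank_approximable fT)).
    rewrite -fr_linearD//; [|by apply: fc => //; exact: finite_rank_rank1..].
    by congr f; rewrite bcompDl bcompDr opprD addrACA.
have Df (a b : aop Z) : frset a -> frset b ->
    D a b = f (bcomp (aop_bop b) (aop_bop a) - bcomp (aop_bop a) (aop_bop b)).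
  case: a => S aS fS fb; rewrite /frset /= in fS *; move: S fS aS.
  apply: finite_rank_ind => [a0|y y' aS|S T fS fT IS IT aST].
  - have -> : Aop a0 = 0 by exact: val_inj.
    by rewrite linear0 bcomp0l bcomp0r subrr fr_linear0.
  - have -> : Aop aS = r1 y y' by exact: val_inj.
    exact: Df1'.
  - have -> : Aop aST = fop fS + fop fT by exact: val_inj.
    have -> : D (fop fS + fop fT) b = D (fop fS) b + D (fop fT) b by rewrite linearD.
    rewrite (IS (finite_rank_approximable fS)) (IT (finite_rank_approximable fT)).
    rewrite -fr_linearD//; [|by apply: fc..].
    by congr f; rewrite bcompDl bcompDr opprD addrACA.
have [l [L L0 gL]] : exists l : R[i], fr_bounded (fun T => f T - l * tr T).
  apply: H => //; exists (rnorm D) => [|S T fS fT]; first exact: rnorm_ge0.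
  have := Df (fop fT) (fop fS) fT fS; rewrite /= => <-.
  rewrite (le_trans (op_normP _ _))// mulrAC; apply: ler_wpM2r; first exact: rnorm_ge0.
  exact: (op_normP D (fop fT)).
have [g gE] := fr_bounded_extend (fr_linear_subtr l lf) (ex_intro2 _ _ L L0 gL).
apply: (inner_dense (@frset_dense R Z) (f := g)) => a b fa fb.
have fab : frset (bmul a b) by exact: finite_rank_compl.
have fba : frset (bmul b a) by exact: finite_rank_compl.
(* The multiple of the trace by which [g] differs from [f] cancels in the commutator. *)
rewrite Df// !gE// !bmul_aop fr_linearB// (@tr_comm R _ _ (aop_bop b))//.
by ring.
Qed.

End WeakAmenabilityCriterion.

Section BalancedDensity.
Variables (R : realType) (A : banachAlgebraType R[i]) (S : set A).
Hypothesis dS : rdense S.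
Implicit Types (a b c x y z : A).

Lemma balanced_functional (D : bop A (bdual R A)) :
  (forall a b c, S a -> S b -> S c -> D (bmul a b) c = D a (bmul b c)) ->
  exists F : bdual R (balanced_tensor A), forall a b, F (balanced_pure a b) = D a b.
Proof.
move=> DS.
have Dle a b : rnorm (D a b) <= rnorm D * rnorm a * rnorm b.
  rewrite (le_trans (op_normP (D a) b))//; apply: ler_wpM2r; first exact: rnorm_ge0.
  exact: (op_normP D a).
have DB x y c : D (x - y) c = D x c - D y c by rewrite linearB.
have Dbal a b c : D (bmul a b) c = D a (bmul b c).
  have bnd x y z : rnorm (D (bmul x y) z - D x (bmul y z)) <= (rnorm D *+ 2) * rnorm x * rnorm y * rnorm z.
    rewrite (le_trans (rnormD _ _))// rnormN !mulrnAl mulr2n; apply: lerD.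
      rewrite (le_trans (Dle _ _))// -[rnorm D * rnorm x * rnorm y]mulrA.
      apply: ler_wpM2r; first exact: rnorm_ge0.
      by apply: ler_wpM2l; [exact: rnorm_ge0 | exact: rnorm_bmul].
    rewrite (le_trans (Dle _ _))// -[leRHS]mulrA.
    apply: ler_wpM2l; last exact: rnorm_bmul.
    by apply: mulr_ge0; exact: rnorm_ge0.
  have F2 x y : S x -> S y -> forall z, D (bmul x y) z - D x (bmul y z) = 0.
    move=> fx fy; apply: (dense_zero (K := (rnorm D *+ 2) * rnorm x * rnorm y) dS) => //.
      by move=> z z'; rewrite bmulBr !linearB /=; ring.
    by move=> z fz; rewrite DS// subrr.
  have F1 x : S x -> forall y z, D (bmul x y) z - D x (bmul y z) = 0.
    move=> fx y z; move: y; apply: (dense_zero (K := (rnorm D *+ 2) * rnorm x * rnorm z) dS).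
    - by move=> y y'; rewrite bmulBr bmulBl DB linearB /=; ring.
    - by move=> y; rewrite mulrAC.
    - by move=> y fy; exact: F2.
  apply/eqP; rewrite -subr_eq0; apply/eqP.
  move: a; apply: (dense_zero (K := (rnorm D *+ 2) * rnorm b * rnorm c) dS).
  - by move=> x x'; rewrite bmulBl !DB; ring.
  - by move=> x; apply: le_trans (bnd _ _ _) _; rewrite -!mulrA [rnorm x * _]mulrC !mulrA.
  - by move=> x fx; exact: F1.
apply: (@balanced_extend R A R[i]^o (fun a b => D a b) (rnorm D)) => //.
- by move=> b k x y; rewrite linearP.
- by move=> a; exact: linearP.
- exact: rnorm_ge0.
- exact: complex_rapidly_complete.
Qed.

Lemma balanced_mul : exists phi : bop (balanced_tensor A) A,
  forall a b, phi (balanced_pure a b) = bmul a b.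
Proof.
apply: (@balanced_extend R A A (fun a b => bmul a b) 1).
- by move=> b a x y; rewrite /= bmulDl bmulZl.
- by move=> b a x y; rewrite bmulDr bmulZr.
- exact: ler01.
- by move=> a b; rewrite mul1r rnorm_bmul.
- by move=> a b c; rewrite bmulA.
- exact: complete_rapidly_complete.
Qed.

(** Extended by continuity to all products, [psiS] makes [psi] a left inverse of [phi] on elementary
    tensors. For the other composition each [x] in [S] is written as a product [bmul e x]. *)
Lemma self_induced_dense (psi : bop A (balanced_tensor A)) :
  (forall x y, S x -> S y -> psi (bmul x y) = balanced_pure x y) ->
  (forall x, S x -> exists2 e, S e & bmul e x = x) -> self_induced A.
Proof.
move=> psiS S1; have [phi phiE] := balanced_mul; exists phi, psi.
have bn x y : rnorm (psi (bmul x y) - balanced_pure x y) <= (rnorm psi + 1) * rnorm x * rnorm y.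
  apply: le_trans (rnormD _ _) _; rewrite rnormN -mulrA mulrDl mul1r; apply: lerD.
    apply: le_trans (op_normP psi _) _; apply: ler_wpM2l; first exact: op_norm_ge0.
    exact: rnorm_bmul.
  exact: rnorm_balanced_pure.
have bpBl x x' y : balanced_pure (x - x') y = balanced_pure x y - balanced_pure x' y.
  by rewrite addrC -scaleN1r balanced_pure_linearl scaleN1r addrC.
have bpBr x x' y : balanced_pure y (x - x') = balanced_pure y x - balanced_pure y x'.
  by rewrite addrC -scaleN1r balanced_pure_linearr scaleN1r addrC.
have F1 x : S x -> forall y, psi (bmul x y) - balanced_pure x y = 0.
  move=> fx; apply: (dense_zero (K := (rnorm psi + 1) * rnorm x) dS).
  - by move=> y y'; rewrite bmulBr bpBr linearB /= !opprD opprK addrACA.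
  - by move=> y; exact: bn.
  - by move=> y fy; rewrite psiS// subrr.
have psiM a b : psi (bmul a b) = balanced_pure a b.
  apply/eqP; rewrite -subr_eq0; apply/eqP; move: a.
  apply: (dense_zero (K := (rnorm psi + 1) * rnorm b) dS).
  - by move=> x x'; rewrite bmulBl bpBl linearB /= !opprD opprK addrACA.
  - by move=> x; rewrite mulrAC.
  - by move=> x fx; exact: F1.
have idB (V : normedModType R[i]) : id \in @bounded_linear R V V.
  by apply/bounded_linearP; split=> //; exists 1 => x; rewrite mul1r.
split=> //.
  suff E1 : bcomp psi phi = Bop (idB _).
    by move=> x; exact: (congr1 (fun h => bop_fun h x) E1).
  by apply: balanced_bop_eq => a b /=; rewrite phiE psiM.
suff E1 : bcomp phi psi = Bop (idB _).
  by move=> x; exact: (congr1 (fun h => bop_fun h x) E1).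
apply: (bop_dense_eq dS) => x Sx /=; have [e Se ex] := S1 x Sx.
by rewrite -{1}ex psiM phiE ex.
Qed.

End BalancedDensity.

Section SelfInducedCriterion.
Variables (R : realType) (Z : completeNormedModType R[i]).
Implicit Types (f : bop Z Z -> R[i]^o).

(** The values [f (S T)] induce a functional [F] on the balanced tensor product. For a left unit [E]
    of [T], multiplication sends the tensor of [E] and [T] to [T], so that tensor is [psi T], and
    [F (psi T) = f (E T) = f T]. *)
Lemma self_induced_functional f : self_induced (aop Z) ->
  fr_linear f -> prod_bounded f -> fr_bounded f.
Proof.
move=> [phi [psi [phiE phiK psiK]]] lf [K K0 fK].
pose beta (S T : aop Z) : R[i]^o := f (bcomp (aop_bop S) (aop_bop T)).
have fc (S T : aop Z) : frset S -> frset T -> frset (bmul S T).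
  by move=> fS _; exact: finite_rank_compl.
have [||S T fS fT|D DE] := @bilinear_extend R _ _ (@frset R Z) (@frset R Z) beta K
  (@frset_subspace R Z) (@frset_subspace R Z) (@frset_dense R Z) (@frset_dense R Z) K0.
- move=> a S S' T fS fS' fT; rewrite /beta -lf; [|exact: fc..].
  by congr f; rewrite bcompDl bcompZl.
- move=> a S T T' fS fT fT'; rewrite /beta -lf; [|exact: fc..].
  by congr f; rewrite bcompDr bcompZr.
- exact: fK.
have [|F FE] := balanced_functional (@frset_dense R Z) (D := D).
  move=> a b c fa fb fc'; rewrite !DE//; [|exact: fc..].
  by rewrite /beta !bmul_aop bcompA.
exists (rnorm F * rnorm psi) => [|T fT]; first by rewrite mulr_ge0 ?rnorm_ge0.
have [n [g [b [ET _]]]] := finite_rank_fix2 fT fT.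
have fE := finite_rank_bproj n g b.
have -> : f T = F (psi (fop fT)).
  have -> : fop fT = phi (balanced_pure (fop fE) (fop fT)).
    by rewrite phiE; apply: val_inj; rewrite /= ET.
  by rewrite phiK FE DE// /beta /= ET.
rewrite (le_trans (op_normP _ _))// -mulrA; apply: ler_wpM2l; first exact: op_norm_ge0.
exact: (op_normP psi (fop fT)).
Qed.

(** The inverse of multiplication is forced to send a finite rank [T] to the tensor of a left unit
    of [T] with [T]. The work lies in showing that this is well defined, linear and bounded. *)
Lemma self_induced_of_functional :
  (forall f, fr_linear f -> prod_bounded f -> fr_bounded f) -> self_induced (aop Z).
Proof.
move=> H.
have /choice[E EP] (T : aop Z) : exists E : aop Z, frset T -> frset E /\ bmul E T = T.
  have [fT|nT] := pselect (frset T); last by exists 0 => /nT.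
  have [n [g [b [ET _]]]] := finite_rank_fix2 fT fT.
  exists (fop (finite_rank_bproj n g b)) => _; split; first exact: finite_rank_bproj.
  by apply: val_inj; exact: ET.
pose psi0 T := balanced_pure (E T) T.
(* A common left unit [G] of [F] and [E T] is moved across the tensor sign: both tensors equal that
   of [G] and [T]. *)
have psi0E (F T : aop Z) : frset F -> frset T -> bmul F T = T -> psi0 T = balanced_pure F T.
  move=> fF fT FT; have [fE ET] := EP T fT.
  have [n [g [b [GF GE]]]] := finite_rank_fix2 fF fE.
  pose G := fop (finite_rank_bproj n g b).
  have {}GF : bmul G F = F by exact: val_inj.
  have {}GE : bmul G (E T) = E T by exact: val_inj.
  by rewrite /psi0 -GE balanced_pureA ET -[F in RHS]GF balanced_pureA FT.
have psi0M (S T : aop Z) : frset S -> frset T -> psi0 (bmul S T) = balanced_pure S T.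
  move=> fS fT; have [fE ES] := EP S fS.
  have fST : frset (bmul S T) by exact: finite_rank_compl.
  by rewrite (psi0E (E S))// -?balanced_pureA ?ES// bmulA ES.
have psi0_lin a S T : frset S -> frset T -> psi0 (a *: S + T) = a *: psi0 S + psi0 T.
  move=> fS fT; have fST := (@frset_subspace R Z).2 a S T fS fT.
  have [n [g [b [GS GT]]]] := finite_rank_fix2 fS fT.
  have fG := finite_rank_bproj n g b; pose G : aop Z := fop fG.
  have {}GS : bmul G S = S by exact: val_inj.
  have {}GT : bmul G T = T by exact: val_inj.
  rewrite !(psi0E G)//; first exact: balanced_pure_linearr.
  by rewrite bmulDr bmulZr GS GT.
have [C C0 psi0C] : exists2 C : R, 0 <= C & forall T, frset T -> rnorm (psi0 T) <= C * rnorm T.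
  have ptw (g : bdual R (balanced_tensor (aop Z))) : exists C : R, forall T, frset T ->
      rnorm (g (psi0 T)) <= C * rnorm T.
    pose f (T : bop Z Z) : R[i]^o :=
      if pselect (finite_rank T) is left fT then g (psi0 (fop fT)) else 0.
    have fE T : frset T -> f (aop_bop T) = g (psi0 T).
      by move=> fT; rewrite /f; case: pselect => // fT'; congr (g (psi0 _)); exact: val_inj.
    have [||C C0 fC] := H f.
    - move=> a S T fS fT; have := @frset_subspace R Z; case=> _ /(_ a (fop fS) (fop fT) fS fT) fST.
      have := fE _ fST; rewrite /= => ->; rewrite psi0_lin// linearP.
      by have := fE _ (fS : frset (fop fS)); have := fE _ (fT : frset (fop fT)); rewrite /= => -> ->.
    - exists (rnorm g) => [|S T fS fT]; first exact: rnorm_ge0.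
      have fST : frset (bmul (fop fS) (fop fT)) by exact: finite_rank_compl.
      have := fE _ fST; rewrite bmul_aop /= => ->; rewrite psi0M//.
      rewrite (le_trans (op_normP _ _))// -mulrA; apply: ler_wpM2l; first exact: op_norm_ge0.
      exact: rnorm_balanced_pure.
    exists C => T fT; rewrite -fE//; exact: fC.
  pose I := {T : aop Z | frset T /\ rnorm T <= 1}.
  have evB (x : balanced_tensor (aop Z)) :
      (fun g : bdual R (balanced_tensor (aop Z)) => g x) \in @bounded_linear R _ R[i]^o.
    apply/bounded_linearP; split=> [a g h|]; first by rewrite bopD bopZ.
    by exists (rnorm x) => g; rewrite mulrC; exact: (op_normP g x).
  (* The evaluations at [psi0 T], for [T] in the unit ball, are pointwise bounded on the complete
     dual; a norming functional then turns their uniform bound into one for [psi0 T] itself. *)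
  have [g|M HM] := @banach_steinhaus R _ _ I (fun T => Bop (evB (psi0 (sval T))))
    (@dual_rapidly_complete R _).
    have [C gC] := ptw g; exists `|C| => -[T [fT T1]] /=.
    rewrite (le_trans (gC T fT))// (le_trans (ler_wpM2r (rnorm_ge0 _) (ler_norm C)))//.
    by rewrite ler_piMr.
  exists `|M| => // T fT.
  have psi0Z a S : frset S -> psi0 (a *: S) = a *: psi0 S.
    move=> fS; have f0 : frset (0 : aop Z) by exact: finite_rank0.
    have p0 : psi0 0 = 0.
      have := psi0_lin 1 0 0 f0 f0; rewrite scaler0 addr0 scale1r -{1}[psi0 0]addr0.
      by move=> /addrI/esym.
    by rewrite -[a *: S]addr0 psi0_lin// p0 addr0.
  have [->|T0] := eqVneq T 0.
    have f0 : frset (0 : aop Z) by exact: finite_rank0.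
    by rewrite -(scale0r 0) psi0Z// scale0r rnorm0 mulr_ge0 ?rnorm_ge0.
  have nT : 0 < rnorm T.
    by rewrite lt_neqAle rnorm_ge0 andbT eq_sym; apply: contra_neq T0 => /rnorm0_eq0.
  pose T1 := (rnorm T)^-1%:C *: T.
  have fT1 : frset T1 by exact: finite_rankZ.
  have T1n : rnorm T1 <= 1.
    by rewrite rnormZ rnormC ?invr_ge0 ?rnorm_ge0// mulVf ?gt_eqF.
  have TE : T = (rnorm T)%:C *: T1.
    by rewrite scalerA -rmorphM /= mulfV ?gt_eqF// scale1r.
  rewrite {1}TE psi0Z// rnormZ rnormC ?rnorm_ge0// mulrC; apply: ler_wpM2r; first exact: rnorm_ge0.
  have [g gle gE] := norming_functional (psi0 T1).
  have gn : rnorm g <= 1.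
    by rewrite rnorm_bop; apply: op_norm_le => // x; rewrite mul1r.
  have -> : rnorm (psi0 T1) = rnorm (g (psi0 T1)) by rewrite gE rnormC ?rnorm_ge0.
  have := op_normP (Bop (evB (psi0 T1))) g; rewrite /= => /le_trans; apply.
  have := HM (exist _ T1 (conj fT1 T1n)); rewrite rnorm_bop /= => HM1.
  rewrite (le_trans (ler_wpM2r (rnorm_ge0 _) HM1))//.
  rewrite (le_trans (ler_wpM2r (rnorm_ge0 _) (ler_norm M)))//.
  by rewrite ler_piMr.
have [psi [psiE _]] := @dense_extend R _ _ (@frset R Z) psi0 C (@frset_subspace R Z)
  (@balanced_rapidly_complete R (aop Z)) (@frset_dense R Z) C0 psi0_lin psi0C.
apply: (self_induced_dense (@frset_dense R Z) (psi := psi)) => [S T fS fT|T fT].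
  rewrite psiE; first exact: psi0M.
  exact: finite_rank_compl.
by have [fE ET] := EP T fT; exists (E T).
Qed.

End SelfInducedCriterion.

(** * Unboundedness of the trace *)

Section HilbertNorm.
Variables (R : realType) (m : nat).
Implicit Types (a x : 'cV[R[i]]_m) (M W : 'M[R[i]]_m).

Definition sqnorm a : R := \sum_(i < m) rnorm (a i 0) ^+ 2.
Definition hnorm a : R := Num.sqrt (sqnorm a).

Lemma sqnorm_ge0 a : 0 <= sqnorm a.
Proof. by apply: sumr_ge0 => i _; rewrite sqr_ge0. Qed.

Lemma hnorm_ge0 a : 0 <= hnorm a. Proof. exact: sqrtr_ge0. Qed.

Lemma sqr_hnorm a : hnorm a ^+ 2 = sqnorm a.
Proof. by rewrite sqr_sqrtr ?sqnorm_ge0. Qed.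

Lemma sqnormZ (k : R[i]) a : sqnorm (k *: a) = rnorm k ^+ 2 * sqnorm a.
Proof. by rewrite mulr_sumr; apply: eq_bigr => i _; rewrite mxE rnormM exprMn. Qed.

Lemma hnormZ (k : R[i]) a : hnorm (k *: a) = rnorm k * hnorm a.
Proof. by rewrite /hnorm sqnormZ sqrtrM ?sqr_ge0// sqrtr_sqr ger0_norm ?rnorm_ge0. Qed.

Lemma rnorm_coord a i : rnorm (a i 0) <= hnorm a.
Proof.
rewrite -[leLHS]ger0_norm ?rnorm_ge0// -sqrtr_sqr ler_sqrt ?sqnorm_ge0//.
by rewrite /sqnorm (bigD1 i)//= lerDl sumr_ge0// => j _; rewrite sqr_ge0.
Qed.

Lemma hnorm_eq0 a : hnorm a = 0 -> a = 0.
Proof.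
move=> a0; apply/matrixP => i j; rewrite ord1 mxE; apply: rnorm0_eq0.
by apply/eqP; rewrite eq_le rnorm_ge0 andbT -a0 rnorm_coord.
Qed.

Definition adjmx p q (A : 'M[R[i]]_(p, q)) : 'M[R[i]]_(q, p) := map_mx Num.conj A^T.

Lemma adjmxM p q r (A : 'M[R[i]]_(p, q)) (B : 'M[R[i]]_(q, r)) :
  adjmx (A *m B) = adjmx B *m adjmx A.
Proof. by rewrite /adjmx trmx_mul map_mxM. Qed.

Lemma adjmxK p q (A : 'M[R[i]]_(p, q)) : adjmx (adjmx A) = A.
Proof. by apply/matrixP => i j; rewrite !mxE conjCK. Qed.

Lemma sqr_rnorm (z : R[i]) : (rnorm z ^+ 2)%:C = Num.conj z * z.
Proof. by rewrite rmorphXn /= rnormE normCKC. Qed.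

Lemma sqnormE a : (sqnorm a)%:C = (adjmx a *m a) 0 0.
Proof.
rewrite mxE rmorph_sum; apply: eq_bigr => i _; rewrite [LHS]sqr_rnorm.
by rewrite !mxE.
Qed.

Lemma hnorm_isometry W : adjmx W *m W = 1%:M -> forall x, hnorm (W *m x) = hnorm x.
Proof.
move=> WW x; congr Num.sqrt; apply: complexI; rewrite !sqnormE adjmxM.
by rewrite mulmxA -[adjmx x *m _ *m _]mulmxA WW mulmx1.
Qed.

Lemma conj_real (t : R) : Num.conj t%:C = t%:C :> R[i].
Proof. exact: conjc_real. Qed.

Lemma adjmx_delta (w : 'cV[R[i]]_m) i : adjmx w *m delta_mx i 0 = (Num.conj (w i 0))%:M :> 'M[R[i]]_1.
Proof. by rewrite -colE; apply/matrixP => p q; rewrite !ord1 !mxE eqxx. Qed.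

Lemma adjmx_sub1 (c : R) W : adjmx W = W -> adjmx (1%:M - c%:C *: W) = 1%:M - c%:C *: W.
Proof.
move=> WW; apply/matrixP => i k; have := congr1 (fun A : 'M[R[i]]_m => A i k) WW.
rewrite !mxE => Wik; rewrite rmorphB rmorphM /= conj_real Wik.
by congr (_ - _); rewrite conjC_nat eq_sym.
Qed.

(* The Householder reflection exchanging the basis vector j with a. *)
Lemma reflection (j : 'I_m) (a : 'cV[R[i]]_m) (r : R) :
  sqnorm a = 1 -> a j 0 = r%:C ->
  exists W : 'M[R[i]]_m, [/\ forall x, hnorm (W *m x) = hnorm x, rnorm (\det W) = 1,
    W *m delta_mx j 0 = a &
    forall i, i != j -> a i 0 = 0 -> W *m delta_mx i 0 = delta_mx i 0 :> 'cV[R[i]]_m].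
Proof.
move=> na ar; pose w := delta_mx j 0 - a.
have [w0|w0] := eqVneq w 0.
  exists 1%:M; split=> [x||| i _ _]; rewrite ?mul1mx//.
    by rewrite det1 rnormC.
  by apply/eqP; rewrite -subr_eq0 -/w w0.
pose s : R := sqnorm w.
have s0 : s != 0.
  apply: contra_neq w0 => s0; apply: hnorm_eq0; rewrite /hnorm -/s s0.
  exact: sqrtr0.
(* As the coordinate of [a] at [j] is the real number [r], the inner product of [w] with the basis
   vector is [1 - r = s / 2]; the reflection along [w] then subtracts exactly [w] from that
   vector. *)
have sE : s = 2 * (1 - r).
  have wE i : rnorm (w i 0) ^+ 2 = rnorm (a i 0) ^+ 2 + (i == j)%:R * (1 - 2 * r).
    rewrite !mxE eqxx andbT; have [->|ij] := eqVneq i j; last by rewrite sub0r rnormN mul0r addr0.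
    rewrite ar mul1r.
    have -> : 1 - r%:C = (1 - r)%:C :> R[i] by rewrite rmorphB.
    rewrite !rnorm_real !real_normK ?num_real//; ring.
  rewrite /s /sqnorm (eq_bigr _ (fun i _ => wE i)) big_split /= -/(sqnorm a) na.
  rewrite (bigD1 j)//= eqxx mul1r big1 ?addr0; last by move=> i /negbTE->; rewrite mul0r.
  by ring.
have ww : adjmx w *m w = s%:C%:M by rewrite [LHS]mx11_scalar -sqnormE.
pose c : R := 2 / s.
pose P := w *m adjmx w; pose W := 1%:M - c%:C *: P.
have PP : P *m P = s%:C *: P.
  by rewrite /P mulmxA -[w *m _ *m w]mulmxA ww mul_mx_scalar -scalemxAl.
have adjW : adjmx W = W by apply: adjmx_sub1; rewrite /P adjmxM adjmxK.
have WW : W *m W = 1%:M.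
  rewrite /W mulmxBl mul1mx mulmxBr mulmx1 -scalemxAl -scalemxAr PP !scalerA.
  have -> : c%:C * c%:C * s%:C = c%:C + c%:C :> R[i].
    by rewrite -!rmorphM -rmorphD; congr (_%:C); rewrite /c; field.
  by rewrite scalerDl opprB addrK subrK.
have wj : adjmx w *m delta_mx j 0 = (s / 2)%:C%:M.
  rewrite adjmx_delta; congr (_%:M); rewrite !mxE !eqxx ar.
  have -> : 1 - r%:C = (1 - r)%:C :> R[i] by rewrite rmorphB.
  by rewrite conj_real; congr (_%:C); rewrite sE; field.
exists W; split=> [x|||i ij ai].
- by apply: hnorm_isometry; rewrite adjW.
- have : rnorm (\det W) ^+ 2 = 1.
    by rewrite expr2 -rnormM -det_mulmx WW det1 rnormC.
  move=> /eqP; rewrite sqrf_eq1 => /orP[/eqP//|/eqP d].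
  by have := rnorm_ge0 (\det W); rewrite d oppr_ge0 ler10.
- rewrite mulmxBl mul1mx -scalemxAl -mulmxA wj mul_mx_scalar scalerA -rmorphM /=.
  by rewrite /c mulrA divfK// divff ?pnatr_eq0// scale1r /w opprB addrCA subrr addr0.
- rewrite mulmxBl mul1mx -scalemxAl -mulmxA.
  have -> : adjmx w *m delta_mx i 0 = 0 :> 'M[R[i]]_1.
    by rewrite adjmx_delta !mxE (negbTE ij) ai subr0 conjC0 raddf0.
  by rewrite mulmx0 scaler0 subr0.
Qed.

End HilbertNorm.

(** * Long orthonormal vectors from determinants *)

Section MaximalDeterminant.
Variables (R : realType) (X : normedModType R[i]) (k : nat).
Let m := (k + k)%N.
Variables (f : nat -> bdual R X) (b : nat -> X).
Hypothesis bfb : biorth m f b.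
Implicit Types (M N W : 'M[R[i]]_m) (a : 'cV[R[i]]_m).

(** The operator with matrix [M] from a Euclidean space into the span of [b]. Maximizing the
    determinant over contractions amounts to seeking an ellipsoid of largest volume in the unit ball
    of that span. *)
Definition emb M a : X := \sum_(i < m) (M *m a) i 0 *: b i.

Lemma emb_mulmx M W a : emb (M *m W) a = emb M (W *m a).
Proof. by rewrite /emb mulmxA. Qed.

Lemma emb_linear M : linear (emb M).
Proof.
move=> c x y; rewrite /emb scaler_sumr -big_split; apply: eq_bigr => i _ /=.
by rewrite mulmxDr -scalemxAr !mxE scalerDl scalerA.
Qed.

Lemma embZl c M a : emb (c *: M) a = c *: emb M a.
Proof.
by rewrite /emb scaler_sumr; apply: eq_bigr => i _; rewrite -scalemxAl mxE scalerA.
Qed.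

Lemma embDl M N a : emb (M + N) a = emb M a + emb N a.
Proof.
by rewrite /emb -big_split; apply: eq_bigr => i _ /=; rewrite mulmxDl mxE scalerDl.
Qed.

Lemma embZr c M a : emb M (c *: a) = c *: emb M a.
Proof.
by rewrite /emb scaler_sumr; apply: eq_bigr => i _; rewrite -scalemxAr mxE scalerA.
Qed.

Definition contraction M : Prop := forall a, rnorm (emb M a) <= hnorm a.

Lemma sqnorm_delta (j : 'I_m) : sqnorm (delta_mx j 0 : 'cV[R[i]]_m) = 1.
Proof.
rewrite /sqnorm (bigD1 j)//= big1 ?addr0; last first.
  by move=> i /negbTE ij; rewrite !mxE ij rnorm0 expr0n.
by rewrite !mxE !eqxx rnormC// expr1n.
Qed.

Lemma hnorm_delta (j : 'I_m) : hnorm (delta_mx j 0 : 'cV[R[i]]_m) = 1.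
Proof. by rewrite /hnorm sqnorm_delta sqrtr1. Qed.

Lemma contraction_entry M i j : contraction M -> rnorm (M i j) <= rnorm (f i).
Proof.
move=> cM.
have -> : M i j = f i (emb M (delta_mx j 0)).
  rewrite /emb linear_sum (bigD1 i)//= linearZ /= bfb// eqxx [_ *: _]mulr1.
  rewrite big1 ?addr0 -?colE ?mxE// => l li; rewrite linearZ /= bfb//.
  by rewrite eq_sym -[_ == _ :> nat]/(l == i) (negbTE li) [_ *: _]mulr0.
apply: le_trans (op_normP (f i) _) _; rewrite -[leRHS]mulr1.
apply: ler_wpM2l; first exact: op_norm_ge0.
by rewrite (le_trans (cM _))// hnorm_delta.
Qed.

(** The biorthogonal functionals [f i] bound the entries of a contraction, and the Leibniz formula
    then bounds its determinant. *)
Lemma contraction_det_bounded : exists B : R, forall M, contraction M -> rnorm (\det M) <= B.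
Proof.
exists (\sum_(s : 'S_m) \prod_(i < m) rnorm (f i)) => M cM.
rewrite (le_trans (rnorm_sum _ _))// ler_sum// => s _.
rewrite rnormM; have -> : rnorm ((-1) ^+ s : R[i]) = 1.
  by apply: complexI; rewrite rnormE normrX normrN normr1 expr1n.
rewrite mul1r; have -> : rnorm (\prod_i M i (s i)) = \prod_i rnorm (M i (s i)).
  apply: complexI; rewrite rnormE normr_prod rmorph_prod /=.
  by apply: eq_bigr => i _; rewrite rnormE.
by apply: ler_prod => i _; rewrite rnorm_ge0 contraction_entry.
Qed.

Lemma contraction_scalar : exists2 M, contraction M & \det M != 0.
Proof.
pose B := \sum_(i < m) rnorm (b i); have B0 : 0 <= B by apply: sumr_ge0 => i _; exact: rnorm_ge0.
have B1 : 0 < B + 1 by rewrite ltr_wpDl.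
exists ((B + 1)^-1%:C%:M) => [a|]; last first.
  rewrite det_scalar expf_neq0//; apply/eqP => /(@complexI R _ 0)/eqP.
  by rewrite invr_eq0 gt_eqF.
rewrite -scalemx1 embZl rnormZ rnormC ?invr_ge0 ?(ltW B1)//.
rewrite ler_pdivrMl// /emb mul1mx (le_trans (rnorm_sum _ _))//.
apply: (@le_trans _ _ (B * hnorm a)); last by rewrite ler_wpM2r ?hnorm_ge0// lerDl.
rewrite mulr_suml ler_sum// => i _; rewrite rnormZ mulrC ler_wpM2l ?rnorm_ge0//.
exact: rnorm_coord.
Qed.

(** A determinant close to the supremum takes the place of a maximal one. The tolerance 25/32 is the
    inverse of the factor 32/25 that is gained at least in [long_vector]. *)
Lemma near_maximal_contraction : exists2 D : R, 0 < D &
  (forall M, contraction M -> rnorm (\det M) <= D) /\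
  exists2 M, contraction M & 25 / 32 * D < rnorm (\det M).
Proof.
have [B HB] := contraction_det_bounded; have [M0 cM0 dM0] := contraction_scalar.
pose E : set R := [set rnorm (\det M) | M in [set M | contraction M]].
have hE : has_sup E.
  split; first by exists (rnorm (\det M0)), M0.
  by exists B => _ [M cM <-]; exact: HB.
have leE M : contraction M -> rnorm (\det M) <= sup E.
  by move=> cM; apply: ub_le_sup; [case: hE | exists M].
have E0 : 0 < sup E.
  apply: lt_le_trans (leE _ cM0); rewrite lt_neqAle rnorm_ge0 andbT eq_sym.
  by apply: contra_neq dM0 => /rnorm0_eq0.
exists (sup E) => //; split=> //.
have [|_ [M cM <-] lM] := sup_adherent (_ : 0 < 7 / 32 * sup E) hE; last first.
  by exists M => //; apply: le_lt_trans lM; lra.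
by rewrite mulr_gt0.
Qed.

Lemma prod_threshold n j : 2 ^+ (n - j) <= \prod_(i < n) (1 + (j <= i)%:R) :> R.
Proof.
elim: n => [|n IH]; first by rewrite big_ord0 sub0n expr0.
rewrite big_ord_recr /=; have [jn|nj] := leqP j n.
  by rewrite subSn// exprSr ler_pM// exprn_ge0.
rewrite (eqP (nj : n.+1 - j == 0)%N) expr0 addr0 mulr1.
by rewrite -[leLHS](expr0 2) (le_trans _ IH)// exprn_ege1// ler1n.
Qed.

(* If u = emb M shrank all vectors supported beyond j by 1/4, stretching these directions
   by 2 and renormalizing would multiply the determinant by at least (32/25)^k. *)
Lemma long_vector D M j : (0 < k)%N -> (j <= k)%N -> 0 < D ->
  (forall M, contraction M -> rnorm (\det M) <= D) -> contraction M ->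
  25 / 32 * D < rnorm (\det M) ->
  exists a, [/\ forall i : 'I_m, (i < j)%N -> a i 0 = 0, hnorm a = 1 & 4^-1 < rnorm (emb M a)].
Proof.
move=> k0 jk D0 leD cM MD; apply: contrapT => nex.
have short a : (forall i : 'I_m, (i < j)%N -> a i 0 = 0) -> rnorm (emb M a) <= 4^-1 * hnorm a.
  move=> aj; have [a0|a0] := eqVneq (hnorm a) 0.
    by rewrite (le_trans (cM a))// a0 mulr0.
  have ha : 0 < hnorm a by rewrite lt_neqAle eq_sym a0 hnorm_ge0.
  rewrite leNgt; apply/negP => lt4; apply: nex; exists ((hnorm a)^-1%:C *: a); split.
  - by move=> i ij; rewrite mxE aj// mulr0.
  - by rewrite hnormZ rnormC ?invr_ge0 ?hnorm_ge0// mulVf.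
  - by rewrite embZr rnormZ rnormC ?invr_ge0 ?hnorm_ge0// mulrC ltr_pdivlMr.
pose V : 'M[R[i]]_m := diag_mx (\row_i (j <= i)%:R).
have V1 : 1%:M + V = diag_mx (\row_i (1 + (j <= i)%:R)).
  by apply/matrixP => p q; rewrite !mxE -mulrnDl.
have VE a i : (V *m a) i 0 = (j <= i)%:R * a i 0.
  by rewrite mul_diag_mx !mxE.
(* Images under [M] of vectors beyond [j] shrink by 1/4, so adding the second copy [V] costs at most
   a factor 5/4, which 4/5 compensates. In the determinant the scaling costs [(16 / 25) ^+ k], as
   [m] is twice [k], while at least [k] coordinates are doubled. *)
pose N := (4 / 5)%:C *: (M *m (1%:M + V)).
have cN : contraction N.
  move=> a; rewrite embZl rnormZ rnormC// mulmxDr mulmx1 embDl emb_mulmx.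
  have h1 := cM a; have h2 : rnorm (emb M (V *m a)) <= 4^-1 * hnorm a.
    rewrite (le_trans (short _ _))//.
      by move=> i ij; rewrite VE leqNgt ij mul0r.
    rewrite ler_wpM2l ?invr_ge0// ler_sqrt ?sqnorm_ge0// ler_sum// => i _.
    by rewrite VE; case: (j <= i)%N; rewrite ?mul1r// mul0r rnorm0 expr0n sqr_ge0.
  have h3 := rnormD (emb M a) (emb M (V *m a)).
  by rewrite -ler_pdivlMl ?divr_gt0// (le_trans h3)//; lra.
have := leD N cN; rewrite leNgt => /negP; apply.
rewrite /N detZ det_mulmx V1 det_diag !rnormM.
have -> : rnorm ((4 / 5)%:C ^+ m : R[i]) = (16 / 25) ^+ k.
  rewrite -rmorphXn rnormC ?exprn_ge0// /m addnn -mul2n exprM; congr (_ ^+ _).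
  by field.
have -> : rnorm (\prod_(i < m) (\row_i (1 + (j <= i)%:R) : 'rV[R[i]]_m) 0 i) =
    \prod_(i < m) (1 + (j <= i)%:R).
  apply: complexI; rewrite rnormE normr_prod rmorph_prod /=; apply: eq_bigr => i _.
  by rewrite mxE rmorphD rmorph1 rmorph_nat /= ger0_norm// addr_ge0.
set P := \prod_(i < m) _; have P2 : 2 ^+ k <= P.
  apply: le_trans (prod_threshold m j); rewrite ler_weXn2l ?ler1n//.
  by rewrite /m -addnBA// leq_addr.
have k32 : 32 / 25 <= (32 / 25) ^+ k :> R.
  by rewrite -[leLHS]expr1 ler_weXn2l//; lra.
have P16 : (32 / 25) ^+ k <= (16 / 25) ^+ k * P.
  have -> : (32 / 25) ^+ k = (16 / 25) ^+ k * 2 ^+ k :> R by rewrite -exprMn; congr (_ ^+ _); field.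
  by rewrite ler_wpM2l// exprn_ge0.
rewrite mulrCA mulrA [in ltRHS]mulrC mulrA.
apply: (@lt_le_trans _ _ (rnorm (\det M) * (32 / 25))); first by lra.
by rewrite [P * _]mulrC -mulrA ler_wpM2l ?rnorm_ge0// [P * _]mulrC (le_trans k32).
Qed.

(** A lemma of Dvoretzky-Rogers type. A reflection of the domain fixes the basis vectors already
    known to be long and sends the next one to a multiple of a vector from [long_vector];
    contractivity and the modulus of the determinant survive, so the step can be repeated. *)
Lemma orthonormal_long j : (0 < k)%N -> (j <= k)%N ->
  exists2 D : R, 0 < D & (forall M, contraction M -> rnorm (\det M) <= D) /\
  exists M, [/\ contraction M, 25 / 32 * D < rnorm (\det M) &
    forall i : 'I_m, (i < j)%N -> 4^-1 < rnorm (emb M (delta_mx i 0))].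
Proof.
move=> k0; elim: j => [_|j IH jk].
  by have [D D0 [leD [M cM MD]]] := near_maximal_contraction; exists D => //; split=> //; exists M.
have [D D0 [leD [M [cM MD long]]]] := IH (ltnW jk); exists D => //; split=> //.
have [a [aj na la]] := long_vector k0 (ltnW jk) D0 leD cM MD.
have jm : (j < m)%N by rewrite /m (leq_trans jk)// leq_addr.
pose o := Ordinal jm.
(* A unimodular factor makes the coordinate at [o] real, as [reflection] requires. *)
have [p p1 [r par]] : exists2 p : R[i], rnorm p = 1 & exists r : R, p * a o 0 = r%:C.
  have [a0|a0] := eqVneq (a o 0) 0.
    by exists 1; [rewrite rnormC | exists 0; rewrite a0 mulr0].
  exists ((rnorm (a o 0))%:C / a o 0); last by exists (rnorm (a o 0)); rewrite divfK.
  apply: (mulIf (_ : rnorm (a o 0) != 0)).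
    by apply: contra_neq a0 => /rnorm0_eq0.
  by rewrite -rnormM divfK// rnormC ?rnorm_ge0// mul1r.
have npa : sqnorm (p *: a) = 1.
  by rewrite sqnormZ p1 expr1n mul1r -sqr_hnorm na expr1n.
have [|W [isoW detW Wj Wi]] := @reflection R m o (p *: a) r npa; first by rewrite mxE.
exists (M *m W); split=> [x||i].
- by rewrite emb_mulmx (le_trans (cM _))// isoW.
- by rewrite det_mulmx rnormM detW mulr1.
- rewrite emb_mulmx ltnS leq_eqVlt => /predU1P[ij|ij].
    have -> : i = o by exact: val_inj.
    by rewrite Wj embZr rnormZ p1 mul1r.
  rewrite Wi ?long//; last by rewrite mxE aj// mulr0.
  by rewrite -val_eqE /= ltn_eqF.
Qed.

End MaximalDeterminant.

Section TraceUnbounded.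
Variables (R : realType) (X : normedModType R[i]).

(** With [phi i] norming [x i], the sum of the rank one operators [rnorm (x i)] times [phi i] tensor
    [x i] has trace [q] and norm at most the square root of [q]. In effect, a bounded trace makes
    the identity 2-summing. *)
Lemma trace_two_summing (C : R) n (x : 'I_n -> X) :
  (forall T : bop X X, finite_rank T -> rnorm (tr T) <= C * rnorm T) ->
  (forall a : 'cV[R[i]]_n, rnorm (\sum_(i < n) a i 0 *: x i) <= hnorm a) ->
  \sum_(i < n) rnorm (x i) ^+ 2 <= C ^+ 2.
Proof.
move=> trC xw; set q := \sum_(i < n) _.
have q0 : 0 <= q by apply: sumr_ge0 => i _; exact: sqr_ge0.
have /choice[phi phiP] (i : 'I_n) : exists g : bdual R X,
    (forall z, rnorm (g z) <= rnorm z) /\ g (x i) = (rnorm (x i))%:C.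
  by have [g g1 gx] := norming_functional (x i); exists g.
pose s := [seq ((rnorm (x i))%:C *: phi i, x i) | i : 'I_n <- enum 'I_n].
pose T := \sum_(u <- s) rank1 u.2 u.1.
have fT : finite_rank T by apply: finite_rank_sum => u; exact: finite_rank_rank1.
have trT : tr T = q%:C.
  rewrite tr_sum big_map big_enum rmorph_sum; apply: eq_bigr => i _ /=.
  rewrite -[LHS]/((rnorm (x i))%:C * phi i (x i)) (phiP i).2 -rmorphM.
  by rewrite expr2.
have nT : rnorm T <= Num.sqrt q.
  rewrite rnorm_bop; apply: op_norm_le; first exact: sqrtr_ge0.
  move=> z; rewrite bop_sumE big_map big_enum /=.
  pose a : 'cV[R[i]]_n := \col_i ((rnorm (x i))%:C * phi i z).
  have -> : \sum_i ((rnorm (x i))%:C *: phi i) z *: x i = \sum_i a i 0 *: x i.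
    by apply: eq_bigr => i _; rewrite mxE.
  rewrite (le_trans (xw a))// -[rnorm z]ger0_norm ?rnorm_ge0// -sqrtr_sqr -sqrtrM//.
  suff qz : sqnorm a <= q * rnorm z ^+ 2 by rewrite /hnorm ler_sqrt// mulr_ge0 ?sqr_ge0.
  rewrite mulr_suml; apply: ler_sum => i _.
  rewrite mxE rnormM exprMn rnormC ?rnorm_ge0// ler_wpM2l ?sqr_ge0//.
  by rewrite ler_pXn2r ?nnegrE ?rnorm_ge0// (phiP i).1.
have := trC T fT; rewrite trT rnormC// => qC.
have [->|qn0] := eqVneq q 0; first exact: sqr_ge0.
have sq0 : 0 < Num.sqrt q by rewrite sqrtr_gt0 lt_neqAle eq_sym qn0.
have C0 : 0 <= C.
  rewrite leNgt; apply/negP => C0.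
  have : q <= 0 by rewrite (le_trans qC)// mulr_le0_ge0 ?rnorm_ge0// ltW.
  by rewrite leNgt lt_neqAle eq_sym qn0 q0.
have sC : Num.sqrt q <= C.
  have := le_trans qC (ler_wpM2l C0 nT).
  by rewrite -{1}(sqr_sqrtr q0) expr2 ler_pM2r.
by rewrite -(sqr_sqrtr q0) ler_pXn2r ?nnegrE// sqrtr_ge0.
Qed.

(** Each of the [k] vectors from [orthonormal_long] contributes at least 1/16 to a sum that
    [trace_two_summing] bounds by [C ^+ 2]; hence the choice of [k] above [16 * C ^+ 2]. *)
Theorem trace_unbounded : ~ finite_dimensional X ->
  ~ exists C : R, forall T : bop X X, finite_rank T -> rnorm (tr T) <= C * rnorm T.
Proof.
move=> infX [C trC]; pose k := (Num.trunc (16 * C ^+ 2)).+1.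
have [f [b bfb]] := infinite_biorth (k + k) infX.
have [D _ [_ [M [cM _ long]]]] := orthonormal_long bfb (ltn0Sn _ : 0 < k)%N (leqnn k).
have sumE (a : 'cV[R[i]]_(k + k)) : \sum_(i < k + k) a i 0 *: emb b M (delta_mx i 0) = emb b M a.
  pose eL : {linear 'cV[R[i]]_(k + k) -> X} :=
    HB.pack (emb b M) (GRing.isLinear.Build R[i] _ X *:%R (emb b M) (emb_linear b M)).
  rewrite -[RHS]/(eL a) [in RHS](matrix_sum_delta a) linear_sum; apply: eq_bigr => i _.
  by rewrite big_ord1 linearZ.
have sC := trace_two_summing trC (fun a => eq_ind_r (fun v => rnorm v <= _) (cM a) (sumE a)).
have : k%:R / 16 <= C ^+ 2.
  apply: le_trans sC; rewrite big_split_ord /= -[leLHS]addr0 lerD//; last first.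
    by apply: sumr_ge0 => i _; exact: sqr_ge0.
  apply: (@le_trans _ _ (\sum_(i < k) 16^-1)).
    by rewrite sumr_const card_ord -[leRHS]mulr_natl.
  apply: ler_sum => i _; have := long (lshift k i) (ltn_ord i).
  set t := rnorm _ => t4; nra.
rewrite ler_pdivrMr// mulrC leNgt => /negP; apply.
exact: truncnS_gt.
Qed.

End TraceUnbounded.

(** * Direct sums *)

Section DirectSum.
Variables (R : realType) (X Y : normedModType R[i]).

Lemma rnorm_fst (p : X * Y) : rnorm p.1 <= rnorm p.
Proof.
by rewrite -lecR !rnormE prod_normE comparable_le_max ?lexx//;
  apply: real_comparable; exact: normr_real.
Qed.

Lemma rnorm_snd (p : X * Y) : rnorm p.2 <= rnorm p.
Proof.
by rewrite -lecR !rnormE prod_normE comparable_le_max ?lexx ?orbT//;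
  apply: real_comparable; exact: normr_real.
Qed.

Lemma rnorm_pair1 (x : X) : rnorm ((x, 0) : X * Y) <= rnorm x.
Proof.
rewrite -lecR !rnormE prod_normE comparable_ge_max /= ?lexx ?normr0 ?normr_ge0//.
by apply: real_comparable; rewrite ?real0 ?normr_real.
Qed.

Lemma rnorm_pair2 (y : Y) : rnorm ((0, y) : X * Y) <= rnorm y.
Proof.
rewrite -lecR !rnormE prod_normE comparable_ge_max /= ?lexx ?normr0 ?normr_ge0//.
Qed.

Lemma prj1_subproof : (fst : X * Y -> X) \in @bounded_linear R (X * Y)%type X.
Proof.
by apply/bounded_linearP; split=> //; exists 1 => p; rewrite mul1r rnorm_fst.
Qed.

Lemma prj2_subproof : (snd : X * Y -> Y) \in @bounded_linear R (X * Y)%type Y.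
Proof.
by apply/bounded_linearP; split=> //; exists 1 => p; rewrite mul1r rnorm_snd.
Qed.

Lemma inc1_subproof : (fun x : X => (x, 0 : Y)) \in @bounded_linear R X (X * Y)%type.
Proof.
apply/bounded_linearP; split=> [a x x'|]; last by exists 1 => x; rewrite mul1r rnorm_pair1.
by rewrite -[RHS]/(a *: x + x', a *: 0 + 0) scaler0 addr0.
Qed.

Lemma inc2_subproof : (fun y : Y => (0 : X, y)) \in @bounded_linear R Y (X * Y)%type.
Proof.
apply/bounded_linearP; split=> [a y y'|]; last by exists 1 => y; rewrite mul1r rnorm_pair2.
by rewrite -[RHS]/(a *: 0 + 0, a *: y + y') scaler0 addr0.
Qed.

Definition prj1 : bop (X * Y)%type X := Bop prj1_subproof.
Definition prj2 : bop (X * Y)%type Y := Bop prj2_subproof.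
Definition inc1 : bop X (X * Y)%type := Bop inc1_subproof.
Definition inc2 : bop Y (X * Y)%type := Bop inc2_subproof.

Lemma rnorm_le1 (V W : normedModType R[i]) (f : bop V W) :
  (forall x, rnorm (f x) <= rnorm x) -> rnorm f <= 1.
Proof. by move=> f1; rewrite rnorm_bop; apply: op_norm_le => // x; rewrite mul1r. Qed.

Lemma prj1_norm : rnorm prj1 <= 1. Proof. by apply: rnorm_le1 => p; exact: rnorm_fst. Qed.
Lemma prj2_norm : rnorm prj2 <= 1. Proof. by apply: rnorm_le1 => p; exact: rnorm_snd. Qed.
Lemma inc1_norm : rnorm inc1 <= 1. Proof. by apply: rnorm_le1 => p; exact: rnorm_pair1. Qed.
Lemma inc2_norm : rnorm inc2 <= 1. Proof. by apply: rnorm_le1 => p; exact: rnorm_pair2. Qed.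

End DirectSum.

Section Sandwich.
Variable R : realType.
Implicit Types V W : normedModType R[i].

(** One operation for three purposes: compressing an operator on the sum to a corner, extending a
    corner by zero, and cutting out the blocks given by two projections [p] and [q]. *)
Definition sandwich V V' W W' (A : bop W W') (B : bop V V') (T : bop V' W) : bop V W' :=
  bcomp A (bcomp T B).

Lemma sandwich_linear V V' W W' (A : bop W W') (B : bop V V') a (S T : bop V' W) :
  sandwich A B (a *: S + T) = a *: sandwich A B S + sandwich A B T.
Proof. by rewrite /sandwich bcompDl bcompZl bcompDr bcompZr. Qed.

Lemma sandwichB V V' W W' (A : bop W W') (B : bop V V') (S T : bop V' W) :
  sandwich A B (S - T) = sandwich A B S - sandwich A B T.
Proof. by rewrite addrC -scaleN1r sandwich_linear scaleN1r addrC. Qed.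

Lemma finite_rank_sandwich V V' W W' (A : bop W W') (B : bop V V') (T : bop V' W) :
  finite_rank T -> finite_rank (sandwich A B T).
Proof. by move=> fT; apply: finite_rank_compr; exact: finite_rank_compl. Qed.

Lemma rnorm_sandwich V V' W W' (A : bop W W') (B : bop V V') (T : bop V' W) :
  rnorm A <= 1 -> rnorm B <= 1 -> rnorm (sandwich A B T) <= rnorm T.
Proof.
move=> A1 B1; rewrite (le_trans (bcomp_norm _ _))//.
rewrite (le_trans (ler_wpM2r (rnorm_ge0 _) A1))// mul1r (le_trans (bcomp_norm _ _))//.
by rewrite (le_trans (ler_wpM2l (rnorm_ge0 _) B1))// mulr1.
Qed.

Lemma tr_sandwich V W (A : bop V W) (B : bop W V) (T : bop V V) : finite_rank T ->
  tr (sandwich A B T) = tr (bcomp (bcomp B A) T).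
Proof.
move=> fT; have fAT : finite_rank (bcomp A T) by exact: finite_rank_compr.
by rewrite /sandwich bcompA tr_comm// bcompA.
Qed.

Lemma tr0 V : tr (0 : bop V V) = 0.
Proof. by have := @tr_sum R V [::]; rewrite !big_nil. Qed.

Lemma trace_multiple_unbounded V (c : R[i]) (K : R) : ~ finite_dimensional V ->
  (forall T : bop V V, finite_rank T -> rnorm (c * tr T) <= K * rnorm T) -> c = 0.
Proof.
move=> infV cK; apply: contrapT => /eqP c0; apply: (trace_unbounded infV).
have nc : 0 < rnorm c.
  by rewrite lt_neqAle rnorm_ge0 andbT eq_sym; apply: contra_neq c0 => /rnorm0_eq0.
exists (K / rnorm c) => T fT; rewrite mulrAC ler_pdivlMr// mulrC -rnormM.
exact: cK.
Qed.

End Sandwich.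

Section OffDiagonal.
Variables (R : realType) (Z : normedModType R[i]) (p q : bop Z Z).
Hypotheses (pp : forall x, p (p x) = p x) (qq : forall x, q (q x) = q x).
Hypothesis qp : forall x, q (p x) = 0.
Hypotheses (pq1 : forall x, p x + q x = x) (p1 : rnorm p <= 1) (q1 : rnorm q <= 1).

Lemma block_decomposition (U : bop Z Z) :
  U = sandwich p p U + sandwich q q U + (sandwich p q U + sandwich q p U).
Proof.
apply: bopP => z; rewrite !bopD /=.
have Uz : U z = U (p z) + U (q z) by rewrite -linearD pq1.
rewrite -[LHS]pq1 Uz !linearD -!addrA; congr (_ + _).
by rewrite [q (U (p z)) + _]addrC addrCA.
Qed.

Variables (f : bop Z Z -> R[i]^o) (C : R).
Hypotheses (lf : fr_linear f) (C0 : 0 <= C).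
Hypothesis fC : forall S T, finite_rank S -> finite_rank T ->
  rnorm (f (bcomp S T - bcomp T S)) <= C * rnorm S * rnorm T.

(** The block [p S T q] is the sum of [(p S p) (p T q)] and [(p S q) (q T q)]. Since [q p = 0],
    either product vanishes in the reverse order, so each is a commutator. *)
Lemma rnorm_off_diagonal (S T : bop Z Z) : finite_rank S -> finite_rank T ->
  rnorm (f (sandwich p q (bcomp S T))) <= (C + C) * rnorm S * rnorm T.
Proof.
move=> fS fT.
have one (A B : bop Z Z) : finite_rank A -> finite_rank B -> rnorm A <= rnorm S -> rnorm B <= rnorm T ->
    bcomp B A = 0 -> rnorm (f (bcomp A B)) <= C * rnorm S * rnorm T.
  move=> fA fB AS BT BA; have := fC fA fB; rewrite BA subr0 => /le_trans; apply.
  by rewrite ler_pM ?mulr_ge0 ?rnorm_ge0// ler_wpM2l.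
pose A1 := sandwich p p S; pose B1 := sandwich p q T.
pose A2 := sandwich p q S; pose B2 := sandwich q q T.
have -> : sandwich p q (bcomp S T) = bcomp A1 B1 + bcomp A2 B2.
  apply: bopP => x; rewrite bopD /= !pp !qq -!linearD pq1.
  by [].
have [fA1 fA2] : finite_rank A1 /\ finite_rank A2 by split; exact: finite_rank_sandwich.
have [fB1 fB2] : finite_rank B1 /\ finite_rank B2 by split; exact: finite_rank_sandwich.
rewrite fr_linearD//; try exact: finite_rank_compl.
rewrite (le_trans (rnormD _ _))// !mulrDl lerD//; apply: one => //; try exact: rnorm_sandwich.
  by apply: bopP => x /=; rewrite qp !linear0.
by apply: bopP => x /=; rewrite qp !linear0.
Qed.

End OffDiagonal.

Section SupremumOfTraces.
Variables (R : realType) (X Y : normedModType R[i]).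

(** Scaling [P] and [Q] to norm 1 turns a finite supremum into a bilinear bound, the form in which
    it enters the estimates. *)
Lemma trace_sup_infinite :
  (ereal_sup [set (rnorm (tr (bcomp P Q)))%:E |
     P in finite_rank_ball Y X & Q in finite_rank_ball X Y] = +oo%E) <->
  ~ exists K : R, forall (P : bop Y X) (Q : bop X Y), finite_rank P -> finite_rank Q ->
      rnorm (tr (bcomp P Q)) <= K * rnorm P * rnorm Q.
Proof.
set E := [set _ | P in _ & Q in _]; split=> [supE [K trK]|nK].
  have : (ereal_sup E <= `|K|%:E)%E.
    apply: ge_ereal_sup => _ [P [fP P1]] [Q [fQ Q1] <-].
    rewrite lee_fin (le_trans (trK _ _ fP fQ))// (le_trans (ler_norm _))// !normrM.
    rewrite ![`|rnorm _|]ger0_norm ?rnorm_ge0// -mulrA ler_piMr//.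
    by rewrite mulr_ile1 ?rnorm_ge0.
  by rewrite supE.
apply: contrapT => supE; apply: nK.
have Ele e : E e -> (e <= ereal_sup E)%E by exact: ereal_sup_ubound.
(* A member of [E] rules out the value [-oo] of the supremum. *)
have E0 : E 0%E.
  exists 0; first by split; [exact: finite_rank0 | rewrite rnorm0].
  exists 0; first by split; [exact: finite_rank0 | rewrite rnorm0].
  by rewrite bcomp0l tr0 rnorm0.
case: (ereal_sup E) supE Ele => [K _ Ele|//|_ /(_ _ E0)//].
exists K => P Q fP fQ.
have [->|P0] := eqVneq P 0; first by rewrite bcomp0l tr0 !rnorm0 mulr0 mul0r.
have [->|Q0] := eqVneq Q 0; first by rewrite bcomp0r tr0 !rnorm0 mulr0.
have nz (V W : normedModType R[i]) (T : bop V W) : T != 0 -> 0 < rnorm T.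
  by move=> T0; rewrite lt_neqAle rnorm_ge0 andbT eq_sym; apply: contra_neq T0 => /rnorm0_eq0.
have [nP nQ] := (nz _ _ _ P0, nz _ _ _ Q0).
have n1 (V W : normedModType R[i]) (T : bop V W) : T != 0 -> rnorm ((rnorm T)^-1%:C *: T) <= 1.
  by move=> /nz nT; rewrite rnormZ rnormC ?invr_ge0 ?rnorm_ge0// mulVf ?gt_eqF.
have /Ele : E (rnorm (tr (bcomp ((rnorm P)^-1%:C *: P) ((rnorm Q)^-1%:C *: Q))))%:E.
  exists ((rnorm P)^-1%:C *: P); first by split; [exact: finite_rankZ | exact: n1].
  by exists ((rnorm Q)^-1%:C *: Q) => //; split; [exact: finite_rankZ | exact: n1].
rewrite lee_fin bcompZl bcompZr.
have trZ a (T : bop X X) : finite_rank T -> tr (a *: T) = a * tr T.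
  by move=> fT; rewrite -[a *: T]addr0 tr_linear ?tr0 ?addr0//; exact: finite_rank0.
have fPQ : finite_rank (bcomp P Q) by exact: finite_rank_compl.
rewrite !trZ//; last exact: finite_rankZ.
rewrite !rnormM !rnormC ?invr_ge0 ?rnorm_ge0// mulrA -invfM.
by rewrite ler_pdivrMl ?mulr_gt0// mulrC mulrA.
Qed.

End SupremumOfTraces.

(** * The two implications for the direct sum *)

Section Main.
Variables (R : realType) (X Y : completeNormedModType R[i]).
Hypotheses (infX : ~ finite_dimensional X) (infY : ~ finite_dimensional Y).
Let Z : completeNormedModType R[i] := (X * Y)%type.

Let i1 : bop X Z := inc1 X Y.
Let i2 : bop Y Z := inc2 X Y.
Let j1 : bop Z X := prj1 X Y.
Let j2 : bop Z Y := prj2 X Y.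

Let i1_norm : rnorm i1 <= 1. Proof. exact: inc1_norm. Qed.
Let i2_norm : rnorm i2 <= 1. Proof. exact: inc2_norm. Qed.
Let j1_norm : rnorm j1 <= 1. Proof. exact: prj1_norm. Qed.
Let j2_norm : rnorm j2 <= 1. Proof. exact: prj2_norm. Qed.
Let i1j1 (z : Z) : i1 (j1 z) + i2 (j2 z) = z.
Proof.
by case: z => x y; rewrite -[LHS]/(x + 0, 0 + y) addr0 add0r.
Qed.

Let nonzero (V : normedModType R[i]) : ~ finite_dimensional V -> exists v : V, v <> 0.
Proof.
move=> infV; apply: contrapT => /forallNP v0; apply: infV; exists 0%N, (fun=> 0) => v _.
by exists (fun=> 0); rewrite big_ord0; apply: contrapT; exact: v0.
Qed.

Let Z_nonzero : exists z : Z, z <> 0.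
Proof. by have [x x0] := nonzero infX; exists (i1 x) => -[]. Qed.

Let tr_block1 (T : bop X X) : finite_rank T -> tr (sandwich i1 j1 T) = tr T.
Proof. by move=> fT; rewrite tr_sandwich//; congr tr; exact: bopP. Qed.

Let tr_block2 (T : bop Y Y) : finite_rank T -> tr (sandwich i2 j2 T) = tr T.
Proof. by move=> fT; rewrite tr_sandwich//; congr tr; exact: bopP. Qed.

Let no_bound : Prop := ~ exists K : R, forall (P : bop Y X) (Q : bop X Y),
  finite_rank P -> finite_rank Q -> rnorm (tr (bcomp P Q)) <= K * rnorm P * rnorm Q.

Let no_bound_multiple (c : R[i]) (K : R) : no_bound ->
  (forall (P : bop Y X) (Q : bop X Y), finite_rank P -> finite_rank Q ->
    rnorm (c * tr (bcomp P Q)) <= K * rnorm P * rnorm Q) -> c = 0.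
Proof.
move=> nb cK; apply: contrapT => /eqP c0; apply: nb.
have nc : 0 < rnorm c.
  by rewrite lt_neqAle rnorm_ge0 andbT eq_sym; apply: contra_neq c0 => /rnorm0_eq0.
exists (K / rnorm c) => P Q fP fQ.
rewrite -(ler_pM2l nc) -rnormM (le_trans (cK P Q fP fQ))//.
by rewrite !mulrA [rnorm c * K]mulrC mulfK ?gt_eqF.
Qed.

(** The trace of the X-corner separates the two summands: after subtraction of [l] times the trace
    it is [1 - l] times the trace on operators of X and [- l] times the trace on operators of Y.
    Both would be bounded, whence [l = 1] and [l = 0]. *)
Lemma weakly_amenable_no_bound : weakly_amenable (aop Z) -> no_bound.
Proof.
move=> wa [K trK].
pose f (U : bop Z Z) : R[i]^o := tr (sandwich j1 i1 U).
have fr := @finite_rank_sandwich R.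
have lf : fr_linear f.
  by move=> a S T fS fT; rewrite /f sandwich_linear tr_linear//; exact: fr.
have fE (S T : bop Z Z) : finite_rank S -> finite_rank T -> f (bcomp S T) =
    tr (bcomp (sandwich j1 i1 S) (sandwich j1 i1 T)) +
    tr (bcomp (sandwich j1 i2 S) (sandwich j2 i1 T)).
  move=> fS fT; rewrite -[X in X + _]mul1r -tr_linear; try by apply: finite_rank_compl; exact: fr.
  rewrite scale1r; congr tr; apply: bopP => x; rewrite bopD /= -!linearD i1j1.
  by [].
have [|l [L L0 fL]] := weakly_amenable_functional Z_nonzero wa lf.
  exists (`|K| + `|K|) => [|S T fS fT]; first by rewrite addr_ge0.
  rewrite fr_linearB//; try exact: finite_rank_compl.
  (* In the commutator the traces of the products of X-corners cancel; what remains factors through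
     Y and is bounded by [trK]. *)
  rewrite !fE// (@tr_comm R _ _ (sandwich j1 i1 S)); last exact: fr.
  rewrite opprD addrACA subrr add0r (le_trans (rnormD _ _))// rnormN !mulrDl.
  have bnd (U V : bop Z Z) : finite_rank U -> finite_rank V ->
      rnorm (tr (bcomp (sandwich j1 i2 U) (sandwich j2 i1 V))) <= `|K| * rnorm U * rnorm V.
    move=> fU fV; rewrite (le_trans (trK _ _ _ _))//; try exact: fr.
    rewrite -!mulrA; apply: (le_trans (ler_wpM2r _ (ler_norm K))).
      by rewrite mulr_ge0 ?rnorm_ge0.
    by rewrite ler_wpM2l// ler_pM ?rnorm_ge0// rnorm_sandwich.
  by apply: lerD; [exact: bnd | rewrite mulrAC; exact: bnd].
have l1 : 1 - l = 0.
  apply: (trace_multiple_unbounded infX (K := L)) => T fT.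
  have fU : finite_rank (sandwich i1 j1 T) by exact: fr.
  have fT1 : f (sandwich i1 j1 T) = tr T by rewrite /f; congr tr; exact: bopP.
  have := fL _ fU; rewrite tr_block1// fT1 => h.
  by rewrite mulrBl mul1r (le_trans h)// ler_wpM2l// rnorm_sandwich.
have l0 : l = 0.
  apply: (trace_multiple_unbounded infY (K := L)) => T fT.
  have fU : finite_rank (sandwich i2 j2 T) by exact: fr.
  have := fL _ fU; rewrite tr_block2//.
  have -> : f (sandwich i2 j2 T) = 0.
    rewrite /f -[RHS](@tr0 R X); congr tr; apply: bopP => x.
    by rewrite -[LHS]/(0 : X).
  rewrite sub0r rnormN => /le_trans; apply.
  by rewrite ler_wpM2l// rnorm_sandwich.
by move/eqP: l1; rewrite l0 subr0 oner_eq0.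
Qed.

(** A functional bounded on products is bounded on commutators, so only its multiple [l] of the
    trace is in question. On [S T], the extension of [P Q] by zero, both [f] and [f - l tr] are at
    most a constant times [rnorm P * rnorm Q]; hence so is [l tr (P Q)]. *)
Lemma weakly_amenable_self_induced : weakly_amenable (aop Z) -> self_induced (aop Z).
Proof.
move=> wa; have nb := weakly_amenable_no_bound wa.
apply: self_induced_of_functional => f lf bf.
have [l [L L0 fL]] := weakly_amenable_functional Z_nonzero wa lf (prod_bounded_comm lf bf).
have [K K0 fK] := bf.
suff l0 : l = 0 by exists L => // T fT; have := fL T fT; rewrite l0 mul0r subr0.
apply: (@no_bound_multiple l (K + L) nb) => P Q fP fQ.
pose S := sandwich i1 j2 P; pose T := sandwich i2 j1 Q.
have fS : finite_rank S by exact: finite_rank_sandwich.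
have fT : finite_rank T by exact: finite_rank_sandwich.
have fPQ : finite_rank (bcomp P Q) by exact: finite_rank_compl.
have STE : bcomp S T = sandwich i1 j1 (bcomp P Q) by exact: bopP.
have nST : rnorm (bcomp S T) <= rnorm P * rnorm Q.
  by rewrite STE (le_trans (rnorm_sandwich _ _ _))// bcomp_norm.
have h1 : rnorm (f (bcomp S T)) <= K * (rnorm P * rnorm Q).
  rewrite (le_trans (fK _ _ fS fT))// -mulrA ler_wpM2l// ler_pM ?rnorm_ge0//;
    exact: rnorm_sandwich.
have := fL _ (finite_rank_compl _ fS : finite_rank (bcomp S T)).
rewrite {2}STE tr_block1// => h2.
rewrite -[l * _](subKr (f (bcomp S T))) (le_trans (rnormD _ _))// rnormN.
rewrite -[leRHS]mulrA mulrDl lerD// (le_trans h2)//.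
by rewrite ler_wpM2l.
Qed.

Lemma weakly_amenable_sum : weakly_amenable (aop X) -> weakly_amenable (aop Y) ->
  self_induced (aop Z) -> no_bound -> weakly_amenable (aop Z).
Proof.
move=> waX waY si nb; apply: (weakly_amenable_of_functional Z_nonzero) => f lf [C C0 fC].
have fr := @finite_rank_sandwich R.
have corner (V : completeNormedModType R[i]) (i : bop V Z) (j : bop Z V) :
    ~ finite_dimensional V -> (forall v, j (i v) = v) -> rnorm i <= 1 -> rnorm j <= 1 ->
    weakly_amenable (aop V) -> exists (l : R[i]) (K : R), 0 <= K /\
      forall T : bop V V, finite_rank T -> rnorm (f (sandwich i j T) - l * tr T) <= K * rnorm T.
  move=> infV ji i1' j1' wa.
  have [||l [K K0 fK]] := @weakly_amenable_functional R V (fun T => f (sandwich i j T)) (nonzero infV) wa.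
  - by move=> a S T fS fT; rewrite sandwich_linear lf//; exact: fr.
  (* As [j] is a left inverse of [i], extension by zero is multiplicative and carries commutators to
     commutators. *)
  - exists C => // S T fS fT.
    have -> : sandwich i j (bcomp S T - bcomp T S) =
        bcomp (sandwich i j S) (sandwich i j T) - bcomp (sandwich i j T) (sandwich i j S).
      by rewrite sandwichB; congr (_ - _); apply: bopP => x /=; rewrite ji.
    rewrite (le_trans (fC _ _ (fr _ _ _ _ _ _ _ fS) (fr _ _ _ _ _ _ _ fT)))//.
    by rewrite ler_pM ?mulr_ge0 ?rnorm_ge0// ?ler_wpM2l// rnorm_sandwich.
  by exists l, K.
have [l [K1 [K10 fX]]] := corner X i1 j1 infX (fun=> erefl) i1_norm j1_norm waX.
have [l' [K2 [K20 fY]]] := corner Y i2 j2 infY (fun=> erefl) i2_norm j2_norm waY.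
(* Placed off the diagonal, [P] and [Q] give [P Q] in the X-corner of [S T] and [Q P] in the
   Y-corner of [T S], two operators with the same trace. *)
have ll' : l' = l.
  apply/eqP; rewrite -subr_eq0; apply/eqP.
  apply: (@no_bound_multiple (l' - l) (C + K1 + K2) nb) => P Q fP fQ.
  pose S := sandwich i1 j2 P; pose T := sandwich i2 j1 Q.
  have fS : finite_rank S by exact: fr.
  have fT : finite_rank T by exact: fr.
  have fPQ : finite_rank (bcomp P Q) by exact: finite_rank_compl.
  have fQP : finite_rank (bcomp Q P) by exact: finite_rank_compl.
  have STE : bcomp S T = sandwich i1 j1 (bcomp P Q) by exact: bopP.
  have TSE : bcomp T S = sandwich i2 j2 (bcomp Q P) by exact: bopP.
  have h0 : rnorm (f (bcomp S T - bcomp T S)) <= C * (rnorm P * rnorm Q).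
    rewrite (le_trans (fC _ _ fS fT))// -mulrA ler_wpM2l// ler_pM ?rnorm_ge0//;
      exact: rnorm_sandwich.
  have h1 : rnorm (f (bcomp S T) - l * tr (bcomp P Q)) <= K1 * (rnorm P * rnorm Q).
    by rewrite STE (le_trans (fX _ fPQ))// ler_wpM2l// bcomp_norm.
  have h2 : rnorm (f (bcomp T S) - l' * tr (bcomp P Q)) <= K2 * (rnorm P * rnorm Q).
    by rewrite TSE tr_comm// (le_trans (fY _ fQP))// ler_wpM2l// mulrC bcomp_norm.
  have -> : (l' - l) * tr (bcomp P Q) = (f (bcomp S T) - l * tr (bcomp P Q)) -
      (f (bcomp T S) - l' * tr (bcomp P Q)) - f (bcomp S T - bcomp T S).
    by rewrite fr_linearB//; [ring | exact: finite_rank_compl..].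
  rewrite (le_trans (rnormD _ _))// rnormN (le_trans (lerD (rnormD _ _) (lexx _)))// rnormN.
  by rewrite -[leRHS]mulrA; move: h0 h1 h2; set t := rnorm P * rnorm Q; lra.
rewrite {}ll' in fY; exists l; pose g (T : bop Z Z) : R[i]^o := f T - l * tr T.
have lg : fr_linear g by exact: fr_linear_subtr.
apply: (self_induced_functional si lg).
pose p := bcomp i1 j1; pose q := bcomp i2 j2.
have p1 : rnorm p <= 1.
  by rewrite (le_trans (bcomp_norm _ _))// mulr_ile1 ?rnorm_ge0.
have q1 : rnorm q <= 1.
  by rewrite (le_trans (bcomp_norm _ _))// mulr_ile1 ?rnorm_ge0.
have pq1 (z : Z) : p z + q z = z := i1j1 z.
have qp1 (z : Z) : q z + p z = z by rewrite addrC pq1.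
have pq0 (z : Z) : p (q z) = 0 by [].
have qp0 (z : Z) : q (p z) = 0 by [].
(* Off-diagonal blocks have trace zero, so [g] agrees there with [f] and [rnorm_off_diagonal]
   applies. *)
have trpq (U : bop Z Z) : finite_rank U -> tr (sandwich p q U) = 0.
  move=> fU; rewrite tr_sandwich//.
  have -> : bcomp (bcomp q p) U = 0 by apply: bopP => z; exact: qp0.
  exact: tr0.
have trqp (U : bop Z Z) : finite_rank U -> tr (sandwich q p U) = 0.
  move=> fU; rewrite tr_sandwich//.
  have -> : bcomp (bcomp p q) U = 0 by apply: bopP => z; exact: pq0.
  exact: tr0.
exists (K1 + K2 + ((C + C) + (C + C))) => [|S T fS fT].
  by rewrite !addr_ge0.
pose U := bcomp S T; have fU : finite_rank U by exact: finite_rank_compl.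
have nU : rnorm U <= rnorm S * rnorm T := bcomp_norm S T.
have UE : U = sandwich p p U + sandwich q q U + (sandwich p q U + sandwich q p U).
  exact: block_decomposition.
have gX : rnorm (g (sandwich p p U)) <= K1 * (rnorm S * rnorm T).
  have fV : finite_rank (sandwich j1 i1 U) by exact: fr.
  have -> : sandwich p p U = sandwich i1 j1 (sandwich j1 i1 U) by exact: bopP.
  rewrite /g tr_block1// (le_trans (fX _ fV))// ler_wpM2l//.
  by rewrite (le_trans (rnorm_sandwich _ _ _)).
have gY : rnorm (g (sandwich q q U)) <= K2 * (rnorm S * rnorm T).
  have fV : finite_rank (sandwich j2 i2 U) by exact: fr.
  have -> : sandwich q q U = sandwich i2 j2 (sandwich j2 i2 U) by exact: bopP.
  rewrite /g tr_block2// (le_trans (fY _ fV))// ler_wpM2l//.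
  by rewrite (le_trans (rnorm_sandwich _ _ _)).
have gpq : rnorm (g (sandwich p q U)) <= (C + C) * (rnorm S * rnorm T).
  rewrite /g trpq// mulr0 subr0 mulrA.
  exact: (@rnorm_off_diagonal R Z p q _ _ qp0 pq1 p1 q1 f C lf C0 fC S T fS fT).
have gqp : rnorm (g (sandwich q p U)) <= (C + C) * (rnorm S * rnorm T).
  rewrite /g trqp// mulr0 subr0 mulrA.
  exact: (@rnorm_off_diagonal R Z q p _ _ pq0 qp1 q1 p1 f C lf C0 fC S T fS fT).
rewrite -/U UE !(fr_linearD lg); try by [exact: fr | apply: finite_rankD; exact: fr].
rewrite (le_trans (rnormD _ _))// (le_trans (lerD (rnormD _ _) (rnormD _ _)))//.
rewrite -[leRHS]mulrA 3!mulrDl.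
exact: lerD (lerD gX gY) (lerD gpq gqp).
Qed.

End Main.

Theorem theorem3p10 (R : realType) (X Y : completeNormedModType R[i]) :
  ~ finite_dimensional X -> ~ finite_dimensional Y ->
  weakly_amenable (aop X) -> weakly_amenable (aop Y) ->
  (weakly_amenable (aop (X * Y)%type) <->
   self_induced (aop (X * Y)%type) /\
   ereal_sup [set (rnorm (tr (bcomp P Q)))%:E |
     P in finite_rank_ball Y X & Q in finite_rank_ball X Y] = +oo%E).
Proof.
move=> infX infY waX waY; split=> [wa|[si sup_oo]].
  split; first exact: weakly_amenable_self_induced.
  by apply/trace_sup_infinite; exact: weakly_amenable_no_bound.
by apply: weakly_amenable_sum => //; apply/trace_sup_infinite.
Qed.
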